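(* Let $n\ge 3$ be an integer. Then, as $N\to\infty$, every choice of $N$ pairwise distinct points $p_1,\ldots,p_N\in\mathbb{S}^n$ satisfies $$E_{\mathbb{S}^n}(p_1,\ldots,p_N)\;\ge\;-\frac{n^{1+2/n}}{(n^2-4)\,V_n^{1-2/n}\,V_{n-1}^{2/n}}\,N^{2-2/n}+o\left(N^{2-2/n}\right),$$ where the $o(N^{2-2/n})$ term depends only on $n$ and $N$ (not on the points).
   Context: $\mathbb{S}^n\subseteq\mathbb{R}^{n+1}$ is the unit sphere with its standard round Riemannian metric and volume measure $dq$, and $V_m=\mathrm{vol}(\mathbb{S}^m)=\frac{2\pi^{(m+1)/2}}{\Gamma((m+1)/2)}$. The Laplacian is $\Delta=-\mathrm{div}\,\nabla$ (nonnegative convention). The Green function $G(\mathbb{S}^n;\cdot,\cdot)$ is the unique real function, defined and continuous on pairs of distinct points of $\mathbb{S}^n$, such that: (1) $\Delta_q G(\mathbb{S}^n;p,q)=\delta_p(q)-V_n^{-1}$ in the sense of distributions, with $\delta_p$ the Dirac delta at $p$; (2) $G(\mathbb{S}^n;p,q)=G(\mathbb{S}^n;q,p)$; (3) $\int_{\mathbb{S}^n}G(\mathbb{S}^n;p,q)\,dq=0$ for all $p$. The Green energy is $E_{\mathbb{S}^n}(p_1,\ldots,p_N)=\sum_{i\ne j}G(\mathbb{S}^n;p_i,p_j)$, the sum being over ordered pairs $(i,j)$ with $i\neq j$. *)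

(* Defs.v *)
From HB Require Import structures.
From mathcomp Require Import all_boot all_order all_algebra.
From mathcomp Require Import all_classical all_reals all_analysis.

Set Implicit Arguments.
Unset Strict Implicit.
Unset Printing Implicit Defensive.

Import Order.TTheory GRing.Theory Num.Theory.
Import numFieldNormedType.Exports.

Local Open Scope classical_set_scope.
Local Open Scope ring_scope.

Section lebesgue_tuple.
Context {R : realType}.
Local Notation TR := (measurableTypeR R).

Definition cons_pair n (z : n.-tuple TR * TR) : n.+1.-tuple TR :=
  [tuple of z.2 :: z.1].

(* Lebesgue measure on R^n. The domain is [n.-tuple] and not ['rV_n] because
   only the former carries the library's product sigma-algebra. *)
Fixpoint lebesgue_tuple n : set (n.-tuple TR) -> \bar R :=
  match n with
  | 0 => dirac [tuple]
  | m.+1 => pushforward (lebesgue_tuple (n := m) \x lebesgue_measure)%E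
              (@cons_pair m)
  end.

Lemma measurable_cons_pair n : measurable_fun setT (@cons_pair n).
Proof. exact: (measurable_cons measurable_snd measurable_fst). Qed.

Section step.
Variables (n : nat) (mu : {sigma_finite_measure set (n.-tuple TR) -> \bar R}).

Definition lebesgue_step := pushforward (mu \x lebesgue_measure)%E (@cons_pair n).

Let preimage_cons_pairE A : measurable A -> measurable (@cons_pair n @^-1` A).
Proof.
by move=> mA; rewrite -[X in measurable X]setTI; exact: measurable_cons_pair.
Qed.

Local Notation step := lebesgue_step.

Let step0 : step set0 = 0%E.
Proof. by rewrite /lebesgue_step /pushforward preimage_set0 measure0. Qed.

Let step_ge0 A : (0 <= step A)%E.
Proof. by rewrite /lebesgue_step /pushforward measure_ge0. Qed.

Let step_sigma_additive : semi_sigma_additive step.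
Proof.
move=> F mF tF mUF; rewrite /lebesgue_step /pushforward preimage_bigcup.
apply: measure_semi_sigma_additive.
- by move=> i; exact: preimage_cons_pairE.
- apply/trivIsetP => /= i j _ _ ij; rewrite -preimage_setI.
  by move/trivIsetP : tF => /(_ _ _ _ _ ij) ->//; rewrite preimage_set0.
- by rewrite -preimage_bigcup; exact: preimage_cons_pairE.
Qed.

HB.instance Definition _ := isMeasure.Build _ _ _ step
  step0 step_ge0 step_sigma_additive.

Let step_sigma_finite : sigma_finite setT step.
Proof.
have /sigma_finiteP[F [TF ndF Foo]] := sigma_finiteT mu.
have /sigma_finiteP[G [TG ndG Goo]] := sigma_finiteT (@lebesgue_measure R).
pose u (t : n.+1.-tuple TR) : n.-tuple TR * TR :=
  ([tuple of behead t], tnth t ord0).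
have mu_ : measurable_fun setT u.
  by apply/measurable_fun_pair; [exact: measurable_behead|exact: measurable_tnth].
have uK z : u (cons_pair z) = z.
  by case: z => a b; rewrite /u /cons_pair; congr pair; apply/val_inj.
exists (fun i => u @^-1` (F i `*` G i)).
  apply/seteqP; split => // t _.
  have [i _ Fi] : (\bigcup_i F i) (u t).1 by rewrite -TF.
  have [j _ Gj] : (\bigcup_i G i) (u t).2 by rewrite -TG.
  exists (maxn i j) => //; split => /=.
  - by have /subsetPset := ndF _ _ (leq_maxl i j); exact.
  - by have /subsetPset := ndG _ _ (leq_maxr i j); exact.
move=> i; have [mF Fi] := Foo i; have [mG Gi] := Goo i; split.
  by rewrite -[X in measurable X]setTI; apply: mu_ => //; exact: measurableX.
rewrite /lebesgue_step /pushforward -comp_preimage.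
rewrite (_ : u \o @cons_pair n = id); last by apply/funext => z; exact: uK.
by rewrite preimage_id product_measure1E// lte_mul_pinfty// ge0_fin_numE.
Qed.

HB.instance Definition _ := Measure_isSigmaFinite.Build _ _ _ step
  step_sigma_finite.

Lemma lebesgue_tuple_step :
  exists nu : {sigma_finite_measure set (n.+1.-tuple TR) -> \bar R},
    step = nu.
Proof. by exists step. Qed.

End step.

Lemma lebesgue_tuple_sigma_finite_measure n :
  exists mu : {sigma_finite_measure set (n.-tuple TR) -> \bar R},
    lebesgue_tuple (n := n) = mu.
Proof.
elim: n => [|n [mu IH]]; first by exists (dirac [tuple]).
by rewrite /= IH; exact: lebesgue_tuple_step.
Qed.

Section instances.
Variable n : nat.
Local Notation leb := (lebesgue_tuple (n := n)).

Let leb0 : leb set0 = 0%E.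
Proof. by have [mu ->] := lebesgue_tuple_sigma_finite_measure n. Qed.

Let leb_ge0 A : (0 <= leb A)%E.
Proof. by have [mu ->] := lebesgue_tuple_sigma_finite_measure n. Qed.

Let leb_sigma_additive : semi_sigma_additive leb.
Proof.
have [mu ->] := lebesgue_tuple_sigma_finite_measure n.
exact: measure_semi_sigma_additive.
Qed.

HB.instance Definition _ := isMeasure.Build _ _ _ leb
  leb0 leb_ge0 leb_sigma_additive.

Let leb_sigma_finite : sigma_finite setT leb.
Proof.
have [mu ->] := lebesgue_tuple_sigma_finite_measure n.
exact: sigma_finiteT.
Qed.

HB.instance Definition _ := Measure_isSigmaFinite.Build _ _ _ leb
  leb_sigma_finite.

End instances.

End lebesgue_tuple.
Arguments lebesgue_tuple {R} n _.

Section calculus.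
Context {R : realType}.

Definition dotv n (x y : 'rV[R]_n) : R := \sum_(i < n) x 0 i * y 0 i.

Fixpoint Ck {V W : normedModType R} (k : nat) (f : V -> W) : Prop :=
  match k with
  | 0 => continuous f
  | j.+1 => (forall x, differentiable f x) /\ (forall v, Ck j ('D_v f))
  end.

Definition smooth {V W : normedModType R} (f : V -> W) : Prop :=
  forall k, Ck k f.

End calculus.

Section sphere.
Context {R : realType}.

(* The norm [`|x|] of the library on ['rV_n] is the sup norm, so the unit sphere
   is defined through the dot product. *)
Definition sphere n : set 'rV[R]_n.+1 := [set x | dotv x x = 1].
Arguments sphere : clear implicits.

(* Coefficients g_ij = <d_i psi, d_j psi> of the metric induced by the Euclidean
   one on the image of a parametrisation [psi], in the coordinates it defines. *)
Definition induced_metric m n (psi : 'rV[R]_m -> 'rV[R]_n) (x : 'rV[R]_m) :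
    'M[R]_m :=
  \matrix_(i, j) dotv ('D_(delta_mx 0 i) psi x) ('D_(delta_mx 0 j) psi x).

Definition volume_density m n (psi : 'rV[R]_m -> 'rV[R]_n) (x : 'rV[R]_m) : R :=
  Num.sqrt (\det (induced_metric psi x)).

(* The open hemispheres x_0 > 0 ([s = false]) and x_0 < 0 ([s = true]) as graphs
   over the open unit ball of R^n; together they cover the sphere up to the
   equator, which is a null set. *)
Definition hemisphere n (s : bool) (x : 'rV[R]_n) : 'rV[R]_n.+1 :=
  row_mx ((-1) ^+ s * Num.sqrt (1 - dotv x x))%:M x.

Definition row_of_tuple n (t : n.-tuple (measurableTypeR R)) : 'rV[R]_n :=
  \row_i tnth t i.

Definition unit_ball n : set (n.-tuple (measurableTypeR R)) :=
  [set t | dotv (row_of_tuple t) (row_of_tuple t) < 1].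
Arguments unit_ball : clear implicits.

(* The function f sqrt(det g) read in the chart [hemisphere s]. *)
Definition chart_integrand n (s : bool) (f : 'rV[R]_n.+1 -> R)
    (t : n.-tuple (measurableTypeR R)) : R :=
  f (hemisphere s (row_of_tuple t)) *
  volume_density (hemisphere s) (row_of_tuple t).

Definition sphere_integrable n (f : 'rV[R]_n.+1 -> R) : Prop :=
  forall s : bool, (lebesgue_tuple n).-integrable (unit_ball n)
    (EFin \o chart_integrand s f).

Definition sphere_integral n (f : 'rV[R]_n.+1 -> R) : R :=
  \sum_(s : bool)
    \int[lebesgue_tuple n]_(t in unit_ball n) chart_integrand s f t.

Definition sphere_volume n : R := sphere_integral (fun _ : 'rV[R]_n.+1 => 1).

(* Functions and vector fields on the sphere are represented by functions on
   R^{n+1}, smooth ones being restrictions of smooth functions; at points of the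
   sphere the operators below only differentiate along tangent directions, hence
   depend only on the restrictions. *)

Definition tangent_proj n (q v : 'rV[R]_n.+1) : 'rV[R]_n.+1 :=
  v - dotv v q *: q.

Local Notation tangent_dir q i := (tangent_proj q (delta_mx 0 i)).

(* The tangent vector w at q such that <w, v> = D_v phi(q) for all tangent v. *)
Definition sphere_grad n (phi : 'rV[R]_n.+1 -> R) (q : 'rV[R]_n.+1) :
    'rV[R]_n.+1 :=
  \row_i 'D_(tangent_dir q i) phi q.

(* The Levi-Civita connection being the tangential part of the Euclidean
   derivative, div X(q) is the trace of v |-> P_q (D_v X(q)) on the tangent space
   at q, that is the trace of P_q (DX(q)) P_q on R^{n+1}, where P_q is
   [tangent_proj q]. *)
Definition sphere_div n (X : 'rV[R]_n.+1 -> 'rV[R]_n.+1) (q : 'rV[R]_n.+1) : R :=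
  \sum_(i < n.+1) dotv ('D_(tangent_dir q i) X q) (tangent_dir q i).

Definition sphere_laplacian n (phi : 'rV[R]_n.+1 -> R) (q : 'rV[R]_n.+1) : R :=
  - sphere_div (sphere_grad phi) q.

(* Only the values of [G] at pairs of distinct points of the sphere are
   meaningful. Integrability is what makes [G p] a distribution. *)
Record is_green_function n (G : 'rV[R]_n.+1 -> 'rV[R]_n.+1 -> R) : Prop := {
  green_continuous :
    {within [set z : 'rV[R]_n.+1 * 'rV[R]_n.+1 |
              [/\ sphere n z.1, sphere n z.2 & z.1 <> z.2]],
     continuous (fun z => G z.1 z.2)};
  green_integrable : forall p, sphere n p -> sphere_integrable (G p);
  green_laplacian : forall p, sphere n p ->
    forall phi : 'rV[R]_n.+1 -> R, smooth phi ->
    sphere_integral (fun q => G p q * sphere_laplacian phi q) =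
    phi p - (sphere_volume n)^-1 * sphere_integral phi;
  green_sym : forall p q, sphere n p -> sphere n q -> p <> q -> G p q = G q p;
  green_mean0 : forall p, sphere n p -> sphere_integral (G p) = 0
}.

Definition green_energy n (G : 'rV[R]_n.+1 -> 'rV[R]_n.+1 -> R) N
    (p : 'I_N -> 'rV[R]_n.+1) : R :=
  \sum_(i < N) \sum_(j < N | i != j) G (p i) (p j).

End sphere.

Arguments sphere {R} n _.
Arguments unit_ball {R} n _.
Arguments sphere_volume {R} n.

(* Main.v *)
(* The Green function is bounded from below by a positive definite zonal kernel
   plus an error, as in the classical smearing argument.  Let f be a nonnegative
   increasing polynomial of total mass 1 on the sphere, close to the normalised
   indicator of a cap of radius s, and let U(p . q) be the mean zero solution of
   [Delta U = f - 1 / V_n].  Then [H(x, y) = int f(x . q) U(y . q) dq] equals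
   [int <grad U(x . q), grad U(y . q)> dq], so the sum of [H(p_i, p_j)] over all
   i, j is nonnegative.  Replacing f by an approximate identity f_k changes U
   into [U + D_k] where, f_k - f changing sign only once, D_k is increasing;
   hence [D_k >= D_k(-1)], and testing against the coordinate function bounds
   [- D_k(-1)] by about [del = s^2 / (2 (n + 2) V_n)].  Since [U + D_k] tends to
   the Green function off the diagonal, [G(x, y) >= H(x, y) - 2 del], and
   [E >= - N H(p, p) - 2 N^2 del].  For a cap,
   [H(p, p) ~ 2 n s^(2 - n) / ((n^2 - 4) V_(n-1))], and the choice
   [s^n = n V_n / (V_(n-1) N)] gives the constant. *)
Require Import Defs.
From mathcomp Require Import all_boot all_order all_algebra.
From mathcomp Require Import all_classical all_reals all_analysis.
From mathcomp Require Import measurable_realfun ring lra.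

Set Implicit Arguments.
Unset Strict Implicit.
Unset Printing Implicit Defensive.

Import Order.TTheory GRing.Theory Num.Theory.
Import numFieldNormedType.Exports.

Local Open Scope classical_set_scope.
Local Open Scope ring_scope.

(** * Polynomial functions *)

(** The integral over the sphere is given by two graph charts whose density blows up at the equator,
    so neither rotation invariance nor slicing by parallels is at hand. Both come from one fact: a
    rotation generator x_i d_j - x_j d_i applied to a polynomial integrates to 0, because on each
    circle the integrand is an exact derivative. This gives the divergence theorem for the fields e
    grad u(p . q), so the Laplacian of a zonal polynomial integrates to 0. As every polynomial in t
    = p . q is a constant plus such a Laplacian, integrals of zonal polynomials reduce to
    one-dimensional ones with weight (1 - t^2)^((n - 2)/2). Profiles are polynomials because the
    equation of the Green function is tested on smooth functions, and because the solution U for a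
    polynomial profile is again a polynomial. The price is explicit error terms, which vanish as the
    profile tends to a cap. Origin of [del]: on a cap of radius s the mean of 1 - t is about n s^2 /
    (2 (n + 2)), and the coordinate function has eigenvalue n. *)

Section polynomial_expressions.
Context {R : realType}.

(* Polynomials in countably many variables, as syntax: derivatives stay inside
   the syntax, so that smoothness follows from differentiability. *)
Inductive pexp : Type :=
  | PVar of nat
  | PCst of R
  | PAdd of pexp & pexp
  | PMul of pexp & pexp.

Fixpoint peval (e : pexp) (r : nat -> R) : R :=
  match e with
  | PVar i => r i
  | PCst c => c
  | PAdd a b => peval a r + peval b r
  | PMul a b => peval a r * peval b r
  end.

Fixpoint pdif (i : nat) (e : pexp) : pexp :=
  match e with
  | PVar j => PCst (i == j)%:R
  | PCst _ => PCst 0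
  | PAdd a b => PAdd (pdif i a) (pdif i b)
  | PMul a b => PAdd (PMul (pdif i a) b) (PMul a (pdif i b))
  end.

(** Environments have infinitely many variables, but only those below [m] move, so the chain rule
    stays a finite sum. *)
Lemma is_derive_peval (V : normedModType R) (r : V -> nat -> R) (x v : V)
    (dr : nat -> R) m (e : pexp) :
  (forall i, is_derive x v (fun y => r y i) (dr i)) ->
  (forall i, (m <= i)%N -> dr i = 0) ->
  is_derive x v (fun y => peval e (r y))
    (\sum_(i < m) dr i * peval (pdif i e) (r x)).
Proof.
move=> rdr dr0; elim: e => [j|c|a iha b ihb|a iha b ihb] /=.
- have -> : \sum_(i < m) dr i * ((i : nat) == j)%:R = dr j; last exact: rdr.
  have [jm|mj] := ltnP j m.
    rewrite (bigD1 (Ordinal jm))//= eqxx mulr1 big1 ?addr0// => i ij.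
    by rewrite (_ : (i : nat) == j = false) ?mulr0//; apply/negbTE.
  rewrite dr0// big1// => i _.
  by rewrite (_ : (i : nat) == j = false) ?mulr0//; apply/negbTE;
    rewrite neq_ltn (leq_trans _ mj).
- under eq_bigr do rewrite mulr0.
  by rewrite big1_eq; exact: is_derive_cst.
- under eq_bigr do rewrite mulrDr.
  by rewrite big_split/=; exact: is_deriveD.
- apply: (is_derive_eq (is_deriveM iha ihb)).
  rewrite /= !scaler_sumr -big_split/=; apply: eq_bigr => i _.
  by rewrite /GRing.scale/=; ring.
Qed.

Lemma cvg_peval (T : Type) (F : set_system T) (FF : Filter F)
    (r : T -> nat -> R) (l : nat -> R) (e : pexp) :
  (forall i, r y i @[y --> F] --> l i) -> peval e (r y) @[y --> F] --> peval e l.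
Proof.
move=> rl; elim: e => [j|c|a iha b ihb|a iha b ihb] /=.
- exact: rl.
- exact: cvg_cst.
- exact: cvgD.
- exact: cvgM.
Qed.

Lemma measurable_peval d (T : measurableType d) (r : T -> nat -> R) (e : pexp) :
  (forall i, measurable_fun setT (fun y => r y i)) ->
  measurable_fun setT (fun y => peval e (r y)).
Proof.
move=> mr; elim: e => [j|c|a iha b ihb|a iha b ihb] /=.
- exact: mr.
- exact: measurable_cst.
- exact: measurable_funD.
- exact: measurable_funM.
Qed.

(** Crude bound for variables in [-1, 1], where the coordinates of a point of the sphere lie; it
    dominates polynomial integrands by a multiple of the chart density. *)
Fixpoint pbound (e : pexp) : R :=
  match e with
  | PVar _ => 1
  | PCst c => `|c|
  | PAdd a b => pbound a + pbound b
  | PMul a b => pbound a * pbound b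
  end.

Lemma pbound_ge0 e : 0 <= pbound e.
Proof.
by elim: e => [j|c|a iha b ihb|a iha b ihb] //=; rewrite ?addr_ge0 ?mulr_ge0.
Qed.

Lemma peval_bound (r : nat -> R) e :
  (forall i, `|r i| <= 1) -> `|peval e r| <= pbound e.
Proof.
move=> r1; elim: e => [j|c|a iha b ihb|a iha b ihb] //=.
- by rewrite (le_trans (ler_normD _ _))// lerD.
- by rewrite normrM ler_pM.
Qed.

Lemma pdifC i j e r : peval (pdif i (pdif j e)) r = peval (pdif j (pdif i e)) r.
Proof.
by elim: e => [k|c|a iha b ihb|a iha b ihb] //=; rewrite iha ihb//; ring.
Qed.

Lemma is_derive_line (a c x : R) : is_derive x 1 (fun s : R => a + s * c) c.
Proof.
have H := is_deriveD (is_derive_cst a x (1 : R))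
  (is_deriveM (is_derive_id x (1 : R)) (is_derive_cst c x (1 : R))).
by apply: (is_derive_eq H); rewrite scaler0 add0r add0r /GRing.scale/= mulr1.
Qed.

Definition psum (s : seq pexp) : pexp := foldr PAdd (PCst 0) s.

Lemma peval_psum s r : peval (psum s) r = \sum_(e <- s) peval e r.
Proof. by elim: s => [|e s ih]; rewrite ?big_nil// big_cons /= ih. Qed.

Lemma peval_psumE n (F : nat -> pexp) r :
  peval (psum [seq F i | i <- iota 0 n]) r = \sum_(i < n) peval (F i) r.
Proof. by rewrite peval_psum big_map -(big_mkord xpredT (fun i => peval (F i) r))
  /index_iota subn0. Qed.

Lemma peval_psum2 n m (F : nat -> nat -> pexp) r :
  peval (psum [seq psum [seq F j i | i <- iota 0 m] | j <- iota 0 n]) r =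
  \sum_(j < n) \sum_(i < m) peval (F j i) r.
Proof. by rewrite peval_psumE; apply: eq_bigr => j _; exact: peval_psumE. Qed.

Lemma pdif_psum j s r : peval (pdif j (psum s)) r = \sum_(e <- s) peval (pdif j e) r.
Proof. by elim: s => [|e s ih]; rewrite ?big_nil// big_cons /= ih. Qed.

Lemma pdif_psumE j n (F : nat -> pexp) r :
  peval (pdif j (psum [seq F i | i <- iota 0 n])) r =
  \sum_(i < n) peval (pdif j (F i)) r.
Proof. by rewrite pdif_psum big_map
  -(big_mkord xpredT (fun i => peval (pdif j (F i)) r)) /index_iota subn0. Qed.

Lemma pevalM a b r : peval (PMul a b) r = peval a r * peval b r. Proof. by []. Qed.

Lemma pevalD a b r : peval (PAdd a b) r = peval a r + peval b r. Proof. by []. Qed.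

Lemma pdifM i a b : pdif i (PMul a b) = PAdd (PMul (pdif i a) b) (PMul a (pdif i b)).
Proof. by []. Qed.

(* [pzonal n u p] is u(p . x) with p . x taken over the first [n] variables. *)
Definition plin n (p : nat -> R) : pexp :=
  psum [seq PMul (PCst (p i)) (PVar i) | i <- iota 0 n].

Definition pzonal n (u : {poly R}) (p : nat -> R) : pexp :=
  foldr (fun c e => PAdd (PMul e (plin n p)) (PCst c)) (PCst 0) u.

Lemma peval_plin n p r : peval (plin n p) r = \sum_(i < n) p i * r i.
Proof. exact: peval_psumE. Qed.

Lemma pdif_plin n p r j : (j < n)%N -> peval (pdif j (plin n p)) r = p j.
Proof.
move=> jn; rewrite pdif_psumE (bigD1 (Ordinal jn))//= eqxx mul0r add0r mulr1.
rewrite big1 ?addr0// => i ij.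
by rewrite mul0r add0r (_ : j == i = false) ?mulr0//; apply/negbTE;
  rewrite eq_sym.
Qed.

Lemma peval_pzonal n u p r :
  peval (pzonal n u p) r = u.[\sum_(i < n) p i * r i].
Proof.
rewrite /pzonal /horner; elim: (polyseq u) => //= c s ->.
by rewrite peval_plin.
Qed.

Lemma pdif_pzonal n u p r j : (j < n)%N ->
  peval (pdif j (pzonal n u p)) r = p j * u^`().[\sum_(i < n) p i * r i].
Proof.
move=> jn; rewrite -{2}(polyseqK u) /pzonal; elim: (polyseq u) => [|c s ih] /=.
  by rewrite derivC horner0 mulr0.
rewrite ih cons_poly_def derivD derivC addr0 derivM derivX mulr1.
rewrite addr0 pdif_plin// peval_plin !hornerE.
have -> : peval (foldr (fun c e => PAdd (PMul e (plin n p)) (PCst c)) (PCst 0) s) r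
   = (Poly s).[\sum_(i < n) p i * r i].
  rewrite horner_Poly; elim: (s) => //= a t ->.
  by rewrite peval_plin.
ring.
Qed.

End polynomial_expressions.
Arguments pexp : clear implicits.

(** * Integrals of powers of sqrt (u - s^2) *)

Section lebesgue_scaling.
Context {R : realType}.
Local Notation mu := (@lebesgue_measure R).
Local Open Scope ereal_scope.

Lemma lebesgue_measure_scale (r : R) (r0 : (0 < r)%R) (A : set R) : measurable A ->
  pushforward (mscale (NngNum (ltW r0)) mu) ( *%R r : _ -> measurableTypeR R) A
  = mu A.
Proof.
have mr : measurable_fun setT ( *%R r : R -> measurableTypeR R).
  exact: mulrl_measurable.
move=> mA; apply/esym; apply: (@lebesgue_measure_unique R
  (measure_function_pushforward__canonical__measure_function_Measure
    (mscale (NngNum (ltW r0)) mu) mr)) => //.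
move=> _ /= [[a b]] _ <-.
rewrite /pushforward /mscale/=.
have -> : ( *%R r : R -> R) @^-1` `]a, b] = `](a / r)%R, (b / r)%R]%classic.
  apply/seteqP; split => x/=; rewrite !in_itv/=.
    by rewrite ltr_pdivrMr// ler_pdivlMr// mulrC.
  by rewrite ltr_pdivrMr// ler_pdivlMr// mulrC.
rewrite !lebesgue_measure_itv/= !lte_fin ltr_pM2r ?invr_gt0//.
case: ifPn => _; last by rewrite mule0.
rewrite -!EFinB -EFinM; congr EFin.
by rewrite -mulrBl mulrC mulfVK// gt_eqF.
Qed.

Lemma ge0_integral_scale (r : R) (f : R -> \bar R) : (0 < r)%R ->
  measurable_fun setT f -> (forall x, 0 <= f x) ->
  \int[mu]_x f x = r%:E * \int[mu]_x f (r * x)%R.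
Proof.
move=> r0 mf f0.
have mr : measurable_fun setT ( *%R r : R -> measurableTypeR R).
  exact: mulrl_measurable.
transitivity (\int[pushforward (mscale (NngNum (ltW r0)) mu)
    ( *%R r : _ -> measurableTypeR R)]_x f x).
  by apply: eq_measure_integral => A mA _; exact/esym/lebesgue_measure_scale.
rewrite ge0_integral_pushforward// preimage_setT ge0_integral_mscale//.
  exact: measurableT_comp.
by move=> x _; exact: f0.
Qed.

End lebesgue_scaling.

Section kappa.
Context {R : realType}.
Local Notation mu := (@lebesgue_measure R).

(* u ^ ((k - 1) / 2) for u > 0, and 0 for u <= 0 (because 0^-1 = 0) *)
Definition kappa (k : nat) (u : R) : R := Num.sqrt u ^+ k / Num.sqrt u.

Lemma kappa_ge0 k u : 0 <= kappa k u.
Proof. by rewrite mulr_ge0// ?exprn_ge0// ?invr_ge0 sqrtr_ge0. Qed.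

Lemma kappa_le0 k u : u <= 0 -> kappa k u = 0.
Proof. by move=> u0; rewrite /kappa ler0_sqrtr// invr0 mulr0. Qed.

Lemma kappa0 u : kappa 0 u = (Num.sqrt u)^-1.
Proof. by rewrite /kappa expr0 mul1r. Qed.

Lemma kappaSS k u : kappa k.+2 u = Num.sqrt u ^+ k.+1.
Proof.
rewrite /kappa exprS mulrC mulrA; have [->|u0] := eqVneq (Num.sqrt u) 0.
  by rewrite invr0 !mul0r expr0n.
by rewrite mulVf// mul1r.
Qed.

(** With the inverse written as an exponential, measurability follows by composition. *)
Lemma kappaE k u :
  kappa k u = if u <= 0 then 0 else Num.sqrt u ^+ k * expR (- ln (Num.sqrt u)).
Proof.
have [u0|u0] := leP u 0; first exact: kappa_le0.
by rewrite /kappa -[X in _ / X]lnK ?posrE ?sqrtr_gt0// -expRN.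
Qed.

Lemma measurable_kappa k : measurable_fun setT (kappa k).
Proof.
have ms : measurable_fun setT (@Num.sqrt R).
  by apply: continuous_measurable_fun; exact: sqrt_continuous.
rewrite (_ : kappa k = fun u =>
  if u <= 0 then 0 else Num.sqrt u ^+ k * expR (- ln (Num.sqrt u))); last first.
  by apply/funext => u; exact: kappaE.
apply: measurable_fun_ifT => //=; first exact: measurable_fun_ler.
apply: measurable_funM; first exact: measurable_funX.
apply: measurableT_comp; first exact: measurable_expR.
apply: measurable_funN; apply: measurableT_comp => //; exact: measurable_ln.
Qed.

Lemma kappa_scale k r u : 0 < r -> kappa k (r ^+ 2 * u) = kappa k (r ^+ 2) * kappa k u.
Proof.
move=> r0; rewrite /kappa sqrtrM ?sqr_ge0// exprMn invfM; ring.
Qed.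

(** The Beta integral of (1 - s^2)^((k - 1)/2) over [-1, 1]; it turns out to be the ratio of the
    volumes of the spheres of dimensions k + 1 and k. *)
Definition kappa_mass (k : nat) : \bar R := (\int[mu]_s (kappa k (1 - s ^+ 2))%:E)%E.

Lemma measurable_sub_sqr (u : R) : measurable_fun setT (fun s : R => u - s ^+ 2).
Proof. by apply: measurable_funB => //; exact: measurable_funX. Qed.

Lemma kappa_mass_ge0 k : (0 <= kappa_mass k)%E.
Proof. by apply: integral_ge0 => s _; rewrite lee_fin kappa_ge0. Qed.

(** The substitution s = sqrt u s' extracts a power of u. Integrating out one coordinate thus raises
    the exponent by 1/2, and integrals over balls are computed one coordinate at a time. *)
Lemma integral_kappa k (u : R) :
  (\int[mu]_s (kappa k (u - s ^+ 2))%:E = kappa_mass k * (kappa k.+1 u)%:E)%E.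
Proof.
have [u0|u0] := leP u 0.
  rewrite [kappa k.+1 u]kappa_le0// mule0 integral0_eq// => s _.
  by rewrite kappa_le0// lerBlDr (le_trans u0)// addr_ge0 ?sqr_ge0.
have r0 : 0 < Num.sqrt u by rewrite sqrtr_gt0.
rewrite (ge0_integral_scale r0)//; last 2 first.
  by apply/measurable_EFinP/measurableT_comp;
    [exact: measurable_kappa|exact: measurable_sub_sqr].
  by move=> x; rewrite lee_fin kappa_ge0.
transitivity ((Num.sqrt u)%:E *
    \int[mu]_s ((kappa k u)%:E * (kappa k (1 - s ^+ 2))%:E))%E.
  congr (_ * _)%E; apply: eq_integral => s _.
  rewrite -EFinM exprMn -{1}(sqr_sqrtr (ltW u0)) -[in X in X - _](mulr1 (_ ^+ 2)).
  by rewrite -mulrBr kappa_scale// sqr_sqrtr// ltW.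
rewrite ge0_integralZl//; last 3 first.
  by apply/measurable_EFinP/measurableT_comp;
    [exact: measurable_kappa|exact: measurable_sub_sqr].
  by move=> x _; rewrite lee_fin kappa_ge0.
  by rewrite lee_fin kappa_ge0.
rewrite muleA -EFinM muleC; congr (_ * _%:E)%E.
by rewrite /kappa exprS; ring.
Qed.

(** The integrand is singular at both ends. On closed intervals exhausting ]-1, 1[ its primitive is
    the arcsine, which bounds all these integrals by pi. *)
Lemma kappa_mass0_lty : (kappa_mass 0 < +oo)%E.
Proof.
pose b (i : nat) : R := 1 - i.+2%:R^-1.
have b1 i : b i < 1 by rewrite /b ltrBlDr ltrDl invr_gt0.
have b0 i : 0 < b i by rewrite /b subr_gt0 invf_lt1// ltr1n.
have ndb : nondecreasing_seq b.
  by move=> i j ij; rewrite lerD2l lerN2 lef_pV2 ?posrE// ler_nat !ltnS.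
pose F (i : nat) : set R := `[- b i, b i]%classic.
have -> : kappa_mass 0 = (\int[mu]_(s in \bigcup_i F i) (kappa 0 (1 - s ^+ 2))%:E)%E.
  rewrite [RHS]integral_mkcond; apply: eq_integral => s _.
  rewrite patchE; case: ifPn => // /negP sF.
  rewrite kappa_le0// subr_le0 leNgt; apply/negP => s1.
  have {}s1 : `|s| < 1 by rewrite -(@ltr_pXn2r _ 2)// ?nnegrE// expr1n real_normK ?num_real.
  apply: sF; rewrite inE; pose i := Num.truncn (1 - `|s|)^-1.
  have hi : (1 - `|s|)^-1 < i.+1%:R.
    exact: truncnS_gt.
  exists i => //; rewrite /F/= in_itv/= -ler_norml /b lerBrDr -lerBrDl.
  rewrite -[leRHS]invrK lef_pV2 ?posrE ?invr_gt0 ?subr_gt0//.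
  by rewrite (le_trans (ltW hi))// ler_nat.
have mk : measurable_fun setT (fun s : R => (kappa 0 (1 - s ^+ 2))%:E).
  by apply/measurable_EFinP/measurableT_comp;
    [exact: measurable_kappa|exact: measurable_sub_sqr].
have cvgF : ((\int[mu]_(s in F i) (kappa 0 (1 - s ^+ 2))%:E)%E @[i --> \oo] -->
    (\int[mu]_(s in \bigcup_i F i) (kappa 0 (1 - s ^+ 2))%:E)%E).
  apply: ge0_nondecreasing_set_cvg_integral => //.
  - move=> i j ij; rewrite subsetEset /F => s /=; rewrite !in_itv/= => /andP[h1 h2].
    by rewrite (le_trans _ h1) ?lerN2 ?ndb// (le_trans h2) ?ndb.
  - by move=> i; rewrite /F; exact: measurable_itv.
  - by move=> i; exact: measurable_funTS mk.
  - by move=> i s _; rewrite lee_fin kappa_ge0.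
apply: (@le_lt_trans _ _ (pi)%:E); last by rewrite ltry.
rewrite -(cvg_lim _ cvgF)//; apply: lime_le; first by apply/cvg_ex; eexists; exact: cvgF.
apply: nearW => i.
have bb : - b i < b i by rewrite (lt_trans _ (b0 i))// oppr_lt0.
have inb s : - b i <= s <= b i -> -1 < s < 1.
  move=> /andP[s1 s2]; rewrite (le_lt_trans s2)// andbT.
  by rewrite (lt_le_trans _ s1)// ltrN2.
rewrite (@continuous_FTC2 _ _ asin)//.
- rewrite -EFinB lee_fin.
  have /andP[h1 h2] : -1 < b i < 1 by apply: inb; rewrite lexx ltW.
  have /andP[h3 h4] : -1 < - b i < 1 by apply: inb; rewrite lexx ltW.
  rewrite [leRHS](_ : _ = pi / 2 - - (pi / 2)); last by rewrite opprK -splitr.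
  rewrite lerB// ?asin_lepi2// ?asin_geNpi2//; by rewrite ?(ltW h1) ?(ltW h2) ?(ltW h3) ?(ltW h4).
- apply: continuous_in_subspaceT => s; rewrite inE/= in_itv/= => /inb /andP[s1 s2].
  have u0 : Num.sqrt (1 - s ^+ 2) != 0.
    by rewrite gt_eqF// sqrtr_gt0 subr_gt0; nra.
  rewrite /kappa; under eq_fun do rewrite expr0 mul1r.
  apply: cvgV => //.
  apply: (@continuous_comp _ _ _ (fun s : R => 1 - s ^+ 2) (@Num.sqrt R)).
    by apply: cvgB; [exact: cvg_cst|exact: exprn_continuous].
  exact: sqrt_continuous.
- split.
  + move=> s; rewrite in_itv/= => /andP[s1 s2].
    by have := @is_derive1_asin R s (inb _ _); rewrite (ltW s1) (ltW s2) => /(_ isT)[].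
  + apply: cvg_at_right_filter; apply: continuous_asin; apply: inb.
    by rewrite lexx ltW.
  + apply: cvg_at_left_filter; apply: continuous_asin; apply: inb.
    by rewrite lexx ltW.
- move=> s; rewrite in_itv/= => /andP[s1 s2].
  rewrite kappa0 derive1E.
  by have := @is_derive1_asin R s (inb _ _); rewrite (ltW s1) (ltW s2) => /(_ isT)[].
Qed.

Lemma kappa_le_kappa0 k (u : R) : u <= 1 -> kappa k u <= kappa 0 u.
Proof.
move=> u1; rewrite /kappa expr0 ler_wpM2r ?invr_ge0 ?sqrtr_ge0//.
by rewrite exprn_ile1 ?sqrtr_ge0// -sqrtr1 ler_wsqrtr.
Qed.

Lemma kappa_mass_lty k : (kappa_mass k < +oo)%E.
Proof.
apply: le_lt_trans kappa_mass0_lty; apply: ge0_le_integral => //.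
- by move=> s _; rewrite lee_fin kappa_ge0.
- by apply/measurable_EFinP/measurableT_comp;
    [exact: measurable_kappa|exact: measurable_sub_sqr].
- by apply/measurable_EFinP/measurableT_comp;
    [exact: measurable_kappa|exact: measurable_sub_sqr].
- by move=> s _; rewrite lee_fin kappa_le_kappa0// gerBl sqr_ge0.
Qed.

Lemma kappa_mass_fin_num k : kappa_mass k \is a fin_num.
Proof. by rewrite ge0_fin_numE ?kappa_mass_ge0// kappa_mass_lty. Qed.

End kappa.

Section open_interval_ftc.
Context {R : realType}.
Local Notation mu := (@lebesgue_measure R).

(** The derivative may blow up at both ends, so the fundamental theorem is applied on inner closed
    intervals. As they grow, one side converges by domination and the other by continuity of [F]. *)
Lemma integral_derive_oo (g F : R -> R) (r : R) : 0 < r ->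
  mu.-integrable setT (EFin \o g) ->
  (forall s, r <= `|s| -> g s = 0) ->
  (forall s, `|s| < r -> {for s, continuous g}) ->
  (forall s, `|s| < r -> is_derive s (1 : R) F (g s)) ->
  continuous F ->
  (\int[mu]_s (g s)%:E = (F r - F (- r))%:E)%E.
Proof.
move=> r0 ig g0 cg dF cF.
(* The shifted index keeps [b 0] positive. *)
pose b (i : nat) : R := r - r * harmonic i.+1.
have b_r i : b i < r by rewrite /b ltrBlDr ltrDl mulr_gt0// harmonic_gt0.
have b0 i : 0 < b i.
  by rewrite /b subr_gt0 gtr_pMr// /harmonic invf_lt1// ltr1n.
have cvgb : b i @[i --> \oo] --> r.
  rewrite /b -[X in _ --> X]subr0 -[X in _ --> _ - X](mulr0 r).
  apply: cvgB; first exact: cvg_cst.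
  by apply: cvgMr; have := @cvg_harmonic R; rewrite -(@cvg_shiftS R).
pose F_ (i : nat) : set R := `[- b i, b i]%classic.
pose G (i : nat) : R -> \bar R := (EFin \o g) \_ (F_ i).
have cvgG : (\int[mu]_s G i s)%E @[i --> \oo] --> (\int[mu]_s (g s)%:E)%E.
  have mG i : measurable_fun setT (G i).
    apply/(measurable_restrictT _ _).1.
      by rewrite /F_; exact: measurable_itv.
    by apply: measurable_funTS; exact: measurable_int ig.
  have mg : measurable_fun setT (EFin \o g) by exact: measurable_int ig.
  have Gg : {ae mu, forall s, setT s -> G ^~ s @ \oo --> (EFin \o g) s}.
    apply: aeW => s _.
    have [sr|rs] := ltP `|s| r; last first.
      rewrite (_ : G ^~ s = cst 0%E); first by rewrite /= g0//; exact: cvg_cst.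
      by apply/funext => i; rewrite /G patchE /= g0//; case: ifP.
    apply: cvg_near_cst; near=> i.
    rewrite /G patchE mem_set// /F_/= in_itv/= -ler_norml ltW//.
    by near: i; exact: (cvgr_gt _ cvgb).
  have bG : {ae mu, forall s i, setT s -> (`|G i s| <= (abse \o (EFin \o g)) s)%E}.
    apply: aeW => s i _; rewrite /G patchE; case: ifP => // _.
    by rewrite abse0 abse_ge0.
  have [|||||_ _ //] := @dominated_convergence _ _ R mu setT measurableT G
    (EFin \o g) (abse \o (EFin \o g)).
  - exact: mG.
  - exact: mg.
  - exact: Gg.
  - exact: integrable_abse.
  - exact: bG.
have cvgF : (F (b i) - F (- b i))%:E @[i --> \oo] --> (F r - F (- r))%:E.
  apply: cvg_EFin; first exact: nearW.
  apply: cvgB; first exact: (continuous_cvg _ (cF r) cvgb).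
  by apply: (continuous_cvg _ (cF (- r))); exact: cvgN.
have E : (fun i => \int[mu]_s G i s)%E = (fun i => (F (b i) - F (- b i))%:E).
  apply/funext => i; rewrite /G -integral_mkcond EFinB.
  have inb s : - b i <= s <= b i -> `|s| < r.
    by rewrite -ler_norml => /le_lt_trans; apply.
  apply: continuous_FTC2.
  - by rewrite (lt_trans _ (b0 i))// oppr_lt0.
  - by apply: continuous_in_subspaceT => s; rewrite inE/= in_itv/= => /inb /cg.
  - split.
    + move=> s; rewrite in_itv/= => /andP[s1 s2].
      by have [] := dF s (inb s _); first by rewrite (ltW s1) (ltW s2).
    + by apply: cvg_at_right_filter; exact: cF.
    + by apply: cvg_at_left_filter; exact: cF.
  - move=> s; rewrite in_itv/= => /andP[s1 s2].
    by rewrite derive1E; have [] := dF s (inb s _); first by rewrite (ltW s1) (ltW s2).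
rewrite E in cvgG.
by apply: (cvg_unique _ cvgG cvgF).
Unshelve. all: by end_near. Qed.

End open_interval_ftc.

(** * Rotation generators on a circle *)

Section rotation1.
Context {R : realType}.
Local Notation mu := (@lebesgue_measure R).

(* The generator x_i d/dx_j - x_j d/dx_i of rotations in the plane (i, j). *)
Definition prot (i j : nat) (e : pexp R) : pexp R :=
  PAdd (PMul (@PVar R i) (pdif j e)) (PMul (PCst (-1)) (PMul (@PVar R j) (pdif i e))).

Lemma peval_prot i j e r :
  peval (prot i j e) r = r i * peval (pdif j e) r - r j * peval (pdif i e) r.
Proof. by rewrite /= mulN1r. Qed.

Definition upd2 (c : nat -> R) (v : nat) (x b : R) : nat -> R :=
  fun i => if i == 0%N then x else if i == v then b else c i.

(** The circle x_0^2 + x_v^2 = u is parametrised by b = x_v, the two signs giving its two arcs. [c]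
    freezes the other coordinates, and [kappa 0] is the arc length density up to the factor sqrt
    u. *)
Definition rot_integrand (c : nat -> R) v u e (b : R) : R :=
  \sum_(s : bool) peval (prot 0 v e) (upd2 c v ((-1) ^+ s * Num.sqrt (u - b ^+ 2)) b)
    * kappa 0 (u - b ^+ 2).

Lemma continuous_sum_bool (f : bool -> R -> R) (b : R) :
  (forall s, {for b, continuous (f s)}) ->
  {for b, continuous (fun y => \sum_(s : bool) f s y)}.
Proof.
move=> cf; rewrite (_ : (fun y => _) = f true \+ f false); last first.
  by apply/funext => y; rewrite big_bool.
by apply: cvgD; exact: cf.
Qed.

Lemma measurable_sqrt : measurable_fun setT (@Num.sqrt R).
Proof. by apply: continuous_measurable_fun; exact: sqrt_continuous. Qed.

Lemma continuous_sqrt_sub_sqr (u : R) : continuous (fun b : R => Num.sqrt (u - b ^+ 2)).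
Proof.
move=> b; apply: (@continuous_comp _ _ _ (fun s : R => u - s ^+ 2) (@Num.sqrt R)).
  by apply: cvgB; [exact: cvg_cst|exact: exprn_continuous].
exact: sqrt_continuous.
Qed.

Lemma integrable_rot_integrand c v u e : (forall i, `|c i| <= 1) -> u <= 1 ->
  mu.-integrable setT (EFin \o rot_integrand c v u e).
Proof.
move=> c1 u1.
have pb0 := pbound_ge0 (prot 0 v e).
have mk : measurable_fun setT (fun b : R => kappa 0 (u - b ^+ 2)).
  by apply: measurableT_comp; [exact: measurable_kappa|exact: measurable_sub_sqr].
have ik : mu.-integrable setT (fun b => (2 * pbound (prot 0 v e))%:E *
    (kappa 0 (u - b ^+ 2))%:E)%E.
  apply: integrableZl => //; apply/integrableP; split; first exact/measurable_EFinP.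
  under eq_integral do rewrite gee0_abs ?lee_fin ?kappa_ge0//.
  rewrite integral_kappa lte_mul_pinfty ?kappa_mass_ge0 ?kappa_mass_fin_num//.
  by rewrite ltry.
apply: le_integrable ik => //.
  apply/measurable_EFinP; apply: measurable_sum => s.
  apply: measurable_funM => //; apply: measurable_peval => i; rewrite /upd2.
  case: (i == 0%N).
    apply: measurable_funM; first exact: measurable_cst.
    by apply: measurableT_comp; [exact: measurable_sqrt|exact: measurable_sub_sqr].
  by case: (i == v); [exact: measurable_id|exact: measurable_cst].
set pb := pbound (prot 0 v e) in pb0 *.
move=> b _ /=; rewrite lee_fin normrM [`|2 * pb|]ger0_norm ?mulr_ge0//.
rewrite (ger0_norm (kappa_ge0 _ _)) /rot_integrand -mulr_suml normrM.
rewrite (ger0_norm (kappa_ge0 _ _)).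
have [ub|ub] := leP (u - b ^+ 2) 0; first by rewrite kappa_le0// !mulr0.
rewrite ler_wpM2r ?kappa_ge0// big_bool/= mulrDl mul1r.
have b1 : `|b| <= 1.
  by rewrite -(@ler_pXn2r _ 2)// ?nnegrE// expr1n real_normK ?num_real//; lra.
have bd s : forall i, `|upd2 c v ((-1) ^+ s * Num.sqrt (u - b ^+ 2)) b i| <= 1.
  move=> i; rewrite /upd2; case: ifP => _; last by case: ifP.
  rewrite normrM normrX normrN1 expr1n mul1r ger0_norm ?sqrtr_ge0//.
  by rewrite -sqrtr1 ler_wsqrtr//; nra.
rewrite (le_trans (ler_normD _ _))// lerD//.
- exact: (peval_bound (prot 0 v e) (bd true)).
- exact: (peval_bound (prot 0 v e) (bd false)).
Qed.

Lemma is_derive_sqrt_sub_sqr (u b : R) : 0 < u - b ^+ 2 ->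
  is_derive b 1 (fun b : R => Num.sqrt (u - b ^+ 2)) (- b / Num.sqrt (u - b ^+ 2)).
Proof.
move=> ub.
have H1 : is_derive b 1 (fun b : R => u - b ^+ 2) (- (2 * b)).
  have := is_deriveB (is_derive_cst u b (1 : R)) (is_deriveX 2 (is_derive_id b (1 : R))).
  by move=> H; apply: (is_derive_eq H); rewrite sub0r expr1 /GRing.scale/= mulr1 mulr_natl.
have H2 := is_derive1_sqrt ub.
have H := @is_derive1_comp _ (@Num.sqrt R) (fun b : R => u - b ^+ 2) b _ _ H2 H1.
apply: (is_derive_eq H); rewrite invfM.
have : Num.sqrt (u - b ^+ 2) != 0 by rewrite gt_eqF// sqrtr_gt0.
by move=> ?; field.
Qed.

(* On the open interval the integrand is the derivative of
   h (sqrt (u - b^2), b) - h (- sqrt (u - b^2), b), which vanishes at both ends. *)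
Lemma integral_rot_integrand c v u e : (0 < v)%N -> (forall i, `|c i| <= 1) -> u <= 1 ->
  (\int[mu]_b (rot_integrand c v u e b)%:E = 0)%E.
Proof.
move=> v0 c1 u1.
have [u0|u0] := leP u 0.
  apply: integral0_eq => b _; rewrite /rot_integrand -mulr_suml kappa_le0 ?mulr0//.
  by rewrite lerBlDr (le_trans u0)// addr_ge0 ?sqr_ge0.
have r0 : 0 < Num.sqrt u by rewrite sqrtr_gt0.
have small (b : R) : `|b| < Num.sqrt u -> 0 < u - b ^+ 2.
  move=> bu; rewrite subr_gt0 -(sqr_sqrtr (ltW u0)) -[ltLHS]real_normK ?num_real//.
  by rewrite ltr_pXn2r// nnegrE// ltW.
pose F (b : R) := \sum_(s : bool) (-1) ^+ s *
  peval e (upd2 c v ((-1) ^+ s * Num.sqrt (u - b ^+ 2)) b).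
have cr (s : bool) (b : R) i : upd2 c v ((-1) ^+ s * Num.sqrt (u - y ^+ 2)) y i @[y --> b] -->
    upd2 c v ((-1) ^+ s * Num.sqrt (u - b ^+ 2)) b i.
  rewrite /upd2; case: (i == 0%N).
    by apply: cvgMr; exact: continuous_sqrt_sub_sqr.
  by case: (i == v); [exact: cvg_id|exact: cvg_cst].
transitivity (F (Num.sqrt u) - F (- Num.sqrt u))%:E; last first.
  have F0 (b : R) : b ^+ 2 = u -> F b = 0.
    move=> bu; rewrite /F big_bool/= bu subrr sqrtr0 !mulr0.
    by rewrite expr0 expr1 mul1r mulN1r addrC subrr.
  by rewrite !F0 ?subrr// ?sqrrN sqr_sqrtr// ltW.
apply: (integral_derive_oo r0).
- exact: integrable_rot_integrand.
- move=> b ub; rewrite /rot_integrand -mulr_suml kappa_le0 ?mulr0// subr_le0.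
  rewrite -(sqr_sqrtr (ltW u0)) -[leRHS]real_normK ?num_real//.
  by rewrite ler_pXn2r// nnegrE// ltW.
- move=> b /small ub; rewrite /rot_integrand.
  apply: continuous_sum_bool => s; apply: cvgM.
    by apply: cvg_peval => i; exact: cr.
  have -> : (fun y : R => kappa 0 (u - y ^+ 2)) = (fun y => (Num.sqrt (u - y ^+ 2))^-1).
    by apply/funext => y; rewrite kappa0.
  rewrite kappa0; apply: cvgV; last exact: continuous_sqrt_sub_sqr.
  by rewrite gt_eqF// sqrtr_gt0.
- move=> b /small ub.
  have sq0 : Num.sqrt (u - b ^+ 2) != 0 by rewrite gt_eqF// sqrtr_gt0.
  have D (s : bool) : is_derive b 1 (fun y => peval e (upd2 c v ((-1) ^+ s * Num.sqrt (u - y ^+ 2)) y))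
     ((-1) ^+ s * (- b / Num.sqrt (u - b ^+ 2)) *
        peval (pdif 0 e) (upd2 c v ((-1) ^+ s * Num.sqrt (u - b ^+ 2)) b) +
      peval (pdif v e) (upd2 c v ((-1) ^+ s * Num.sqrt (u - b ^+ 2)) b)).
    pose dr (i : nat) : R := if i == 0%N then (-1) ^+ s * (- b / Num.sqrt (u - b ^+ 2))
      else (i == v)%:R.
    have := @is_derive_peval R R (fun y => upd2 c v ((-1) ^+ s * Num.sqrt (u - y ^+ 2)) y)
       b 1 dr v.+1 e.
    move=> H; apply: is_derive_eq.
      apply: H => i.
        rewrite /upd2 /dr; case: (i == 0%N).
          exact: (is_deriveZ ((-1) ^+ s) (is_derive_sqrt_sub_sqr ub)).
        by case: (i == v); [exact: is_derive_id|exact: is_derive_cst].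
      by move=> vi; rewrite /dr !gtn_eqF// (leq_trans _ vi).
    clear H; case: (v) v0 @dr => // v' _ dr.
    rewrite big_ord_recl big_ord_recr/= /dr/= eqxx mul1r big1 ?add0r// => i _.
    by rewrite /= /bump/= add1n eqSS ltn_eqF ?mul0r.
  have D2 := is_deriveD (is_deriveZ ((-1) ^+ true) (D true)) (is_deriveZ ((-1) ^+ false) (D false)).
  have -> : F = (fun y => (-1) ^+ true *: peval e (upd2 c v ((-1) ^+ true * Num.sqrt (u - y ^+ 2)) y)
     + (-1) ^+ false *: peval e (upd2 c v ((-1) ^+ false * Num.sqrt (u - y ^+ 2)) y)).
    by apply/funext => y; rewrite /F big_bool.
  apply: (is_derive_eq D2).
  rewrite /rot_integrand big_bool !peval_prot kappa0 /GRing.scale /=.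
  have uv x : upd2 c v x b v = b by rewrite /upd2 gtn_eqF// eqxx.
  have u00 x : upd2 c v x b 0 = x by [].
  rewrite !uv !u00 expr0 expr1.
  by field.
- move=> b; apply: continuous_sum_bool => s; apply: cvgMr.
  by apply: cvg_peval => i; exact: cr.
Qed.

End rotation1.

(** * Integration over the unit ball *)

Section tuple_integrals.
Context {R : realType}.
Local Notation mu := (@lebesgue_measure R).
Local Notation TR := (measurableTypeR R).

Definition sqn n (t : n.-tuple TR) : R := \sum_(i < n) tnth t i ^+ 2.

Lemma sqn_ge0 n (t : n.-tuple TR) : 0 <= sqn t.
Proof. by apply: sumr_ge0 => i _; exact: sqr_ge0. Qed.

Lemma sqn_cons n (a : n.-tuple TR) (b : TR) :
  sqn (cons_pair (a, b)) = b ^+ 2 + sqn a.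
Proof.
rewrite /sqn big_ord_recl; congr (_ + _).
by apply: eq_bigr => i _; rewrite /cons_pair tnthS.
Qed.

Lemma measurable_sqn n : measurable_fun setT (@sqn n).
Proof.
apply: measurable_sum => i; apply: measurable_funX.
exact: measurable_tnth.
Qed.

Lemma measurable_sub_sqn n (r : R) : measurable_fun setT (fun t : n.-tuple TR => r - sqn t).
Proof. by apply: measurable_funB => //; exact: measurable_sqn. Qed.

Lemma measurable_kappa_sqn n k (r : R) :
  measurable_fun setT (fun t : n.-tuple TR => kappa k (r - sqn t)).
Proof.
by apply: measurableT_comp; [exact: measurable_kappa|exact: measurable_sub_sqn].
Qed.

Lemma ge0_integral_tuple_cons n (f : n.+1.-tuple TR -> \bar R) :
  measurable_fun setT f -> (forall t, 0 <= f t)%E ->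
  (\int[lebesgue_tuple n.+1]_t f t =
   \int[lebesgue_tuple n]_a \int[mu]_b f (cons_pair (a, b)))%E.
Proof.
move=> mf f0.
transitivity (\int[pushforward (lebesgue_tuple n \x mu) (@cons_pair R n)]_t f t)%E; first by [].
rewrite ge0_integral_pushforward//; last exact: measurable_cons_pair.
rewrite preimage_setT; apply: (fubini_tonelli1 (f \o @cons_pair R n)) => //=.
by apply: measurableT_comp => //; exact: measurable_cons_pair.
Qed.

Lemma integrable_tuple_cons n (f : n.+1.-tuple TR -> \bar R) :
  (lebesgue_tuple n.+1).-integrable setT f ->
  (lebesgue_tuple n \x mu)%E.-integrable setT (f \o @cons_pair R n).
Proof.
move=> /integrableP[mf foo]; apply/integrableP; split.
  by apply: measurableT_comp => //; exact: measurable_cons_pair.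
move: foo.
rewrite (_ : (\int[lebesgue_tuple n.+1]_x `|f x|)%E =
  (\int[pushforward (lebesgue_tuple n \x mu) (@cons_pair R n)]_t `|f t|)%E)//.
rewrite ge0_integral_pushforward//; first exact: measurable_cons_pair.
by apply: measurableT_comp.
Qed.

Lemma integral_tuple_cons_prod n (f : n.+1.-tuple TR -> \bar R) :
  (lebesgue_tuple n.+1).-integrable setT f ->
  (\int[lebesgue_tuple n.+1]_t f t =
   \int[(lebesgue_tuple n \x mu)%E]_z f (cons_pair z))%E.
Proof.
move=> intf.
transitivity (\int[pushforward (lebesgue_tuple n \x mu) (@cons_pair R n)]_t f t)%E; first by [].
rewrite integral_pushforward// ?preimage_setT//.
- exact: measurable_cons_pair.
- exact: measurable_int intf.
- exact: integrable_tuple_cons.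
Qed.

Lemma integral_tuple_cons1 n (f : n.+1.-tuple TR -> \bar R) :
  (lebesgue_tuple n.+1).-integrable setT f ->
  (\int[lebesgue_tuple n.+1]_t f t =
   \int[lebesgue_tuple n]_a \int[mu]_b f (cons_pair (a, b)))%E.
Proof.
move=> intf; rewrite integral_tuple_cons_prod// -integral12_prod_meas1//.
exact: integrable_tuple_cons.
Qed.

Lemma integral_tuple_cons2 n (f : n.+1.-tuple TR -> \bar R) :
  (lebesgue_tuple n.+1).-integrable setT f ->
  (\int[lebesgue_tuple n.+1]_t f t =
   \int[mu]_b \int[lebesgue_tuple n]_a f (cons_pair (a, b)))%E.
Proof.
move=> intf; rewrite integral_tuple_cons_prod// -integral21_prod_meas1//.
exact: integrable_tuple_cons.
Qed.

Definition kmass (k : nat) : R := fine (@kappa_mass R k).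

Lemma kmass_ge0 k : 0 <= kmass k.
Proof. by rewrite fine_ge0// kappa_mass_ge0. Qed.

(** Each coordinate integrated out raises the index of [kappa] by one and contributes one Beta
    integral. *)
Lemma integral_kappa_sqn n k (r : R) :
  (\int[lebesgue_tuple n]_t (kappa k (r - sqn t))%:E =
   (\prod_(j < n) kmass (k + j) * kappa (k + n) r)%:E)%E.
Proof.
elim: n k => [|n ih] k.
  rewrite big_ord0 mul1r addn0.
  transitivity ((\int[dirac ([tuple] : 0.-tuple TR)]_t (kappa k (r - sqn t))%:E)%E); first by [].
  rewrite integral_dirac//; last first.
    by apply/measurable_EFinP; exact: measurable_kappa_sqn.
  by rewrite diracT mul1e /sqn big_ord0 subr0.
rewrite ge0_integral_tuple_cons//; last 2 first.
  by apply/measurable_EFinP; exact: measurable_kappa_sqn.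
  by move=> t; rewrite lee_fin kappa_ge0.
transitivity (\int[lebesgue_tuple n]_a ((kmass k)%:E * (kappa k.+1 (r - sqn a))%:E))%E.
  apply: eq_integral => a _.
  rewrite fineK ?kappa_mass_fin_num// -integral_kappa; apply: eq_integral => b _.
  by rewrite sqn_cons; congr (kappa _ _)%:E; ring.
rewrite ge0_integralZl//; last 3 first.
  by apply/measurable_EFinP; exact: measurable_kappa_sqn.
  by move=> t _; rewrite lee_fin kappa_ge0.
  by rewrite lee_fin kmass_ge0.
rewrite ih -EFinM big_ord_recl addn0 mulrA addSnnS; congr (_ * _ * _)%:E.
by apply: eq_bigr => j _; rewrite /= /bump/= add1n addSnnS.
Qed.

Lemma integrable_kappa_sqn n k (r : R) :
  (lebesgue_tuple n).-integrable setT (fun t => (kappa k (r - sqn t))%:E).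
Proof.
apply/integrableP; split; first by apply/measurable_EFinP; exact: measurable_kappa_sqn.
under eq_integral do rewrite gee0_abs ?lee_fin ?kappa_ge0//.
by rewrite integral_kappa_sqn ltry.
Qed.

(** Coordinates of a point in a partly integrated chart: [x] is the height given by the graph, [pre]
    holds the coordinates already frozen, [t] those still to be integrated, and all further ones are
    0. *)
Definition tenv (x : R) (pre t : seq R) : nat -> R := fun i => nth 0 (x :: pre ++ t) i.

Lemma measurable_tenv n (f : n.-tuple TR -> R) pre i : measurable_fun setT f ->
  measurable_fun setT (fun t : n.-tuple TR => tenv (f t) pre t i).
Proof.
move=> mf; rewrite /tenv; case: i => [|i] //=.
under eq_fun do rewrite nth_cat.
case: (i < size pre)%N; first exact: measurable_cst.
have [jn|nj] := ltnP (i - size pre) n.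
  rewrite (_ : (fun t => _) = (fun t => tnth t (Ordinal jn))); first exact: measurable_tnth.
  by apply/funext => t; rewrite (tnth_nth 0).
rewrite (_ : (fun t => _) = cst 0); first exact: measurable_cst.
by apply/funext => t; rewrite nth_default// size_tuple.
Qed.

Lemma le_norm1 (x y : R) : 0 <= y -> x ^+ 2 + y <= 1 -> `|x| <= 1.
Proof.
move=> y0 xy; rewrite -(@ler_pXn2r _ 2)// ?nnegrE// expr1n real_normK ?num_real//.
by rewrite (le_trans _ xy)// lerDl.
Qed.

Lemma sum_sqr_ge0 (s : seq R) : 0 <= \sum_(x <- s) x ^+ 2.
Proof. by apply: sumr_ge0 => i _; exact: sqr_ge0. Qed.

Lemma sum_sqr_nth (s : seq R) i : nth 0 s i ^+ 2 <= \sum_(x <- s) x ^+ 2.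
Proof.
have [h|h] := ltnP i (size s); last by rewrite nth_default// expr0n sum_sqr_ge0.
rewrite (big_nth 0) big_mkord (bigD1 (Ordinal h))//= lerDl.
by apply: sumr_ge0 => j _; exact: sqr_ge0.
Qed.

Lemma sqn_seq n (t : n.-tuple TR) : sqn t = \sum_(x <- t) (x : R) ^+ 2.
Proof. by rewrite [RHS]big_tuple. Qed.

Lemma tenv_le1 n (t : n.-tuple TR) pre (r x : R) :
  \sum_(y <- pre) y ^+ 2 + r <= 1 -> x ^+ 2 + sqn t = r ->
  forall i, `|tenv x pre t i| <= 1.
Proof.
move=> Hr xr i; apply: (@le_norm1 _ 0) => //; rewrite addr0.
apply: le_trans (sum_sqr_nth _ _) _; rewrite big_cons big_cat/= -sqn_seq.
by rewrite (le_trans _ Hr)// -xr addrCA.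
Qed.

Lemma sqr_sign_sqrt (s : bool) (u : R) : 0 <= u -> ((-1) ^+ s * Num.sqrt u) ^+ 2 = u.
Proof. by move=> u0; rewrite exprMn sqrr_sign mul1r sqr_sqrtr. Qed.

Definition ball_integrand n pre (r : R) e (s : bool) (t : n.-tuple TR) : R :=
  peval e (tenv ((-1) ^+ s * Num.sqrt (r - sqn t)) pre t) * kappa 0 (r - sqn t).

Lemma integrable_ball_integrand n pre (r : R) e s :
  \sum_(y <- pre) y ^+ 2 + r <= 1 ->
  (lebesgue_tuple n).-integrable setT (EFin \o @ball_integrand n pre r e s).
Proof.
move=> Hr; have pb0 := pbound_ge0 e; set pb := pbound e in pb0 *.
have ik : (lebesgue_tuple n).-integrable setT (fun t => pb%:E * (kappa 0 (r - sqn t))%:E)%E.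
  by apply: integrableZl => //; exact: integrable_kappa_sqn.
apply: le_integrable ik => //.
  apply/measurable_EFinP; apply: measurable_funM; last exact: measurable_kappa_sqn.
  apply: measurable_peval => i; apply: measurable_tenv.
  apply: measurable_funM; first exact: measurable_cst.
  by apply: measurableT_comp; [exact: measurable_sqrt|exact: measurable_sub_sqn].
move=> t _ /=; rewrite lee_fin /ball_integrand normrM [leRHS]normrM [`|pb|]ger0_norm//.
have [u0|u0] := leP (r - sqn t) 0; first by rewrite kappa_le0// normr0 !mulr0.
rewrite ler_wpM2r// peval_bound// => i.
by apply: tenv_le1 Hr _ _; rewrite sqr_sign_sqrt ?ltW// subrK.
Qed.

Definition ball_rot n pre (r : R) v e (t : n.-tuple TR) : R :=
  \sum_(s : bool) @ball_integrand n pre r (prot 0 v e) s t.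

Lemma integrable_ball_rot n pre (r : R) v e :
  \sum_(y <- pre) y ^+ 2 + r <= 1 ->
  (lebesgue_tuple n).-integrable setT (EFin \o @ball_rot n pre r v e).
Proof.
move=> Hr; rewrite (_ : EFin \o _ = (EFin \o @ball_integrand n pre r (prot 0 v e) true) \+
   (EFin \o @ball_integrand n pre r (prot 0 v e) false)); last first.
  by apply/funext => t; rewrite /= /ball_rot big_bool.
by apply: integrableD => //; exact: integrable_ball_integrand.
Qed.

Lemma ball_rot_cons_head n pre (r : R) e (a : n.-tuple TR) :
  \sum_(y <- pre) y ^+ 2 + r <= 1 ->
  (\int[mu]_b (ball_rot pre r (size pre).+1 e (cons_pair (a, b)))%:E = 0)%E.
Proof.
move=> Hr.
have sr b : r - sqn (cons_pair (a, b)) = r - sqn a - b ^+ 2.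
  by rewrite sqn_cons; ring.
have [u0|u0] := leP (r - sqn a) 0.
  apply: integral0_eq => b _; rewrite /ball_rot /ball_integrand -mulr_suml.
  by rewrite sr kappa_le0 ?mulr0// lerBlDr (le_trans u0)// addr_ge0 ?sqr_ge0.
pose c := tenv 0 pre (0 :: a).
have c1 i : `|c i| <= 1.
  apply: (@le_norm1 _ 0) => //; rewrite addr0.
  apply: le_trans (sum_sqr_nth _ _) _.
  rewrite big_cons big_cat/= big_cons expr0n/= !add0r -sqn_seq.
  by rewrite (le_trans _ Hr)// lerD2l -subr_ge0 ltW.
have u1 : r - sqn a <= 1.
  rewrite (le_trans _ Hr)// (@le_trans _ _ r)//.
    by rewrite gerBl sqn_ge0.
  by rewrite lerDr sum_sqr_ge0.
rewrite -[RHS](@integral_rot_integrand R c (size pre).+1 (r - sqn a) e)//.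
apply: eq_integral => b _; congr EFin; rewrite /ball_rot /rot_integrand.
apply: eq_bigr => s _; rewrite /ball_integrand sr; congr (peval _ _ * _).
apply/funext => i; rewrite /tenv /upd2 /c /tenv; case: i => [|i] //=.
rewrite eqSS !nth_cat; case: ltngtP => // h.
  by rewrite -(subnSK h).
by rewrite h subnn.
Qed.

Lemma ball_rot_cons_tail n pre (r : R) v e (a : n.-tuple TR) (b : TR) :
  ball_rot pre r v e (cons_pair (a, b)) = ball_rot (rcons pre b) (r - b ^+ 2) v e a.
Proof.
apply: eq_bigr => s _; rewrite /ball_integrand.
rewrite (_ : r - sqn (cons_pair (a, b)) = r - b ^+ 2 - sqn a); last first.
  by rewrite sqn_cons; ring.
by congr (peval _ _ * _); rewrite /tenv /= cat_rcons.
Qed.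

(** If the rotating coordinate is the first one left, it is integrated first, and the inner integral
    is one over a circle. Otherwise the first coordinate [b] is integrated last: it joins [pre]
    while [r] drops by b^2, which preserves the bound on [pre] and [r] that keeps all coordinates in
    [-1, 1]. *)
Lemma integral_ball_rot n pre (r : R) j e : (j < n)%N ->
  \sum_(y <- pre) y ^+ 2 + r <= 1 ->
  (\int[lebesgue_tuple n]_t (ball_rot pre r (size pre + j).+1 e t)%:E = 0)%E.
Proof.
elim: n pre r j => [|n ih] pre r [|j]// jn Hr.
  rewrite integral_tuple_cons1; last exact: integrable_ball_rot.
  apply: integral0_eq => a _; rewrite addn0; exact: ball_rot_cons_head.
rewrite integral_tuple_cons2; last exact: integrable_ball_rot.
apply: integral0_eq => b _.
under eq_integral => a _ do rewrite ball_rot_cons_tail.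
rewrite -addSnnS -(size_rcons pre b); apply: ih => //.
by rewrite -cats1 big_cat/= big_seq1 -addrA (addrC (_ ^+ 2)) subrK.
Qed.

End tuple_integrals.

(** * The hemisphere charts *)

Section rank_one_determinant.
Context {F : comNzRingType}.

(** Both sides are the determinant of one block matrix, factored in two ways. *)
Lemma det_add_rank1 n (u : 'cV[F]_n) (v : 'rV[F]_n) :
  \det (1%:M + u *m v) = 1 + (v *m u) 0 0.
Proof.
pose A : 'M[F]_(1 + n) := block_mx 1%:M (- v) u 1%:M.
have E1 : A = block_mx 1%:M 0 u 1%:M *m block_mx 1%:M (- v) 0 (1%:M + u *m v).
  rewrite mulmx_block !mul1mx !mul0mx !mulmx1 ?mulmx0 !addr0 ?add0r mulmxN.
  by rewrite addrCA addNr addr0.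
have E2 : A = block_mx 1%:M (- v) 0 1%:M *m block_mx (1%:M + v *m u) 0 u 1%:M.
  by rewrite mulmx_block !mul1mx !mul0mx !mulmx1 ?mulmx0 !add0r mulNmx addrK.
have : \det A = \det A by [].
rewrite {1}E1 E2 !det_mulmx !det_lblock !det_ublock !det1 !mul1r mulr1 => ->.
by rewrite det_mx11 !mxE eqxx.
Qed.

End rank_one_determinant.

Section hemisphere_chart.
Context {R : realType}.
Local Notation TR := (measurableTypeR R).

Lemma is_derive_along (V W : normedModType R) (f : V -> W) (x v : V) (d : W) :
  is_derive (0 : R) 1 (fun h => f (h *: v + x)) d -> is_derive x v f d.
Proof.
have E : (fun h : R => h^-1 *: ((f \o shift x) (h *: v) - f x)) =
   (fun h : R => h^-1 *: (((fun h => f (h *: v + x)) \o shift 0) (h *: (1 : R)) - f (0 *: v + x))).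
  by rewrite funeqE => h /=; rewrite addr0 scale0r add0r [_%:A]mulr1.
move=> [dv ev]; split; first exact/derivable1P.
by rewrite -ev /derive E.
Qed.

Lemma is_derive_coord n (x v : 'rV[R]_n) j :
  is_derive x v (fun y : 'rV[R]_n => y 0 j) (v 0 j).
Proof.
apply: is_derive_along.
rewrite (_ : (fun h => _) = (fun h => x 0 j + h * v 0 j)); last first.
  by apply/funext => h; rewrite !mxE addrC.
exact: is_derive_line.
Qed.

Lemma dotvC n (x y : 'rV[R]_n) : dotv x y = dotv y x.
Proof. by apply: eq_bigr => i _; rewrite mulrC. Qed.

Lemma dotvDl n (x y z : 'rV[R]_n) : dotv (x + y) z = dotv x z + dotv y z.
Proof. by rewrite /dotv -big_split; apply: eq_bigr => i _; rewrite mxE mulrDl. Qed.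

Lemma dotvZl n a (x z : 'rV[R]_n) : dotv (a *: x) z = a * dotv x z.
Proof. by rewrite /dotv mulr_sumr; apply: eq_bigr => i _; rewrite mxE mulrA. Qed.

Lemma dotvDr n (x y z : 'rV[R]_n) : dotv z (x + y) = dotv z x + dotv z y.
Proof. by rewrite dotvC dotvDl !(dotvC z). Qed.

Lemma dotvZr n a (x z : 'rV[R]_n) : dotv z (a *: x) = a * dotv z x.
Proof. by rewrite dotvC dotvZl (dotvC z). Qed.

Lemma dotv_delta n (x : 'rV[R]_n) i : dotv x (delta_mx 0 i) = x 0 i.
Proof.
rewrite /dotv (bigD1 i)//= mxE !eqxx mulr1 big1 ?addr0// => j ji.
by rewrite mxE (negbTE ji) andbF mulr0.
Qed.

Lemma dotv_ge0 n (x : 'rV[R]_n) : 0 <= dotv x x.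
Proof. by apply: sumr_ge0 => i _; rewrite -expr2 sqr_ge0. Qed.

Lemma hemisphere0 n s (x : 'rV[R]_n) :
  hemisphere s x 0 ord0 = (-1) ^+ s * Num.sqrt (1 - dotv x x).
Proof.
rewrite /hemisphere (_ : ord0 = lshift n (ord0 : 'I_1)); last exact: val_inj.
by rewrite (@row_mxEl _ 1 1 n) mxE eqxx.
Qed.

Lemma hemisphereS n s (x : 'rV[R]_n) i : hemisphere s x 0 (lift ord0 i) = x 0 i.
Proof.
rewrite /hemisphere (_ : lift ord0 i = rshift 1 i); last exact: val_inj.
by rewrite (@row_mxEr _ 1 1 n).
Qed.

Lemma sphere_hemisphere n s (x : 'rV[R]_n) : dotv x x <= 1 -> sphere n (hemisphere s x).
Proof.
move=> x1; rewrite /sphere/= /dotv big_ord_recl hemisphere0.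
under eq_bigr do rewrite hemisphereS.
rewrite -/(dotv x x) -expr2 exprMn sqrr_sign mul1r sqr_sqrtr ?subr_ge0//.
by rewrite subrK.
Qed.

Lemma is_derive_hemisphere0 n s (x v : 'rV[R]_n) : dotv x x < 1 ->
  is_derive x v (fun y => hemisphere s y 0 ord0)
    ((-1) ^+ s * (- dotv x v / Num.sqrt (1 - dotv x x))).
Proof.
move=> x1; apply: is_derive_along.
rewrite (_ : (fun h => _) = (fun h : R => (-1) ^+ s *: Num.sqrt
   ((1 - dotv x x) + h * (- (2 * dotv x v) + h * - dotv v v)))); last first.
  apply/funext => h; rewrite hemisphere0 /GRing.scale/=; congr (_ * Num.sqrt _).
  by rewrite !(dotvDl, dotvDr, dotvZl, dotvZr) (dotvC v x); ring.
apply: is_deriveZ.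
have u0 : 0 < (1 - dotv x x) + 0 * (- (2 * dotv x v) + 0 * - dotv v v).
  by rewrite mul0r addr0 subr_gt0.
have H1 : is_derive (0:R) (1:R) (fun h : R => (1 - dotv x x) + h * (- (2 * dotv x v) + h * - dotv v v)) (- (2 * dotv x v)).
  have := is_deriveD (is_derive_cst (1 - dotv x x) (0:R) (1 : R))
    (is_deriveM (is_derive_id (0:R) (1 : R)) (is_derive_line (- (2 * dotv x v)) (- dotv v v) 0)).
  move=> H; apply: (is_derive_eq H).
  by rewrite add0r scale0r add0r mul0r addr0 /GRing.scale/= mulr1.
have H := @is_derive1_comp _ (@Num.sqrt R) _ (0:R) _ _ (is_derive1_sqrt u0) H1.
apply: (is_derive_eq H); rewrite mul0r addr0 invfM.
have : Num.sqrt (1 - dotv x x) != 0 by rewrite gt_eqF// sqrtr_gt0 subr_gt0.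
by move=> ?; field.
Qed.

Lemma is_derive_hemisphereS n s (x v : 'rV[R]_n) j :
  is_derive x v (fun y => hemisphere s y 0 (lift ord0 j)) (v 0 j).
Proof.
rewrite (_ : (fun y => _) = (fun y : 'rV[R]_n => y 0 j)); first exact: is_derive_coord.
by apply/funext => y; rewrite hemisphereS.
Qed.

Lemma derivable_hemisphere n s (x v : 'rV[R]_n) : dotv x x < 1 ->
  derivable (hemisphere s) x v.
Proof.
move=> x1; apply/derivable_mxP => i j; rewrite ord1.
case: (unliftP ord0 j) => [k ->|->].
- by have [] := is_derive_hemisphereS s x v k.
- by have [] := is_derive_hemisphere0 s v x1.
Qed.

Lemma derive_hemisphere n s (x v : 'rV[R]_n) : dotv x x < 1 ->
  'D_v (hemisphere s) x =
  row_mx ((-1) ^+ s * (- dotv x v / Num.sqrt (1 - dotv x x)))%:M v.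
Proof.
move=> x1; rewrite derive_mx; last exact: derivable_hemisphere.
apply/rowP => k; rewrite mxE; case: (unliftP ord0 k) => [j ->|->].
  rewrite (@derive_val _ _ _ _ _ _ _ (is_derive_hemisphereS s x v j)).
  rewrite (_ : lift ord0 j = rshift 1 j); last exact: val_inj.
  by rewrite (@row_mxEr _ 1 1 n).
rewrite (@derive_val _ _ _ _ _ _ _ (is_derive_hemisphere0 s v x1)).
rewrite (_ : ord0 = lshift n (ord0 : 'I_1)); last exact: val_inj.
by rewrite (@row_mxEl _ 1 1 n) mxE eqxx.
Qed.

Lemma dotv_row_mx n (a b : R) (v w : 'rV[R]_n) :
  dotv (row_mx a%:M v : 'rV_(1 + n)) (row_mx b%:M w) = a * b + dotv v w.
Proof.
rewrite /dotv big_split_ord/= big_ord1 !row_mxEl !mxE eqxx; congr (_ + _).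
by apply: eq_bigr => i _; rewrite !row_mxEr.
Qed.

(** The metric in this chart is the identity plus the rank-one matrix x^T x / (1 - |x|^2), so its
    determinant is 1 / (1 - |x|^2). *)
Lemma volume_density_hemisphere n s (x : 'rV[R]_n) : dotv x x < 1 ->
  volume_density (hemisphere s) x = kappa 0 (1 - dotv x x).
Proof.
move=> x1; have u0 : 0 < 1 - dotv x x by rewrite subr_gt0.
have sq0 : Num.sqrt (1 - dotv x x) != 0 by rewrite gt_eqF// sqrtr_gt0.
rewrite /volume_density.
have -> : induced_metric (hemisphere s) x =
    1%:M + ((1 - dotv x x)^-1 *: x^T) *m x.
  apply/matrixP => i j; rewrite !mxE big_ord1 !mxE !derive_hemisphere// dotv_row_mx.
  have d0 : (delta_mx 0 i : 'rV[R]_n) 0 j = (i == j)%:R.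
    by rewrite mxE eqxx andTb eq_sym.
  rewrite !dotv_delta d0 addrC; congr (_ + _).
  rewrite mulrACA -expr2 sqrr_sign mul1r.
  rewrite -[in RHS](sqr_sqrtr (ltW u0)).
  by field.
rewrite det_add_rank1 -scalemxAr mxE [(x *m _) _ _]mxE.
rewrite (_ : \sum_j _ = dotv x x); last by apply: eq_bigr => k _; rewrite mxE.
rewrite (_ : 1 + _ = (1 - dotv x x)^-1); last first.
  by field; rewrite gt_eqF.
by rewrite sqrtrV ?kappa0// ltW.
Qed.

Lemma dotv_row_of_tuple n (t : n.-tuple TR) :
  dotv (row_of_tuple t) (row_of_tuple t) = sqn t.
Proof. by apply: eq_bigr => i _; rewrite mxE expr2. Qed.

Lemma unit_ballE n (t : n.-tuple TR) : unit_ball n t <-> sqn t < 1.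
Proof. by rewrite /unit_ball/= dotv_row_of_tuple. Qed.

Lemma measurable_unit_ball n : measurable (unit_ball n : set (n.-tuple TR)).
Proof.
rewrite (_ : unit_ball n = setT `&` (@sqn R n) @^-1` [set` `]-oo, 1[ ]).
  exact: measurable_sqn.
apply/seteqP; split => [t /unit_ballE h|t [_]]; first by split; rewrite //= in_itv.
by rewrite /= in_itv/= => h; exact/unit_ballE.
Qed.

(* The chart integrand extended by 0 outside of the ball, thanks to 0^-1 = 0. *)
Definition chart_fun n (s : bool) (f : 'rV[R]_n.+1 -> R) (t : n.-tuple TR) : R :=
  f (hemisphere s (row_of_tuple t)) * kappa 0 (1 - sqn t).

Lemma chart_integrandE n s (f : 'rV[R]_n.+1 -> R) :
  chart_integrand s f \_ (unit_ball n) = chart_fun s f.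
Proof.
apply/funext => t; rewrite patchE /chart_integrand /chart_fun.
case: ifPn => [/set_mem/unit_ballE t1|/negP tn].
  by rewrite volume_density_hemisphere dotv_row_of_tuple.
rewrite kappa_le0 ?mulr0// subr_le0 leNgt; apply/negP => t1; apply: tn.
by apply/mem_set/unit_ballE.
Qed.

Lemma sphere_integrableE n (f : 'rV[R]_n.+1 -> R) :
  sphere_integrable f <->
  forall s, (lebesgue_tuple n).-integrable setT (EFin \o chart_fun s f).
Proof.
have E s : (lebesgue_tuple n).-integrable (unit_ball n) (EFin \o chart_integrand s f) <->
    (lebesgue_tuple n).-integrable setT (EFin \o chart_fun s f).
  rewrite -chart_integrandE -restrict_EFin.
  by apply: integrable_mkcond; exact: measurable_unit_ball.
by split => h s; apply/E; exact: h.
Qed.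

Lemma sphere_integralE n (f : 'rV[R]_n.+1 -> R) :
  sphere_integral f = \sum_(s : bool) \int[lebesgue_tuple n]_t chart_fun s f t.
Proof.
by apply: eq_bigr => s _; rewrite Rintegral_mkcond chart_integrandE.
Qed.

Definition renv n (q : 'rV[R]_n.+1) : nat -> R :=
  fun i => if (i < n.+1)%N then q 0 (inord i) else 0.

Lemma renvE n (q : 'rV[R]_n.+1) (i : 'I_n.+1) : renv q i = q 0 i.
Proof. by rewrite /renv ltn_ord inord_val. Qed.

Lemma renv_hemisphere n s (t : n.-tuple TR) :
  renv (hemisphere s (row_of_tuple t)) =
  tenv ((-1) ^+ s * Num.sqrt (1 - sqn t)) [::] t.
Proof.
apply/funext => i; rewrite /renv /tenv; case: i => [|i].
  by rewrite ltn0Sn (_ : inord 0 = ord0) ?hemisphere0 ?dotv_row_of_tuple//;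
    apply: val_inj; rewrite /= inordK.
rewrite ltnS /=; case: ltnP => h; last by rewrite nth_default// size_tuple.
rewrite (_ : inord i.+1 = lift ord0 (Ordinal h)); last first.
  by apply: val_inj; rewrite /= inordK.
by rewrite hemisphereS mxE (tnth_nth 0).
Qed.

Definition psph n (e : pexp R) (q : 'rV[R]_n.+1) : R := peval e (renv q).

Lemma chart_fun_psph n s e :
  chart_fun s (@psph n e) = @ball_integrand R n [::] 1 e s.
Proof.
by apply/funext => t; rewrite /chart_fun /psph renv_hemisphere.
Qed.

Lemma sphere_integrable_psph n e : sphere_integrable (@psph n e).
Proof.
apply/sphere_integrableE => s; rewrite chart_fun_psph.
by apply: integrable_ball_integrand; rewrite big_nil add0r.
Qed.

Lemma sphere_integral_prot0 n j e : (j < n)%N ->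
  sphere_integral (@psph n (prot 0 j.+1 e)) = 0.
Proof.
move=> jn; rewrite sphere_integralE.
have H : \sum_(y <- [::] : seq R) y ^+ 2 + 1 <= 1 by rewrite big_nil add0r.
under eq_bigr do rewrite chart_fun_psph.
rewrite big_bool.
transitivity (\int[lebesgue_tuple n]_t (ball_integrand [::] 1 (prot 0 j.+1 e) true t +
   ball_integrand [::] 1 (prot 0 j.+1 e) false t)).
  by rewrite RintegralD//; exact: integrable_ball_integrand.
have := @integral_ball_rot R n [::] 1 j e jn H.
rewrite add0n => E.
rewrite /Rintegral (eq_integral (fun t => (ball_rot [::] 1 j.+1 e t)%:E)) ?E//.
by move=> t _; rewrite /ball_rot big_bool.
Qed.

Lemma sphere_volumeE n : sphere_volume n = 2 * \prod_(j < n) @kmass R j.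
Proof.
rewrite /sphere_volume sphere_integralE.
under eq_bigr => s _.
  rewrite (_ : (\int[_]_t _)%R = \prod_(j < n) @kmass R j); first over.
  rewrite /Rintegral /chart_fun.
  under eq_integral do rewrite mul1r.
  rewrite integral_kappa_sqn /= add0n /kappa sqrtr1 expr1n divr1 mulr1.
  by apply: eq_bigr => j _; rewrite add0n.
by rewrite big_bool/= mulrDl !mul1r.
Qed.

Lemma sphere_volumeS n : sphere_volume n.+1 = sphere_volume n * @kmass R n.
Proof. by rewrite !sphere_volumeE big_ord_recr mulrA. Qed.

End hemisphere_chart.

(** * Integration by parts on the sphere *)

Section sphere_linear.
Context {R : realType}.
Variable n : nat.
Local Notation V := 'rV[R]_n.+1.
Implicit Types (f g : V -> R) (e : pexp R).
Local Notation leb := (@lebesgue_tuple R n).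
Local Notation SI := (@sphere_integral R n).

Lemma sphere_integral_chart_eq f g :
  (forall q, sphere n q -> f q = g q) ->
  forall s, chart_fun s f = chart_fun s g.
Proof.
move=> fg s; apply/funext => t; rewrite /chart_fun.
have [t1|t1] := leP (sqn t) 1.
  by rewrite fg//; apply: sphere_hemisphere; rewrite dotv_row_of_tuple.
by rewrite kappa_le0 ?mulr0// subr_le0 ltW.
Qed.

Lemma eq_sphere_integral f g :
  (forall q, sphere n q -> f q = g q) -> SI f = SI g.
Proof.
move=> fg; rewrite !sphere_integralE; apply: eq_bigr => s _.
by rewrite (sphere_integral_chart_eq fg).
Qed.

Lemma eq_sphere_integrable f g :
  (forall q, sphere n q -> f q = g q) -> sphere_integrable f -> sphere_integrable g.
Proof.
move=> fg /sphere_integrableE h; apply/sphere_integrableE => s.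
by rewrite -(sphere_integral_chart_eq fg).
Qed.

Lemma sphere_integrableD f g : sphere_integrable f -> sphere_integrable g ->
  sphere_integrable (fun q => f q + g q).
Proof.
move=> /sphere_integrableE hf /sphere_integrableE hg.
apply/sphere_integrableE => s.
rewrite (_ : EFin \o _ = (EFin \o chart_fun s f) \+ (EFin \o chart_fun s g))%E; last first.
  by apply/funext => t; rewrite /= /chart_fun mulrDl.
exact: integrableD.
Qed.

Lemma sphere_integrableZ c f : sphere_integrable f ->
  sphere_integrable (fun q => c * f q).
Proof.
move=> /sphere_integrableE hf; apply/sphere_integrableE => s.
rewrite (_ : EFin \o _ = (fun t => c%:E * (EFin \o chart_fun s f) t)%E); last first.
  by apply/funext => t; rewrite /= /chart_fun -mulrA EFinM.
exact: integrableZl.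
Qed.

Lemma sphere_integrableB f g : sphere_integrable f -> sphere_integrable g ->
  sphere_integrable (fun q => f q - g q).
Proof.
move=> hf hg; apply: (@eq_sphere_integrable (fun q => f q + -1 * g q)).
  by move=> q _; rewrite mulN1r.
by apply: sphere_integrableD => //; exact: sphere_integrableZ.
Qed.

Lemma sphere_integralD f g : sphere_integrable f -> sphere_integrable g ->
  SI (fun q => f q + g q) = SI f + SI g.
Proof.
move=> /sphere_integrableE hf /sphere_integrableE hg.
rewrite !sphere_integralE -big_split; apply: eq_bigr => s _ /=.
rewrite -RintegralD//.
by apply: eq_Rintegral => t _; rewrite /chart_fun mulrDl.
Qed.

Lemma sphere_integralZ c f : sphere_integrable f ->
  SI (fun q => c * f q) = c * SI f.
Proof.
move=> /sphere_integrableE hf.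
rewrite !sphere_integralE mulr_sumr; apply: eq_bigr => s _ /=.
rewrite -RintegralZl//.
by apply: eq_Rintegral => t _; rewrite /chart_fun mulrA.
Qed.

Lemma sphere_integralB f g : sphere_integrable f -> sphere_integrable g ->
  SI (fun q => f q - g q) = SI f - SI g.
Proof.
move=> hf hg; rewrite -[- SI g]mulN1r -sphere_integralZ// -sphere_integralD//.
  by apply: eq_sphere_integral => q _; rewrite mulN1r.
exact: sphere_integrableZ.
Qed.

Lemma le_sphere_integral f g : sphere_integrable f -> sphere_integrable g ->
  (forall q, sphere n q -> f q <= g q) -> SI f <= SI g.
Proof.
move=> /sphere_integrableE hf /sphere_integrableE hg fg.
rewrite !sphere_integralE; apply: ler_sum => s _.
apply: le_Rintegral => //.
move=> t _; rewrite /chart_fun; have [t1|t1] := leP (sqn t) 1; last first.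
  by rewrite kappa_le0 ?mulr0// subr_le0 ltW.
rewrite ler_wpM2r ?kappa_ge0// fg//.
by apply: sphere_hemisphere; rewrite dotv_row_of_tuple.
Qed.

Lemma sphere_integrable_norm f : sphere_integrable f ->
  sphere_integrable (fun q => `|f q|).
Proof.
move=> /sphere_integrableE hf; apply/sphere_integrableE => s.
rewrite (_ : EFin \o _ = (fun t => `|(EFin \o chart_fun s f) t|%E)); last first.
  by apply/funext => t; rewrite /= /chart_fun normrM (ger0_norm (kappa_ge0 _ _)).
exact: (integrable_abse (hf s)).
Qed.

Lemma renv_le1 (q : V) i : sphere n q -> `|renv q i| <= 1.
Proof.
rewrite /sphere/= => q1; rewrite /renv; case: ifP => // _; last by rewrite normr0.
apply: (@le_norm1 _ _ (dotv q q - q 0 (inord i) ^+ 2)); last by rewrite addrC subrK q1.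
rewrite /dotv (bigD1 (inord i))//= -expr2 addrAC subrr add0r.
by apply: sumr_ge0 => j _; rewrite -expr2 sqr_ge0.
Qed.

Lemma psph_bound e (q : V) : sphere n q -> `|psph e q| <= pbound e.
Proof. by move=> q1; apply: peval_bound => i; exact: renv_le1. Qed.

Lemma sphere_integrableM f e : sphere_integrable f ->
  sphere_integrable (fun q => f q * psph e q).
Proof.
move=> /sphere_integrableE hf; apply/sphere_integrableE => s.
have pb0 := pbound_ge0 e; set pb := pbound e in pb0 *.
have ik : leb.-integrable setT (fun t => pb%:E * (EFin \o chart_fun s f) t)%E.
  by apply: integrableZl => //; exact: hf.
have E t : chart_fun s (fun q => f q * psph e q) t =
    chart_fun s f t * psph e (hemisphere s (row_of_tuple t)).
  by rewrite /chart_fun; ring.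
apply: le_integrable ik => //.
  apply/measurable_EFinP; rewrite (_ : chart_fun _ _ = fun t => chart_fun s f t *
    psph e (hemisphere s (row_of_tuple t))); last by apply/funext => t; exact: E.
  apply: measurable_funM; first by have /measurable_int/measurable_EFinP := hf s.
  rewrite /psph; under eq_fun do rewrite renv_hemisphere.
  apply: measurable_peval => i; apply: measurable_tenv.
  apply: measurable_funM; first exact: measurable_cst.
  by apply: measurableT_comp; [exact: measurable_sqrt|exact: measurable_sub_sqn].
move=> t _; rewrite [(EFin \o _) t]/= E [(EFin \o _) t]/= -EFinM !abse_EFin lee_fin.
rewrite [`|_ * psph _ _|]normrM [`|pb * _|]normrM [`|pb|]ger0_norm// mulrC.
have [t1|t1] := leP (sqn t) 1; last first.
  by rewrite /chart_fun kappa_le0 ?mulr0 ?normr0 ?mulr0// subr_le0 ltW.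
rewrite ler_wpM2r// psph_bound//.
by apply: sphere_hemisphere; rewrite dotv_row_of_tuple.
Qed.

Lemma sphere_integral_psum m (F : nat -> pexp R) :
  SI (@psph R n (psum [seq F i | i <- iota 0 m])) = \sum_(i < m) SI (psph (F i)).
Proof.
rewrite -(big_mkord xpredT (fun i => SI (psph (F i)))) /index_iota subn0.
elim: (iota 0 m) => [|i s ih].
  rewrite big_nil (@eq_sphere_integral _ (fun q => 0 * psph (PCst 0) q)).
    by rewrite sphere_integralZ ?mul0r//; exact: sphere_integrable_psph.
  by move=> q _; rewrite mul0r.
rewrite big_cons -ih -sphere_integralD//; exact: sphere_integrable_psph.
Qed.

Lemma sphere_integral_psphB e1 e2 :
  SI (fun q => psph e1 q - psph e2 q) = SI (psph e1) - SI (psph e2).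
Proof. by apply: sphere_integralB; exact: sphere_integrable_psph. Qed.

(** The charts single out coordinate 0 and directly handle only the generators that involve it; this
    removes the asymmetry. *)
Lemma sphere_integral_prot i j e : (i <= n)%N -> (j <= n)%N ->
  SI (psph (prot i j e)) = 0.
Proof.
have z0 e' : (forall q, sphere n q -> psph e' q = 0) -> SI (psph e') = 0.
  move=> h; rewrite (@eq_sphere_integral _ (fun q => psph (PCst 0) q - psph (PCst 0) q)).
    by rewrite sphere_integral_psphB subrr.
  by move=> q /h ->; rewrite subrr.
move=> hi hj; case: i hi => [_|i hi].
  case: j hj => [_|j hj]; last exact: sphere_integral_prot0.
  by apply: z0 => q _; rewrite /psph peval_prot subrr.
case: j hj => [_|j hj].
  rewrite (@eq_sphere_integral _ (fun q => psph (PCst 0) q - psph (prot 0 i.+1 e) q)).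
    rewrite sphere_integral_psphB sphere_integral_prot0// subr0.
    by apply: z0.
  by move=> q _; rewrite /psph !peval_prot /=; ring.
have [->|ij] := eqVneq i j.
  by apply: z0 => q _; rewrite /psph peval_prot subrr.
(* the generators satisfy [R_0j, R_0i] = R_ij *)
rewrite (@eq_sphere_integral _ (fun q => psph (prot 0 j.+1 (prot 0 i.+1 e)) q -
    psph (prot 0 i.+1 (prot 0 j.+1 e)) q)).
  by rewrite sphere_integral_psphB !sphere_integral_prot0// subrr.
move=> q _; rewrite /psph !peval_prot /= !eqSS (negbTE ij) eq_sym (negbTE ij).
rewrite !(pdifC j.+1 i.+1) !(pdifC 0 i.+1) !(pdifC 0 j.+1).
ring.
Qed.

End sphere_linear.

Section zonal.
Context {R : realType}.
Variable n : nat.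
Local Notation V := 'rV[R]_n.+1.
Implicit Types (e : pexp R) (u v : {poly R}) (p q : V).
Local Notation SI := (@sphere_integral R n).

(** The nonnegative Laplacian of the n-sphere acting on functions of t = p . q (the Gegenbauer
    operator). *)
Definition Lop u : {poly R} := n%:R *: ('X * u^`()) - (1 - 'X^2) * u^`()^`().

Lemma horner_Lop u t :
  (Lop u).[t] = n%:R * (t * u^`().[t]) - (1 - t ^+ 2) * u^`()^`().[t].
Proof. by rewrite /Lop !hornerE. Qed.

Lemma sum_renv p q : \sum_(i < n.+1) renv p i * renv q i = dotv p q.
Proof. by apply: eq_bigr => i _; rewrite !renvE. Qed.

Lemma psph_zonal u p q : psph (pzonal n.+1 u (renv p)) q = u.[dotv p q].
Proof. by rewrite /psph peval_pzonal sum_renv. Qed.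

Lemma psph_pdif_zonal u p q (i : 'I_n.+1) :
  psph (pdif i (pzonal n.+1 u (renv p))) q = p 0 i * u^`().[dotv p q].
Proof. by rewrite /psph pdif_pzonal// sum_renv renvE. Qed.

(** The divergence theorem for the tangent field e grad u(p . q), where p - (p . q) q is the
    gradient of q |-> p . q. *)
Lemma sphere_integral_green e u p : sphere n p ->
  SI (fun q => psph e q * (Lop u).[dotv p q]) =
  SI (fun q => u^`().[dotv p q] *
    \sum_(i < n.+1) (p 0 i - dotv p q * q 0 i) * psph (pdif i e) q).
Proof.
move=> p1.
pose pz w := pzonal n.+1 w (renv p).
pose h := PMul e (pz u^`()).
pose e1 := PMul e (pz (Lop u)).
pose e2 := PMul (pz u^`()) (psum [seq PMul (PAdd (PCst (renv p i))
   (PMul (PCst (-1)) (PMul (plin n.+1 (renv p)) (@PVar R i)))) (pdif i e) | i <- iota 0 n.+1]).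
have E1 q : psph e q * (Lop u).[dotv p q] = psph e1 q.
  by rewrite -psph_zonal.
have E2 q : u^`().[dotv p q] * \sum_(i < n.+1) (p 0 i - dotv p q * q 0 i) * psph (pdif i e) q
   = psph e2 q.
  rewrite /e2 /psph pevalM peval_pzonal sum_renv peval_psumE; congr (_ * _).
  apply: eq_bigr => i _; rewrite pevalM pevalD !pevalM peval_plin sum_renv /= !renvE.
  by rewrite mulN1r.
transitivity (SI (psph e1)); first by apply: eq_sphere_integral => q _; exact: E1.
transitivity (SI (psph e2)); last by apply: eq_sphere_integral => q _; rewrite E2.
apply/eqP; rewrite eq_sym -subr_eq0 -sphere_integral_psphB.
(* Summed over i and j, these rotation derivatives give, on the sphere, the divergence of the
   tangent field h (p - (p . q) q). *)
pose T j i := PMul (PCst (renv p i)) (prot j i (PMul (@PVar R j) h)).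
rewrite (@eq_sphere_integral _ _ _ (psph (psum [seq psum [seq T j i | i <- iota 0 n.+1] | j <- iota 0 n.+1]))).
  rewrite sphere_integral_psum big1// => j _; rewrite sphere_integral_psum big1// => i _.
  rewrite (@eq_sphere_integral _ _ _ (fun q => renv p i * psph (prot j i (PMul (@PVar R j) h)) q)) //.
  rewrite sphere_integralZ; last exact: sphere_integrable_psph.
  rewrite sphere_integral_prot ?mulr0//; [by have := ltn_ord j|by have := ltn_ord i].
move=> q q1; rewrite -E1 -E2 /psph (peval_psum2 _ _ T).
set t := dotv p q.
have hE : peval h (renv q) = peval e (renv q) * u^`().[t].
  by rewrite pevalM peval_pzonal sum_renv.
have dh (i : 'I_n.+1) : peval (pdif i h) (renv q) =
    peval (pdif i e) (renv q) * u^`().[t] + peval e (renv q) * (p 0 i * u^`()^`().[t]).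
  by rewrite pdifM pevalD !pevalM peval_pzonal sum_renv pdif_pzonal// sum_renv renvE.
have TE (j i : 'I_n.+1) : peval (T j i) (renv q) =
   p 0 i * ((i == j)%:R * (q 0 j * peval h (renv q))) + p 0 i * peval (pdif i h) (renv q) * (q 0 j * q 0 j)
   - (p 0 i * q 0 i) * (peval h (renv q) + q 0 j * peval (pdif j h) (renv q)).
  rewrite /T pevalM peval_prot !pdifM !pevalD !pevalM /= eqxx !renvE -val_eqE /=.
  by ring.
rewrite [RHS](eq_bigr (fun j : 'I_n.+1 => p 0 j * q 0 j * peval h (renv q) +
    (\sum_(i < n.+1) p 0 i * peval (pdif i h) (renv q)) * (q 0 j * q 0 j) -
     t * peval h (renv q) - t * (q 0 j * peval (pdif j h) (renv q)))); last first.
  move=> j _; rewrite (eq_bigr _ (fun i _ => TE j i)) sumrB big_split/=.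
  rewrite (bigD1 j)//= eqxx mul1r big1 ?addr0; last first.
    by move=> i /negbTE ->; rewrite mul0r mulr0.
  by rewrite -mulr_suml -mulr_suml -/(dotv p q) -/t; ring.
have key H S (D : 'I_n.+1 -> R) : \sum_(j < n.+1) (p 0 j * q 0 j * H +
    S * (q 0 j * q 0 j) - t * H - t * (q 0 j * D j)) =
    t * H + S - n.+1%:R * (t * H) - t * \sum_(j < n.+1) q 0 j * D j.
  rewrite !sumrB big_split/= -mulr_suml -!mulr_sumr -/(dotv p q) -/t -/(dotv q q) q1.
  by rewrite sumr_const card_ord -[_ *+ n.+1]mulr_natl; ring.
rewrite key hE horner_Lop.
under [\sum_(i < n.+1) p 0 i * peval (pdif i h) _]eq_bigr => i _ do rewrite dh.
under [\sum_(j < n.+1) q 0 j * _]eq_bigr => i _ do rewrite dh.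
have -> : \sum_(i < n.+1) p 0 i * (peval (pdif i e) (renv q) * u^`().[t] + peval e (renv q) * (p 0 i * u^`()^`().[t]))
   = (\sum_(i < n.+1) p 0 i * peval (pdif i e) (renv q)) * u^`().[t] + peval e (renv q) * u^`()^`().[t] * dotv p p.
  rewrite mulr_suml mulr_sumr -big_split; apply: eq_bigr => i _ /=; ring.
have -> : \sum_(i < n.+1) q 0 i * (peval (pdif i e) (renv q) * u^`().[t] + peval e (renv q) * (p 0 i * u^`()^`().[t]))
   = (\sum_(i < n.+1) q 0 i * peval (pdif i e) (renv q)) * u^`().[t] + peval e (renv q) * u^`()^`().[t] * t.
  rewrite mulr_suml mulr_sumr -big_split; apply: eq_bigr => i _ /=; ring.
have -> : \sum_(i < n.+1) (p 0 i - t * q 0 i) * peval (pdif i e) (renv q) =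
  \sum_(i < n.+1) p 0 i * peval (pdif i e) (renv q) - t * \sum_(i < n.+1) q 0 i * peval (pdif i e) (renv q).
  rewrite mulr_sumr -sumrB; apply: eq_bigr => i _ /=; ring.
rewrite p1 -natr1; ring.
Qed.

Lemma sphere_integral_Lop u p : sphere n p -> SI (fun q => (Lop u).[dotv p q]) = 0.
Proof.
move=> p1; rewrite (@eq_sphere_integral _ _ _ (fun q => psph (PCst 1) q * (Lop u).[dotv p q])).
  rewrite sphere_integral_green// (@eq_sphere_integral _ _ _ (fun q => 0 * psph (PCst 1) q)).
    by rewrite sphere_integralZ ?mul0r//; exact: sphere_integrable_psph.
  by move=> q _; rewrite mul0r big1 ?mulr0// => i _; rewrite mulr0.
by move=> q _; rewrite mul1r.
Qed.

(** The right-hand side integrates the scalar product of the two gradients; its symmetry is what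
    makes the Laplacian self-adjoint on zonal polynomials. *)
Lemma sphere_integral_Lop2 u v p p' : sphere n p ->
  SI (fun q => v.[dotv p' q] * (Lop u).[dotv p q]) =
  SI (fun q => u^`().[dotv p q] * v^`().[dotv p' q] *
               (dotv p p' - dotv p q * dotv p' q)).
Proof.
move=> p1; rewrite (@eq_sphere_integral _ _ _
    (fun q => psph (pzonal n.+1 v (renv p')) q * (Lop u).[dotv p q])).
  rewrite sphere_integral_green//; apply: eq_sphere_integral => q _.
  rewrite -mulrA; congr (_ * _); under eq_bigr do rewrite psph_pdif_zonal.
  rewrite /dotv mulr_sumr -sumrB mulr_sumr; apply: eq_bigr => i _; ring.
by move=> q _; rewrite psph_zonal.
Qed.

End zonal.

(** * Zonal functions *)

Section smoothness.
Context {R : realType}.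
Variable n : nat.
Local Notation V := 'rV[R]_n.+1.
Implicit Types (e : pexp R) (u : {poly R}) (p q v : V).

Lemma is_derive_renv q v i : is_derive q v (fun y : V => renv y i) (renv v i).
Proof.
rewrite /renv; case: (i < n.+1)%N; last exact: is_derive_cst.
exact: is_derive_coord.
Qed.

Lemma renv_default q i : (n.+1 <= i)%N -> renv q i = 0.
Proof. by rewrite /renv leqNgt => /negbTE ->. Qed.

Lemma is_derive_psph e q v : is_derive q v (@psph R n e)
  (\sum_(i < n.+1) v 0 i * psph (pdif i e) q).
Proof.
have H := is_derive_peval e (fun i => is_derive_renv q v i) (@renv_default v).
apply: (is_derive_eq H); apply: eq_bigr => i _.
by rewrite renvE.
Qed.

Lemma differentiable_psph e q : differentiable (@psph R n e) q.
Proof.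
rewrite /psph; elim: e => [i|c|a iha b ihb|a iha b ihb].
- rewrite /= /renv; case: (i < n.+1)%N; last exact: differentiable_cst.
  exact: differentiable_coord.
- exact: differentiable_cst.
- exact: differentiableD.
- exact: differentiableM.
Qed.

Lemma smooth_psph e : smooth (@psph R n e).
Proof.
move=> k; elim: k e => [|k ih] e /=.
  by move=> q; apply: differentiable_continuous; exact: differentiable_psph.
split=> [q|v]; first exact: differentiable_psph.
have -> : 'D_v (@psph R n e) =
    psph (psum [seq PMul (PCst (renv v i)) (pdif i e) | i <- iota 0 n.+1]).
  apply/funext => q.
  rewrite (@derive_val _ _ _ _ _ _ _ (is_derive_psph e q v)).
  by rewrite [RHS]peval_psumE; apply: eq_bigr => i _; rewrite pevalM renvE.
exact: ih.
Qed.

Definition zonal p u : V -> R := fun q => u.[dotv p q].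

Lemma zonalE p u : zonal p u = psph (pzonal n.+1 u (renv p)).
Proof. by apply/funext => q; rewrite psph_zonal. Qed.

Lemma smooth_zonal p u : smooth (zonal p u).
Proof. by rewrite zonalE; exact: smooth_psph. Qed.

Lemma is_derive_zonal p u q v :
  is_derive q v (zonal p u) (u^`().[dotv p q] * dotv p v).
Proof.
rewrite zonalE; apply: (is_derive_eq (is_derive_psph _ q v)).
rewrite mulr_sumr; apply: eq_bigr => i _.
by rewrite psph_pdif_zonal; ring.
Qed.

Lemma tangent_projE q i j :
  tangent_proj q (delta_mx 0 i) 0 j = (j == i)%:R - q 0 i * q 0 j.
Proof.
by rewrite /tangent_proj (dotvC _ q) dotv_delta !mxE eqxx.
Qed.

Lemma dotv_tangent p q i :
  dotv p (tangent_proj q (delta_mx 0 i)) = p 0 i - q 0 i * dotv p q.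
Proof.
rewrite /tangent_proj dotvDr dotv_delta -scaleNr dotvZr (dotvC _ q) dotv_delta.
by rewrite mulNr.
Qed.

(** Along the projected basis vectors P_q e_i the second-order terms add up to |P_q p|^2 = 1 - t^2
    times u'', and the first-order ones to n t u', since the numbers 1 - q_i^2 sum to n. *)
Lemma sphere_laplacian_zonal p u q : sphere n p -> sphere n q ->
  sphere_laplacian (zonal p u) q = (Lop n u).[dotv p q].
Proof.
move=> p1 q1; rewrite /sphere_laplacian /sphere_div.
have gE : sphere_grad (zonal p u) =
    fun x : V => \row_j ((zonal p u^`() x) * (p 0 j - dotv p x * x 0 j)).
  apply/funext => x; apply/rowP => j; rewrite !mxE.
  rewrite (@derive_val _ _ _ _ _ _ _ (is_derive_zonal p u x _)) dotv_tangent.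
  by rewrite /zonal; ring.
set X := sphere_grad _; set t := dotv p q.
have Xj v j : is_derive q v (fun x => X x 0 j)
    (u^`()^`().[t] * dotv p v * (p 0 j - t * q 0 j) -
     u^`().[t] * (dotv p v * q 0 j + t * v 0 j)).
  rewrite /X gE.
  rewrite (_ : (fun x : V => _) = (fun x : V => zonal p u^`() x * (p 0 j - zonal p 'X x * x 0 j))); last first.
    by apply/funext => x; rewrite mxE /zonal hornerX.
  have H := is_deriveM (is_derive_zonal p u^`() q v)
    (is_deriveB (is_derive_cst (p 0 j) q v)
      (is_deriveM (is_derive_zonal p 'X q v) (is_derive_coord q v j))).
  apply: (is_derive_eq H); rewrite /GRing.scale/= !fctE /zonal derivX hornerX hornerC -/t.
  by ring.
have Xd v : derivable X q v.
  by apply/derivable_mxP => i j; rewrite ord1; have [] := Xj v j.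
have divE i : dotv ('D_(tangent_proj q (delta_mx 0 i)) X q) (tangent_proj q (delta_mx 0 i)) =
    u^`()^`().[t] * (p 0 i - q 0 i * t) ^+ 2 - u^`().[t] * t * (1 - q 0 i ^+ 2).
  set v := tangent_proj _ _.
  have vq : dotv q v = 0 by rewrite dotv_tangent q1 mulr1 subrr.
  have vv : dotv v v = 1 - q 0 i ^+ 2.
    rewrite {2}/v dotv_tangent (dotvC v q) vq mulr0 subr0 tangent_projE eqxx.
    by rewrite expr2.
  have pv : dotv p v = p 0 i - q 0 i * t by rewrite dotv_tangent.
  rewrite derive_mx// /dotv.
  rewrite (eq_bigr (fun j => (u^`()^`().[t] * dotv p v) * (p 0 j * v 0 j) -
       (u^`()^`().[t] * dotv p v * t + u^`().[t] * dotv p v) * (q 0 j * v 0 j) -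
       u^`().[t] * t * (v 0 j * v 0 j))); last first.
    by move=> j _; rewrite mxE (@derive_val _ _ _ _ _ _ _ (Xj v j)); ring.
  rewrite !sumrB -!mulr_sumr -/(dotv p v) -/(dotv q v) -/(dotv v v) vq vv pv.
  by ring.
under eq_bigr do rewrite divE.
rewrite sumrB -!mulr_sumr sumrB sumr_const card_ord.
have -> : \sum_(i < n.+1) (p 0 i - q 0 i * t) ^+ 2 = 1 - t ^+ 2.
  rewrite (eq_bigr (fun i => p 0 i * p 0 i - 2 * t * (p 0 i * q 0 i) + t ^+ 2 * (q 0 i * q 0 i))).
    2: by move=> i _; ring.
  rewrite big_split/= sumrB -!mulr_sumr -/(dotv p p) -/(dotv p q) -/(dotv q q) -/t q1 p1.
  by ring.
have -> : \sum_(i < n.+1) q 0 i ^+ 2 = 1.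
  by rewrite -[RHS]q1; apply: eq_bigr => i _; rewrite expr2.
by rewrite horner_Lop -natr1 addrK; ring.
Qed.

End smoothness.

(** * Solving the zonal Laplace equation in polynomials *)

Section Lop_surjective.
Context {R : realType}.
Variable n : nat.
Hypothesis n0 : (0 < n)%N.
Implicit Types u v : {poly R}.

Lemma LopD u v : Lop n (u + v) = Lop n u + Lop n v.
Proof. by rewrite /Lop !derivD !mulrDr !scalerDr; ring. Qed.

Lemma LopZ (a : R) u : Lop n (a *: u) = a *: Lop n u.
Proof. by rewrite /Lop !derivZ -!scalerAr scalerBr scalerA mulrC -scalerA. Qed.

Lemma LopC (c : R) : Lop n c%:P = 0.
Proof. by rewrite /Lop derivC deriv0 !mulr0 scaler0 subr0. Qed.

Lemma LopB u v : Lop n (u - v) = Lop n u - Lop n v.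
Proof. by rewrite -scaleN1r LopD LopZ scaleN1r. Qed.

Lemma LopXn k : Lop n ('X^(k.+2)) =
  (k.+2 * (k.+1 + n))%:R *: 'X^(k.+2) - (k.+2 * k.+1)%:R *: 'X^k :> {poly R}.
Proof.
rewrite /Lop derivXn derivMn derivXn -!pred_Sn !scaler_nat.
have -> : 'X^(k.+2) = 'X * 'X * 'X^k :> {poly R} by rewrite !exprS mulrA.
have -> : 'X^(k.+1) = 'X * 'X^k :> {poly R} by rewrite exprS.
by set a : {poly R} := 'X^k; ring.
Qed.

(** On monomials [Lop] is triangular, reaching two degrees down, and its diagonal coefficient k (k -
    1 + n) vanishes only for k = 0: constants are the only obstruction. *)
Lemma Lop_surj u : exists (w : {poly R}) (c : R), u = c%:P + Lop n w.
Proof.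
have PD a b : (exists (w : {poly R}) (c : R), a = c%:P + Lop n w) ->
    (exists (w : {poly R}) (c : R), b = c%:P + Lop n w) ->
    (exists (w : {poly R}) (c : R), a + b = c%:P + Lop n w).
  move=> [w [c ->]] [w' [c' ->]]; exists (w + w'), (c + c').
  by rewrite LopD polyCD; ring.
have PZ (k : R) a : (exists (w : {poly R}) (c : R), a = c%:P + Lop n w) ->
    (exists (w : {poly R}) (c : R), k *: a = c%:P + Lop n w).
  move=> [w [c ->]]; exists (k *: w), (k * c).
  by rewrite LopZ scalerDr polyCM mul_polyC.
have PX k : (exists (w : {poly R}) (c : R), 'X^k = c%:P + Lop n w) /\
   (exists (w : {poly R}) (c : R), 'X^(k.+1) = c%:P + Lop n w).
  elim: k => [|k [ih0 ih1]]; split => //.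
  - by exists 0, 1; rewrite -[0]/(0%:P) LopC addr0 expr0.
  - exists (n%:R^-1 *: 'X), 0.
    rewrite LopZ /Lop derivX derivC mulr0 subr0 mulr1 scalerA mulVf ?pnatr_eq0 -?lt0n//.
    by rewrite scale1r add0r expr1.
  - have k0 : (k.+2 * (k.+1 + n))%:R != 0 :> R by rewrite pnatr_eq0.
    have -> : 'X^(k.+2) = (k.+2 * (k.+1 + n))%:R^-1 *: (Lop n 'X^(k.+2) + (k.+2 * k.+1)%:R *: 'X^k) :> {poly R}.
      by rewrite LopXn subrK scalerA mulVf// scale1r.
    apply: (PZ); apply: PD; last exact: PZ.
    by exists 'X^(k.+2), 0; rewrite add0r.
rewrite -[u]coefK poly_def.
elim/big_rec : _ => [|i a _ ih]; first by exists 0, 0; rewrite -[0]/(0%:P) LopC addr0.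
apply: PD => //; apply: PZ; exact: (PX _).1.
Qed.

End Lop_surjective.

(** * One-dimensional integrals *)

Section horner_rules.
Context {R : comNzRingType}.

Lemma horner_one (x : R) : (1 : {poly R}).[x] = 1.
Proof. by rewrite -polyC1 hornerC. Qed.

Lemma hornerB (p q : {poly R}) x : (p - q).[x] = p.[x] - q.[x].
Proof. by rewrite hornerD hornerN. Qed.

Definition pE := (@horner_exp R, @hornerXn R, @hornerB, @hornerD R, @hornerN R, @hornerM R,
  @hornerZ R, @hornerX R, @hornerC R, @horner_one).

End horner_rules.

Section interval_integral.
Context {R : realType}.
Local Notation mu := (@lebesgue_measure R).
Implicit Types (a b c : R) (f g F : R -> R).

Definition itv_int a b f : R := \int[mu]_(t in `[a, b]) f t.

Lemma within_continuous_integrable a b f : {within `[a, b], continuous f} ->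
  mu.-integrable `[a, b] (EFin \o f).
Proof. by apply: continuous_compact_integrable; exact: segment_compact. Qed.

Lemma within_continuousM a b f g : {within `[a, b], continuous f} ->
  {within `[a, b], continuous g} -> {within `[a, b], continuous (fun t => f t * g t)}.
Proof. by move=> cf cg t; apply: cvgM; [exact: cf|exact: cg]. Qed.

Lemma within_continuousT a b f : continuous f -> {within `[a, b], continuous f}.
Proof. exact: continuous_subspaceT. Qed.

Lemma itv_intD a b f g : {within `[a, b], continuous f} ->
  {within `[a, b], continuous g} ->
  itv_int a b (fun t => f t + g t) = itv_int a b f + itv_int a b g.
Proof.
move=> cf cg; apply: RintegralD => //; exact: within_continuous_integrable.
Qed.

Lemma itv_intZ a b c f : {within `[a, b], continuous f} ->
  itv_int a b (fun t => c * f t) = c * itv_int a b f.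
Proof.
move=> cf; apply: RintegralZl => //; exact: within_continuous_integrable.
Qed.

Lemma eq_itv_int a b f g : (forall t, a <= t <= b -> f t = g t) ->
  itv_int a b f = itv_int a b g.
Proof.
move=> fg; apply: eq_Rintegral => t; rewrite inE/= in_itv/=; exact: fg.
Qed.

Lemma le_itv_int a b f g : {within `[a, b], continuous f} ->
  {within `[a, b], continuous g} -> (forall t, a <= t <= b -> f t <= g t) ->
  itv_int a b f <= itv_int a b g.
Proof.
move=> cf cg fg; apply: le_Rintegral => //; try exact: within_continuous_integrable.
Qed.

Lemma itv_int_cst a b c : a <= b -> itv_int a b (fun=> c) = c * (b - a).
Proof.
move=> ab; have E : lebesgue_measure [set` `[a, b] ] = (b - a)%:E.
  rewrite lebesgue_measure_itv/= lte_fin.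
  by case: ltgtP ab => // -> _; rewrite subrr.
by rewrite /itv_int Rintegral_cst//; congr (_ * _); rewrite -[RHS]/(fine (b - a)%:E) -E.
Qed.

Lemma itv_int_split a b c f : a <= c <= b -> {within `[a, b], continuous f} ->
  itv_int a b f = itv_int a c f + itv_int c b f.
Proof.
move=> /andP[ac cb] cf; have intf := within_continuous_integrable cf.
apply/eqP; rewrite addrC -subr_eq /itv_int.
rewrite (@Rintegral_itvB _ _ (BLeft a) (BRight b) c)//.
rewrite Rintegral_itv_obnd_cbnd//.
by apply: integrableS intf => //; apply: subset_itvr; rewrite bnd_simp.
Qed.

Lemma itv_int_ge0 a b f : (forall t, a <= t <= b -> 0 <= f t) -> 0 <= itv_int a b f.
Proof. by move=> f0; apply: Rintegral_ge0 => t; rewrite /= in_itv/=; exact: f0. Qed.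

Lemma itv_int_derive a b f F : a < b -> {within `[a, b], continuous f} ->
  {within `[a, b], continuous F} ->
  (forall t, a < t < b -> is_derive t (1 : R) F (f t)) ->
  itv_int a b f = F b - F a.
Proof.
move=> ab cf cF dF; rewrite /itv_int /Rintegral.
rewrite (@continuous_FTC2 _ _ F)//.
  have [_ h1 h2] := (continuous_within_itvP F ab).1 cF; split => //.
  by move=> t; rewrite in_itv/= => /dF[].
by move=> t; rewrite in_itv/= => /dF[_ <-]; rewrite derive1E.
Qed.

Lemma ge0_derive_le a b f F : a <= b -> {within `[a, b], continuous F} ->
  (forall t, a < t < b -> is_derive t (1 : R) F (f t)) ->
  (forall t, a < t < b -> 0 <= f t) -> F a <= F b.
Proof.
rewrite le_eqVlt => /predU1P[->//|ab] cF dF f0.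
have dF' x : x \in `]a, b[ -> is_derive x (1:R) F (f x) by rewrite in_itv/=; exact: dF.
have [c cab] := MVT ab dF' cF.
move/eqP; rewrite subr_eq => /eqP ->; rewrite lerDr mulr_ge0 ?subr_ge0 ?(ltW ab)//.
by apply: f0; rewrite in_itv/= in cab.
Qed.

End interval_integral.

Section sin_weight.
Context {R : realType}.
Local Notation mu := (@lebesgue_measure R).
Implicit Types (t : R) (u v f g : {poly R}).

(* [sinw t] is the sine of the angle whose cosine is [t]. *)
Definition sinw t : R := Num.sqrt (1 - t ^+ 2).

Lemma sinw_ge0 t : 0 <= sinw t. Proof. exact: sqrtr_ge0. Qed.

Lemma sinwX_ge0 k t : 0 <= sinw t ^+ k. Proof. by rewrite exprn_ge0// sinw_ge0. Qed.

Lemma sinw_le1 t : sinw t <= 1.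
Proof. by rewrite -[leRHS]sqrtr1 ler_wsqrtr// gerBl sqr_ge0. Qed.

Lemma sinw_sqr t : -1 <= t <= 1 -> sinw t ^+ 2 = 1 - t ^+ 2.
Proof. by move=> /andP[t1 t2]; rewrite sqr_sqrtr//; nra. Qed.

Lemma sinw_gt0 t : -1 < t < 1 -> 0 < sinw t.
Proof. by move=> /andP[t1 t2]; rewrite sqrtr_gt0; nra. Qed.

Lemma sinw1 : sinw 1 = 0. Proof. by rewrite /sinw expr1n subrr sqrtr0. Qed.

Lemma sinwN1 : sinw (-1) = 0. Proof. by rewrite /sinw sqrrN expr1n subrr sqrtr0. Qed.

Lemma continuous_sinw : continuous sinw.
Proof. exact: continuous_sqrt_sub_sqr. Qed.

Lemma continuous_sinwX k : continuous (fun t => sinw t ^+ k).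
Proof.
move=> t; apply: (@continuous_comp _ _ _ sinw (fun x : R => x ^+ k)).
  exact: continuous_sinw.
exact: exprn_continuous.
Qed.

Lemma is_derive_sinw t : -1 < t < 1 ->
  is_derive t 1 sinw (- t / sinw t).
Proof. by move=> /andP[t1 t2]; apply: is_derive_sqrt_sub_sqr; nra. Qed.

Lemma is_derive_sinwX k t : -1 < t < 1 ->
  is_derive t 1 (fun t => sinw t ^+ k.+2) (- (k.+2%:R * t * sinw t ^+ k)).
Proof.
move=> t1; have s0 : sinw t != 0 by rewrite gt_eqF// sinw_gt0.
have H := @is_derive1_comp _ _ _ _ _ _ (is_derive_poly 'X^(k.+2) (sinw t)) (is_derive_sinw t1).
rewrite (_ : (fun t => _) = horner 'X^(k.+2) \o sinw); last first.
  by apply/funext => x; rewrite /= hornerXn.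
apply: (is_derive_eq H); rewrite derivXn hornerMn hornerXn -pred_Sn exprS.
by field.
Qed.

Lemma continuous_wt k f : continuous (fun t => sinw t ^+ k * f.[t]).
Proof.
by move=> t; apply: cvgM; [exact: continuous_sinwX|exact: continuous_horner].
Qed.

(** Divergence form of [Lop n] for n = k + 2: multiplied by the weight (1 - t^2)^((n - 2)/2), it is
    an exact derivative. *)
Lemma is_derive_flux k u t : -1 < t < 1 ->
  is_derive t 1 (fun t => sinw t ^+ k.+2 * u^`().[t])
    (- (sinw t ^+ k * (Lop k.+2 u).[t])).
Proof.
move=> t1; have H := is_deriveM (is_derive_sinwX k t1) (is_derive_poly u^`() t).
apply: (is_derive_eq H); rewrite /GRing.scale/= horner_Lop.
rewrite (_ : sinw t ^+ k.+2 = sinw t ^+ k * (1 - t ^+ 2)); last first.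
  rewrite -sinw_sqr; first by rewrite -exprD addn2.
  by case/andP: t1 => ? ?; rewrite !ltW.
ring.
Qed.

Lemma itv_int_Lop k u : itv_int (-1) 1 (fun t => sinw t ^+ k * (Lop k.+2 u).[t]) = 0.
Proof.
have E : itv_int (-1) 1 (fun t => -1 * (sinw t ^+ k * (Lop k.+2 u).[t])) = 0.
  transitivity (sinw 1 ^+ k.+2 * u^`().[1] - sinw (-1) ^+ k.+2 * u^`().[-1]); last first.
    by rewrite sinw1 sinwN1 !expr0n/= !mul0r subrr.
  apply: (@itv_int_derive R (-1) 1 _ (fun t => sinw t ^+ k.+2 * u^`().[t])).
  - by lra.
  - apply: within_continuousM; first by apply: within_continuousT; exact: cst_continuous.
    by apply: within_continuousT; exact: continuous_wt.
  - by apply: within_continuousT; exact: continuous_wt.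
  - by move=> t t1; apply: (is_derive_eq (is_derive_flux k u t1)); rewrite mulN1r.
rewrite itv_intZ in E; last by apply: within_continuousT; exact: continuous_wt.
by move/eqP: E; rewrite mulN1r oppr_eq0 => /eqP.
Qed.

Lemma kmassE m : @kmass R m.+2 = itv_int (-1) 1 (fun t => sinw t ^+ m.+1).
Proof.
rewrite /itv_int Rintegral_mkcond /kmass /kappa_mass /Rintegral; congr fine.
apply: eq_integral => t _; rewrite kappaSS patchE; case: ifPn => // /negP h.
rewrite -/(sinw t) (_ : sinw t = 0) ?expr0n//.
rewrite /sinw ler0_sqrtr// subr_le0 leNgt; apply/negP => h1; apply: h.
rewrite inE/= in_itv/= -ler_norml.
by rewrite -(@ler_pXn2r _ 2)// ?nnegrE// expr1n real_normK ?num_real// ltW.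
Qed.

(** On [-1/2, 1/2], an interval of length 1, the integrand is at least 2^-k. *)
Lemma kmass_gt0 k : 0 < @kmass R k.
Proof.
rewrite /kmass fine_gt0// kappa_mass_lty andbT.
pose D : set R := `[- 2^-1, 2^-1]%classic.
have mk : measurable_fun setT (fun s : R => (kappa k (1 - s ^+ 2))%:E).
  by apply/measurable_EFinP/measurableT_comp;
    [exact: measurable_kappa|exact: measurable_sub_sqr].
have mD : measurable D by exact: measurable_itv.
have H1 : (\int[mu]_(s in D) ((2^-1 : R) ^+ k)%:E <= \int[mu]_(s in D) (kappa k (1 - s ^+ 2))%:E)%E.
  apply: ge0_le_integral => //.
  - exact: measurable_funTS.
  - move=> s; rewrite /D /= in_itv/= => /andP[s1 s2]; rewrite lee_fin /kappa -/(sinw s).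
    have s0 : 2^-1 <= sinw s.
      rewrite -(ger0_norm (sinw_ge0 s)) -[leLHS]ger0_norm// -ler_sqr ?qualifE/= ?normr_ge0//.
      rewrite !ger0_norm ?sinw_ge0// sinw_sqr; first by nra.
      by rewrite (le_trans _ s1) ?(le_trans s2)//; lra.
    have s3 : 0 < sinw s by rewrite (lt_le_trans _ s0)// invr_gt0.
    rewrite ler_pdivlMr// (@le_trans _ _ ((2^-1) ^+ k))//.
      by rewrite ler_piMr ?exprn_ge0 ?invr_ge0// sinw_le1.
    by rewrite lerXn2r// ?nnegrE ?invr_ge0// ltW.
have H2 : (\int[mu]_(s in D) (kappa k (1 - s ^+ 2))%:E <= \int[mu]_s (kappa k (1 - s ^+ 2))%:E)%E.
  by apply: ge0_subset_integral => // s _; rewrite lee_fin kappa_ge0.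
apply: lt_le_trans (le_trans H1 H2).
have D1 : lebesgue_measure D = 1%E.
  rewrite /D lebesgue_measure_itv/= lte_fin ifT; last by lra.
  by rewrite -EFinB; congr EFin; lra.
rewrite integral_cst//; apply: mule_gt0; first by rewrite lte_fin exprn_gt0// invr_gt0.
by move: (@lte01 R); rewrite -D1.
Qed.

Lemma sphere_volume_gt0 n : 0 < @sphere_volume R n.
Proof. by rewrite sphere_volumeE mulr_gt0// prodr_gt0// => i _; exact: kmass_gt0. Qed.

End sin_weight.

(** * Integrals of zonal polynomials *)

Section zonal_integral.
Context {R : realType}.
Variable m : nat.
Local Notation n := m.+3.
Implicit Types (t : R) (u v f g : {poly R}).

(** The integral over S^n of q |-> f(p . q), sliced by the height t. As n = m + 3, the volume is
    V_(n-1) and the exponent is n - 2. *)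
Definition zint f : R :=
  sphere_volume m.+2 * itv_int (-1) 1 (fun t => sinw t ^+ m.+1 * f.[t]).

Lemma within_wt a b k f : {within `[a, b], continuous (fun t : R => sinw t ^+ k * f.[t])}.
Proof. by apply: within_continuousT; exact: continuous_wt. Qed.

Lemma zintD f g : zint (f + g) = zint f + zint g.
Proof.
rewrite /zint -mulrDr -itv_intD; try exact: within_wt.
by congr (_ * _); apply: eq_itv_int => t _; rewrite hornerD mulrDr.
Qed.

Lemma zintZ c f : zint (c *: f) = c * zint f.
Proof.
rewrite /zint mulrCA -[c * itv_int _ _ _]itv_intZ; last exact: within_wt.
by congr (_ * _); apply: eq_itv_int => t _; rewrite hornerZ mulrCA.
Qed.

Lemma zintB f g : zint (f - g) = zint f - zint g.
Proof. by rewrite -scaleN1r zintD zintZ mulN1r. Qed.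

Lemma le_zint f g : (forall t, -1 <= t <= 1 -> f.[t] <= g.[t]) -> zint f <= zint g.
Proof.
move=> fg; rewrite /zint ler_wpM2l ?(ltW (sphere_volume_gt0 _))//.
apply: le_itv_int; try exact: within_wt.
by move=> t /fg h; apply: ler_wpM2l => //; exact: sinwX_ge0.
Qed.

Lemma zint_ge0 f : (forall t, -1 <= t <= 1 -> 0 <= f.[t]) -> 0 <= zint f.
Proof.
move=> f0; rewrite (_ : 0 = zint 0); last by have := zintZ 0 0; rewrite scale0r mul0r.
by apply: le_zint => t /f0; rewrite horner0.
Qed.

Lemma zintC c : zint c%:P = c * sphere_volume n.
Proof.
rewrite /zint [in RHS]sphere_volumeS kmassE mulrCA -[c * itv_int _ _ _]itv_intZ; last first.
  by apply: within_continuousT; exact: continuous_sinwX.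
by congr (_ * _); apply: eq_itv_int => t _; rewrite hornerC mulrC.
Qed.

Lemma zint_Lop u : zint (Lop n u) = 0.
Proof. by rewrite /zint itv_int_Lop mulr0. Qed.

Lemma sphere_integrable_zonal p f : sphere_integrable (@zonal R n p f).
Proof. by rewrite zonalE; exact: sphere_integrable_psph. Qed.

(** Both sides are linear, agree on constants and vanish on the image of [Lop]; constants and that
    image span all polynomials. *)
Lemma sphere_integral_zonal p f : sphere n p -> sphere_integral (zonal p f) = zint f.
Proof.
move=> p1; have [u [c ->]] := @Lop_surj R n isT f.
rewrite zintD zintC zint_Lop addr0.
rewrite (@eq_sphere_integral _ _ _ (fun q => zonal p c%:P q + zonal p (Lop n u) q)); last first.
  by move=> q _; rewrite /zonal hornerD.
rewrite sphere_integralD; try exact: sphere_integrable_zonal.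
rewrite [X in _ + X]sphere_integral_Lop// addr0.
rewrite (@eq_sphere_integral _ _ _ (fun q => c * psph (PCst 1) q)); last first.
  by move=> q _; rewrite /zonal hornerC mulr1.
by rewrite sphere_integralZ//; exact: sphere_integrable_psph.
Qed.

Lemma sphere_delta : sphere n (delta_mx 0 ord0 : 'rV[R]_n.+1).
Proof. by rewrite /sphere/= dotv_delta mxE !eqxx. Qed.

(** Transferred from the sphere: it is the integration by parts there for two zonal functions with
    the same pole. *)
Lemma zint_green u v : zint (v * Lop n u) = zint ((1 - 'X^2) * u^`() * v^`()).
Proof.
rewrite -!(sphere_integral_zonal _ sphere_delta).
rewrite [LHS](@eq_sphere_integral _ _ _ (fun q => v.[dotv (delta_mx 0 ord0) q] *
   (Lop n u).[dotv (delta_mx 0 ord0) q])); last by move=> q _; rewrite /zonal hornerM.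
rewrite sphere_integral_Lop2; last exact: sphere_delta.
apply: eq_sphere_integral => q _; rewrite /zonal !hornerE.
by have := sphere_delta; rewrite /sphere/= => ->; ring.
Qed.

End zonal_integral.

(** * One-dimensional estimates *)

Section zonal_ode.
Context {R : realType}.
Variable m : nat.
Local Notation n := m.+3.
Implicit Types (t a b c : R) (P f g : {poly R}).

(** Up to the factor V_(n-1), the flux of the gradient of P(p . q) through the parallel p . q =
    t. *)
Definition flux P t : R := sinw t ^+ n * P^`().[t].

Lemma continuous_flux P : continuous (flux P).
Proof. exact: continuous_wt. Qed.

Lemma is_derive_fluxE P t : -1 < t < 1 ->
  is_derive t 1 (flux P) (- (sinw t ^+ m.+1 * (Lop n P).[t])).
Proof. exact: is_derive_flux. Qed.

Lemma fluxN1 P : flux P (-1) = 0.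
Proof. by rewrite /flux sinwN1 expr0n mul0r. Qed.

Lemma flux1 P : flux P 1 = 0.
Proof. by rewrite /flux sinw1 expr0n mul0r. Qed.

Lemma flux_nondecr P a b : -1 <= a -> a <= b -> b <= 1 ->
  (forall t, a < t < b -> (Lop n P).[t] <= 0) -> flux P a <= flux P b.
Proof.
move=> a1 ab b1 h; apply: (ge0_derive_le ab).
- exact/within_continuousT/continuous_flux.
- move=> t /andP[at1 tb]; apply: is_derive_fluxE.
  by rewrite (le_lt_trans a1)// (lt_le_trans tb).
- move=> t /h tb; rewrite -mulrN mulr_ge0 ?sinwX_ge0//; lra.
Qed.

Lemma flux_nonincr P a b : -1 <= a -> a <= b -> b <= 1 ->
  (forall t, a < t < b -> 0 <= (Lop n P).[t]) -> flux P b <= flux P a.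
Proof.
move=> a1 ab b1 h; rewrite -lerN2.
have fN t : - flux P t = flux (- P) t by rewrite /flux derivN hornerN mulrN.
rewrite !fN; apply: flux_nondecr => // t tab.
by rewrite -scaleN1r LopZ scaleN1r hornerN oppr_le0 h.
Qed.

Lemma flux_ge0_deriv P t : -1 < t < 1 -> 0 <= flux P t -> 0 <= P^`().[t].
Proof. by move=> t1; rewrite /flux pmulr_rge0// exprn_gt0// sinw_gt0. Qed.

(** The flux vanishes at both poles. It increases from -1 as long as [Lop n P] is nonpositive, and
    decreases towards 1 once [Lop n P] has become positive; in both regimes it is nonnegative, and
    so is P'. *)
Lemma deriv_ge0_single_crossing P :
  (forall s t, -1 <= s -> s <= t -> t <= 1 -> 0 < (Lop n P).[s] -> 0 <= (Lop n P).[t]) ->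
  forall t, -1 < t < 1 -> 0 <= P^`().[t].
Proof.
move=> cross t /andP[t1 t2]; apply: flux_ge0_deriv; first by rewrite t1.
have [[s [s1 st s0]]|/forallNP h] := pselect (exists s, [/\ -1 <= s, s <= t & 0 < (Lop n P).[s]]).
  rewrite -(flux1 P); apply: flux_nonincr => //; [exact: ltW|exact: ltW|].
  by move=> x /andP[tx x1]; apply: (cross s) => //; [rewrite (le_trans st)// ltW|exact: ltW].
rewrite -(fluxN1 P); apply: flux_nondecr => //; [exact: ltW|exact: ltW|].
move=> x /andP[x1 xt]; rewrite leNgt; apply/negP => x0; apply: (h x); split => //; exact: ltW.
Qed.

Definition left_const t : R := 2 ^+ n / (n%:R * (1 - t) ^+ n).

Lemma left_const_ge0 t : t <= 1 -> 0 <= left_const t.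
Proof. by move=> t1; rewrite divr_ge0 ?exprn_ge0// mulr_ge0 ?ler0n ?exprn_ge0// subr_ge0. Qed.

Lemma is_derive_left t : -1 < t < 1 ->
  is_derive t 1 (fun x => sinw x ^+ n * (((1 - 'X) ^+ n : {poly R}).[x])^-1)
    (n%:R * sinw t ^+ m.+1 / (1 - t) ^+ n).
Proof.
move=> /andP[t1 t2]; have t0 : 1 - t != 0 by rewrite gt_eqF// subr_gt0.
have p0 : ((1 - 'X) ^+ n : {poly R}).[t] != 0.
  by rewrite !pE expf_neq0.
have H1 := is_deriveV p0 (is_derive_poly ((1 - 'X) ^+ n : {poly R}) t).
have t12 : -1 < t < 1 by rewrite t1.
have H := is_deriveM (is_derive_sinwX m.+1 t12) H1.
apply: (is_derive_eq H).
rewrite /GRing.scale/= deriv_exp derivB derivX derivC sub0r hornerMn !pE.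
have -> : sinw t ^+ n = sinw t ^+ m.+1 * ((1 - t) * (1 + t)).
  rewrite (_ : (1 - t) * (1 + t) = 1 - t ^+ 2); last by ring.
  by rewrite -sinw_sqr -?exprD ?addn2// !ltW.
rewrite -[_ *+ n]mulr_natl (exprS _ m.+2).
have : (1 - t) ^+ m.+2 != 0 by rewrite expf_neq0.
set A := (1 - t) ^+ m.+2; set B := sinw t ^+ m.+1; move=> A0.
by field; rewrite A0.
Qed.

(* Comparison of the flux with a multiple of ((1 + t) / (1 - t)) ^ (n / 2). *)
Lemma deriv_le_left P t0 b : t0 < 1 -> 0 <= b ->
  (forall t, -1 <= t <= t0 -> - (Lop n P).[t] <= b) ->
  forall t, -1 < t <= t0 -> P^`().[t] <= b * left_const t0.
Proof.
move=> t01 b0 h t /andP[t1 tt0]; have t2 : t < 1 by rewrite (le_lt_trans tt0).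
pose K : R := b * 2 ^+ n / n%:R.
pose E := fun x => sinw x ^+ n * (((1 - 'X) ^+ n : {poly R}).[x])^-1.
have n0 : n%:R != 0 :> R by rewrite pnatr_eq0.
have : K * E (-1) - flux P (-1) <= K * E t - flux P t.
  apply: (@ge0_derive_le _ _ _ (fun x => K * (n%:R * sinw x ^+ m.+1 / (1 - x) ^+ n) -
     - (sinw x ^+ m.+1 * (Lop n P).[x])) (fun x => K * E x - flux P x)); first exact: ltW.
  - apply: continuous_in_subspaceT => x; rewrite inE/= in_itv/= => /andP[x1 xt].
    apply: cvgB; last exact: continuous_flux.
    apply: cvgMr; apply: cvgM; first exact: continuous_sinwX.
    apply: cvgV; last exact: continuous_horner.
    by rewrite !pE expf_neq0// gt_eqF// subr_gt0 (le_lt_trans xt).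
  - move=> x /andP[x1 xt]; have x12 : -1 < x < 1 by rewrite x1 (lt_trans xt).
    exact: (is_deriveB (is_deriveZ K (is_derive_left x12)) (is_derive_fluxE P x12)).
  - move=> x /andP[x1 xt]; have x2 : 0 < 1 - x by lra.
    have := h x _; rewrite (ltW x1) (ltW (lt_le_trans xt tt0)) => /(_ isT) hx.
    rewrite opprK /K.
    have -> : b * 2 ^+ n / n%:R * (n%:R * sinw x ^+ m.+1 / (1 - x) ^+ n) +
      sinw x ^+ m.+1 * (Lop n P).[x] =
      sinw x ^+ m.+1 * (b * (2 ^+ n / (1 - x) ^+ n) + (Lop n P).[x]).
      have : (1 - x) ^+ n != 0 by rewrite expf_neq0// gt_eqF.
      move: (n%:R : R) n0 ((1 - x) ^+ n) (sinw x ^+ m.+1) (2 ^+ n) => N n0 A B E2 A0.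
      by field; rewrite ?n0 ?A0.
    rewrite mulr_ge0 ?sinwX_ge0//.
    have : b <= b * (2 ^+ n / (1 - x) ^+ n).
      rewrite ler_peMr// ler_pdivlMr ?exprn_gt0// mul1r.
      by rewrite lerXn2r// ?nnegrE//; lra.
    lra.
rewrite fluxN1 /E sinwN1 expr0n !mul0r mulr0 subr0 subr_ge0 /flux !pE.
have s0 : 0 < sinw t ^+ n by rewrite exprn_gt0// sinw_gt0// t1.
rewrite [K * _]mulrCA ler_pM2l// => /le_trans; apply.
rewrite /K /left_const.
have -> : b * 2 ^+ n / n%:R / (1 - t) ^+ n = b * (2 ^+ n / (n%:R * (1 - t) ^+ n)).
  have : (1 - t) ^+ n != 0 by rewrite expf_neq0// gt_eqF// subr_gt0.
  move: (n%:R : R) n0 ((1 - t) ^+ n) (2 ^+ n) => N n0 A E2 A0.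
  by field; rewrite ?n0 ?A0.
rewrite ler_wpM2l// ler_wpM2l ?exprn_ge0//.
have p0 : (0 : R) < n%:R by rewrite ltr0n.
have hp x : x < 1 -> 0 < n%:R * (1 - x) ^+ n.
  by move=> x1; rewrite mulr_gt0// exprn_gt0// subr_gt0.
rewrite lef_pV2 ?posrE; [|exact: hp|exact: hp].
by rewrite ler_pM2l// lerXn2r// ?nnegrE; lra.

Qed.

(** Comparison with K t, whose image K n t under [Lop n] is at least [b] for t >= t0 when K = b / (n
    t0). Both fluxes vanish at 1, so integrating back from there compares the slopes. *)
Lemma deriv_le_right P t0 b : 0 < t0 -> 0 <= b ->
  (forall t, t0 <= t <= 1 -> (Lop n P).[t] <= b) ->
  forall t, t0 <= t < 1 -> P^`().[t] <= b / (n%:R * t0).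
Proof.
move=> t01 b0 h t /andP[t1 t2].
pose K : R := b / (n%:R * t0).
have n0 : (0 : R) < n%:R by rewrite ltr0n.
have t3 : 0 < t by rewrite (lt_le_trans t01).
have : flux P t - K * sinw t ^+ n <= flux P 1 - K * sinw 1 ^+ n.
  apply: (@ge0_derive_le _ _ _ (fun x => - (sinw x ^+ m.+1 * (Lop n P).[x])
     - K * - (n%:R * x * sinw x ^+ m.+1)) (fun x => flux P x - K * sinw x ^+ n)); first exact: ltW.
  - apply: within_continuousT => x; apply: cvgB; first exact: continuous_flux.
    by apply: cvgMr; exact: continuous_sinwX.
  - move=> x /andP[x1 xt]; have x12 : -1 < x < 1 by rewrite xt andbT (lt_trans _ x1)// (lt_trans _ t3).
    exact: (is_deriveB (is_derive_fluxE P x12) (is_deriveZ K (is_derive_sinwX m.+1 x12))).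
  - move=> x /andP[x1 xt].
    have := h x _; rewrite (ltW (le_lt_trans t1 x1)) (ltW xt) => /(_ isT) hx.
    have -> : - (sinw x ^+ m.+1 * (Lop n P).[x]) - K * - (n%:R * x * sinw x ^+ m.+1) =
       sinw x ^+ m.+1 * (b * (x / t0) - (Lop n P).[x]).
      by rewrite /K; field; rewrite !gt_eqF.
    rewrite mulr_ge0 ?sinwX_ge0//.
    have : b <= b * (x / t0).
      by rewrite ler_peMr// ler_pdivlMr// mul1r (le_trans t1)// ltW.
    lra.
rewrite flux1 sinw1 expr0n mulr0 subr0 subr_le0 /flux [K * _]mulrC.
by rewrite ler_pM2l// exprn_gt0// sinw_gt0// t2 (lt_trans _ t3).
Qed.

(** The flux at [t] is the weighted integral of f - c over [t, 1]. Dropping c >= 0 and extending the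
    interval, as f >= 0, bounds it by the total mass. *)
Lemma flux_le_mass P f c t : Lop n P = f - c%:P -> 0 <= c ->
  (forall t, -1 <= t <= 1 -> 0 <= f.[t]) -> -1 <= t -> t < 1 ->
  flux P t <= itv_int (-1) 1 (fun t => sinw t ^+ m.+1 * f.[t]).
Proof.
move=> LP c0 f0 t1 t2.
have F : itv_int t 1 (fun t => -1 * (sinw t ^+ m.+1 * (Lop n P).[t])) = flux P 1 - flux P t.
  apply: itv_int_derive => //.
  - apply: within_continuousM; first by apply: within_continuousT; exact: cst_continuous.
    exact: within_wt.
  - exact/within_continuousT/continuous_flux.
  - move=> x /andP[x1 x2]; rewrite mulN1r; apply: is_derive_fluxE.
    by rewrite x2 andbT (le_lt_trans t1).
rewrite itv_intZ in F; last exact: within_wt.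
have -> : flux P t = itv_int t 1 (fun t => sinw t ^+ m.+1 * (Lop n P).[t]).
  by move: F; rewrite flux1; lra.
rewrite (@itv_int_split _ (-1) 1 t) ?t1 ?(ltW t2)//; last exact: within_wt.
apply: ler_wpDl.
  apply: itv_int_ge0 => x /andP[x1 x2]; rewrite mulr_ge0 ?sinwX_ge0// f0// x1.
  by rewrite (le_trans x2)// ltW.
apply: le_itv_int; [exact: within_wt|exact: within_wt|].
move=> x _; rewrite ler_wpM2l ?sinwX_ge0// LP !pE; lra.
Qed.

End zonal_ode.

(** * Smoothing error and self-energy of a profile *)

Section smoothing_constants.
Context {R : realType}.
Variable m : nat.
Local Notation n := m.+3.
Local Notation zint := (@zint R m).
Local Notation vol := (@sphere_volume R n).
Local Notation vol' := (@sphere_volume R m.+2).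
Implicit Types (t a b c : R) (f g D U : {poly R}).

Lemma zint_X : zint 'X = 0.
Proof.
have n0 : n%:R != 0 :> R by rewrite pnatr_eq0.
have E : Lop n 'X = n%:R *: 'X :> {poly R}.
  by rewrite /Lop derivX derivC mulr0 subr0 mulr1.
have := @zint_Lop R m 'X; rewrite E zintZ => /eqP; rewrite mulf_eq0 (negbTE n0).
by move/eqP.
Qed.

Lemma zint_mulX D : n%:R * zint ('X * D) = zint ('X * Lop n D).
Proof.
have E : Lop n 'X = n%:R *: 'X :> {poly R}.
  by rewrite /Lop derivX derivC mulr0 subr0 mulr1.
rewrite (@zint_green R m D 'X) mulrAC -(@zint_green R m 'X D) E.
by rewrite [D * _]mulrC -scalerAl zintZ.
Qed.

(** As [D] and X have mean zero, integrating (1 - X) (D - D(-1)) leaves - zint(X D) - D(-1) vol, and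
    X being an eigenfunction for n turns zint(X D) into zint(X (g - f)) / n. The same integral is
    nearly negligible: beyond t0 the factor 1 - t is at most 1 - t0, and before t0 the difference D
    - D(-1) is small because f <= b there. The factor 1 - t0 is absorbed on the left, which is where
    t0 vol comes from. *)
Lemma zint_drop f g D t0 b : 0 < t0 -> t0 < 1 -> 0 <= b ->
  Lop n D = g - f -> zint D = 0 -> zint f = zint g ->
  (forall t, -1 <= t <= 1 -> 0 <= f.[t]) ->
  (forall t, -1 <= t <= 1 -> 0 <= g.[t]) ->
  (forall s t, -1 <= s -> s <= t -> t <= 1 -> 0 < g.[s] - f.[s] -> 0 <= g.[t] - f.[t]) ->
  (forall t, -1 <= t <= t0 -> f.[t] <= b) ->
  (forall t, -1 <= t <= 1 -> D.[-1] <= D.[t]) /\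
  - D.[-1] * (t0 * vol) <= zint (f * (1 - 'X)) / n%:R + 4 * (b * left_const m t0) * vol.
Proof.
move=> t00 t01 b0 LD D0 fg f0 g0 cross fb.
have D' : forall t, -1 < t < 1 -> 0 <= D^`().[t].
  apply: (@deriv_ge0_single_crossing R m) => s t s1 st t1; rewrite LD !pE.
  exact: cross.
have cD (Q : {poly R}) a c : {within `[a, c], continuous (horner Q)}.
  by apply: within_continuousT; exact: continuous_horner.
have Dmin : forall t, -1 <= t <= 1 -> D.[-1] <= D.[t].
  move=> t /andP[t1 t2]; apply: (@ge0_derive_le _ _ _ (horner D^`()) (horner D)) => //.
  by move=> x /andP[x1 x2]; apply: D'; rewrite x1 (lt_le_trans x2).
split => //.
have d0 : 0 <= b * left_const m t0 by rewrite mulr_ge0// left_const_ge0// ltW.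
move Ed : (b * left_const m t0) d0 => d d0.
have Dleft t : -1 <= t <= t0 -> D.[t] - D.[-1] <= 2 * d.
  move=> /andP[t1 tt0].
  have : (d%:P * 'X - D).[-1] <= (d%:P * 'X - D).[t].
    apply: (@ge0_derive_le _ _ _ (horner (d%:P * 'X - D)^`()) (horner (d%:P * 'X - D))) => //.
    move=> x /andP[x1 xt]; rewrite derivB derivM derivX derivC mul0r add0r mulr1 !pE subr_ge0.
    rewrite -Ed; apply: (@deriv_le_left R m D t0 b) => //; last by rewrite x1 (le_trans (ltW xt)).
    move=> s /andP[s1 s2]; rewrite LD !pE opprB.
    have sb := fb s; rewrite s1 s2 in sb; have {}sb := sb isT.
    have sg := g0 s; rewrite s1 (le_trans s2 (ltW t01)) in sg; have {}sg := sg isT.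
    lra.
  rewrite !pE => h; have : d * (t + 1) <= d * 2 by rewrite ler_wpM2l//; lra.
  lra.
have key : zint ((1 - 'X) * (D - (D.[-1])%:P)) <=
    zint ((1 - t0) *: (D - (D.[-1])%:P) + (4 * d)%:P).
  apply: le_zint => t t12; rewrite !pE.
  have h1 := Dmin t t12; have [tt0|t0t] := leP t t0.
    have h2 := Dleft t; rewrite tt0 andbT in h2; have {}h2 := h2 (andP t12).1.
    case/andP: t12 => t1 t2.
    have h3 : (1 - t) * (D.[t] - D.[-1]) <= 2 * (2 * d) by apply: ler_pM; lra.
    have h4 : 0 <= (1 - t0) * (D.[t] - D.[-1]) by rewrite mulr_ge0; lra.
    lra.
  have : (1 - t) * (D.[t] - D.[-1]) <= (1 - t0) * (D.[t] - D.[-1]).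
    by rewrite ler_wpM2r; lra.
  lra.
have E1 : zint ((1 - 'X) * (D - (D.[-1])%:P)) = - zint ('X * D) - D.[-1] * vol.
  rewrite (_ : (1 - 'X) * _ = D - 'X * D - (D.[-1])%:P + D.[-1] *: 'X); last first.
    by rewrite -mul_polyC; ring.
  by rewrite zintD !zintB zintZ zint_X D0 zintC; ring.
have E2 : zint ((1 - t0) *: (D - (D.[-1])%:P) + (4 * d)%:P) =
    - (1 - t0) * D.[-1] * vol + 4 * d * vol.
  by rewrite zintD zintZ zintB D0 !zintC; ring.
have E3 : zint ('X * D) = zint ('X * (g - f)) / n%:R.
  by rewrite -LD -zint_mulX [RHS]mulrAC divff ?mul1r// pnatr_eq0.
(* The masses of [f] and [g] being equal, the two sides differ by zint(g (1 - X)), which is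
   nonnegative. *)
have E4 : zint ('X * (g - f)) <= zint (f * (1 - 'X)).
  rewrite mulrBr zintB (_ : f * _ = f - 'X * f); last by rewrite mulrBr mulr1 mulrC.
  rewrite zintB fg lerB// -subr_ge0 -zintB; apply: zint_ge0 => t t1.
  rewrite !pE; have := g0 t t1; case/andP: t1 => t1 t2 gt0.
  by rewrite -[X in X - _]mul1r -mulrBl mulr_ge0; lra.
rewrite E1 E2 E3 in key.
have n0 : (0 : R) < n%:R by rewrite ltr0n.
have : zint ('X * (g - f)) / n%:R <= zint (f * (1 - 'X)) / n%:R.
  by rewrite ler_pM2r ?invr_gt0.
move: (zint ('X * (g - f)) / n%:R) (zint (f * (1 - 'X)) / n%:R) key => A B key AB.
have -> : - D.[-1] * (t0 * vol) = - D.[-1] * vol + (1 - t0) * D.[-1] * vol by ring.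
rewrite (le_trans _ (lerD AB (lexx (4 * d * vol))))// -subr_ge0.
have -> : A + 4 * d * vol - (- D.[-1] * vol + (1 - t0) * D.[-1] * vol) =
  (- (1 - t0) * D.[-1] * vol + 4 * d * vol) - (- A - D.[-1] * vol) by ring.
by rewrite subr_ge0.
Qed.

Lemma within_t_sinw a b k : {within `[a, b], continuous (fun t : R => t * sinw t ^+ k)}.
Proof.
apply: within_continuousT => t; apply: cvgM; first exact: cvg_id.
exact: continuous_sinwX.
Qed.

(** The factor t makes the primitive elementary. The estimates below introduce it at the cost of t /
    t0 >= 1, a loss that disappears as t0 tends to 1. *)
Lemma itv_int_t_sinw a k : -1 <= a -> a < 1 ->
  itv_int a 1 (fun t => t * sinw t ^+ k) = sinw a ^+ k.+2 / k.+2%:R.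
Proof.
move=> a1 a2; have k0 : k.+2%:R != 0 :> R by rewrite pnatr_eq0.
have E : itv_int a 1 (fun t => - k.+2%:R * (t * sinw t ^+ k)) = sinw 1 ^+ k.+2 - sinw a ^+ k.+2.
  apply: (@itv_int_derive R a 1 _ (fun t => sinw t ^+ k.+2)) => //.
  - apply: within_continuousM; last exact: within_t_sinw.
    by apply: within_continuousT; exact: cst_continuous.
  - exact/within_continuousT/continuous_sinwX.
  - move=> t /andP[t1 t2]; have t12 : -1 < t < 1 by rewrite t2 andbT (le_lt_trans a1).
    by apply: (is_derive_eq (is_derive_sinwX k t12)); ring.
rewrite itv_intZ ?sinw1 ?expr0n/= in E; last exact: within_t_sinw.
have : k.+2%:R * itv_int a 1 (fun t => t * sinw t ^+ k) = sinw a ^+ k.+2 by lra.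
by move=> <-; rewrite mulrC mulKf.
Qed.

(** Left of t0 the crude bounds 1 - t <= 2, f <= b and length at most 2 give 4 b. Right of it, 1 - t
    is at most t (1 - t^2) / (t0 (1 + t0)), whose weighted integral is elementary. *)
Lemma zint_moment f t0 b M : 0 < t0 -> t0 < 1 -> 0 <= b -> 0 <= M ->
  (forall t, -1 <= t <= t0 -> f.[t] <= b) -> (forall t, t0 <= t <= 1 -> f.[t] <= M) ->
  zint (f * (1 - 'X)) <=
  vol' * (4 * b + M * sinw t0 ^+ m.+3.+2 / (m.+3.+2%:R * (t0 * (1 + t0)))).
Proof.
move=> t00 t01 b0 M0 fb fM; rewrite /zint ler_wpM2l ?(ltW (sphere_volume_gt0 _))//.
have ts : -1 <= t0 <= 1 by apply/andP; split; lra.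
rewrite (@itv_int_split _ (-1) 1 t0)//; last exact: within_wt.
apply: lerD.
  apply: (@le_trans _ _ (itv_int (-1) t0 (fun=> 2 * b))).
    apply: le_itv_int; [exact: within_wt|by apply: within_continuousT; exact: cst_continuous|].
    move=> t tt; rewrite !pE; have := fb t tt; case/andP: tt => t1 t2 ftb.
    apply: (@le_trans _ _ (sinw t ^+ m.+1 * (2 * b))).
      rewrite ler_wpM2l ?sinwX_ge0// mulrC.
      apply: (@le_trans _ _ ((1 - t) * b)); first by rewrite ler_wpM2l//; lra.
      by rewrite ler_wpM2r//; lra.
    by rewrite ler_piMl ?mulr_ge0// exprn_ile1 ?sinw_ge0// sinw_le1.
  rewrite itv_int_cst; nra.
have q0 : 0 < t0 * (1 + t0) by nra.
apply: (@le_trans _ _ (itv_int t0 1 (fun t => M / (t0 * (1 + t0)) * (t * sinw t ^+ n)))).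
  apply: le_itv_int; [exact: within_wt| |].
    apply: within_continuousM; last exact: within_t_sinw.
    by apply: within_continuousT; exact: cst_continuous.
  move=> t tt; rewrite !pE; have := fM t tt; case/andP: tt => t1 t2 ftM.
  have sE : sinw t ^+ n = sinw t ^+ m.+1 * (1 - t ^+ 2).
    by rewrite -sinw_sqr -?exprD ?addn2//; apply/andP; split; lra.
  have -> : M / (t0 * (1 + t0)) * (t * sinw t ^+ n) =
     sinw t ^+ m.+1 * (M * (1 - t) * ((t * (1 + t)) / (t0 * (1 + t0)))).
    by rewrite sE; field; rewrite !gt_eqF//; lra.
  rewrite ler_wpM2l ?sinwX_ge0//.
  apply: (@le_trans _ _ (M * (1 - t))); first by rewrite ler_wpM2r//; lra.
  rewrite ler_peMr ?mulr_ge0//; first by lra.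
  by rewrite ler_pdivlMr// mul1r; nra.
rewrite itv_intZ; last exact: within_t_sinw.
rewrite itv_int_t_sinw//; last by lra.
rewrite le_eqVlt; apply/orP; left; apply/eqP.
have k0 : m.+3.+2%:R != 0 :> R by rewrite pnatr_eq0.
move: (m.+3.+2%:R : R) k0 => N k0.
by field; rewrite k0 !gt_eqF//; lra.
Qed.

Lemma is_derive_inv_sinw t : -1 < t < 1 ->
  is_derive t 1 (fun t => (sinw t ^+ m.+1)^-1) (m.+1%:R * (t / sinw t ^+ n)).
Proof.
move=> t1; have s0 : sinw t != 0 by rewrite gt_eqF// sinw_gt0.
have H0 := @is_derive1_comp _ _ _ _ _ _ (is_derive_poly 'X^(m.+1) (sinw t)) (is_derive_sinw t1).
have p0 : (horner 'X^(m.+1) \o sinw) t != 0 by rewrite /= hornerXn expf_neq0.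
have H := is_deriveV p0 H0.
rewrite (_ : (fun t => _) = (fun y => ((horner 'X^(m.+1) \o sinw) y)^-1)); last first.
  by apply/funext => x; rewrite /= hornerXn.
apply: (is_derive_eq H); rewrite /GRing.scale/= hornerXn derivXn hornerMn hornerXn -pred_Sn.
rewrite -[_ *+ m.+1]mulr_natl !exprS.
have : sinw t ^+ m != 0 by rewrite expf_neq0.
move: (sinw t) s0 (sinw t ^+ m) (m.+1%:R : R) => A A0 B N B0.
by field; rewrite A0 B0.
Qed.

(** Three zones. On [-1, t1] only the constant background c acts and the slope is bounded. On
    [t1, T] the flux is at most 1 / V_(n-1), as for a point mass. On [T, 1], the cap, the slope is
    at most that of a uniform charge of height M. With s = sinw T and M about n / (V_(n-1) s^n), the
    last two zones give s^(2 - n) / V_(n-1) times 1 / (n - 2) and 1 / (n + 2) at leading order. *)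
Lemma zint_energy f U c t1 T M : 0 < t1 -> t1 <= T -> T < 1 -> 0 <= M -> 0 <= c ->
  Lop n U = f - c%:P -> zint f = 1 ->
  (forall t, -1 <= t <= 1 -> 0 <= f.[t]) ->
  (forall s t, -1 <= s -> s <= t -> t <= 1 -> f.[s] <= f.[t]) ->
  (forall t, -1 <= t <= 1 -> f.[t] <= M) ->
  zint ((1 - 'X^2) * U^`() * U^`()) <=
  vol' * (2 * (c * left_const m t1) ^+ 2 +
     (vol' ^+ 2 * (m.+1%:R * t1 * sinw T ^+ m.+1))^-1 +
     (M / (n%:R * T)) ^+ 2 * (sinw T ^+ m.+3.+2 / (m.+3.+2%:R * T))).
Proof.
move=> t10 t1T T1 M0 c0 LU f1 f0 fincr fM.
have v0 := sphere_volume_gt0 m.+2 : 0 < vol'.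
have U0 : forall t, -1 < t < 1 -> 0 <= U^`().[t].
  apply: (@deriv_ge0_single_crossing R m) => s t s1 st t2; rewrite LU !pE.
  by have := fincr s t s1 st t2; lra.
have T0 : 0 < T by lra.
have C0 : 0 <= c * left_const m t1 by rewrite mulr_ge0// left_const_ge0//; lra.
set C := c * left_const m t1 in C0 *.
pose G t : R := sinw t ^+ n * U^`().[t] ^+ 2.
have cG : continuous G.
  move=> t; apply: cvgM; first exact: continuous_sinwX.
  apply: (@continuous_comp _ _ _ (horner U^`()) (fun x : R => x ^+ 2)).
    exact: continuous_horner.
  exact: exprn_continuous.
have wG a b : {within `[a, b], continuous G} by exact: within_continuousT.
have -> : zint ((1 - 'X^2) * U^`() * U^`()) = vol' * itv_int (-1) 1 G.
  congr (_ * _); apply: eq_itv_int => t t12; rewrite !pE /G.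
  rewrite (_ : sinw t ^+ n = sinw t ^+ m.+1 * (1 - t ^+ 2)); last first.
    by rewrite -sinw_sqr -?exprD ?addn2.
  by ring.
rewrite ler_wpM2l ?(ltW v0)//.
rewrite (@itv_int_split _ (-1) 1 T)//; last by apply/andP; split; lra.
rewrite (@itv_int_split _ (-1) T t1)//; last by apply/andP; split; lra.
apply: lerD; first apply: lerD.
- apply: (@le_trans _ _ (itv_int (-1) t1 (fun=> C ^+ 2))).
    apply: le_itv_int => //; first by apply: within_continuousT; exact: cst_continuous.
    move=> t /andP[tN1 tt1]; rewrite /G.
    move: tN1; rewrite le_eqVlt => /predU1P[<-|tN1].
      by rewrite sinwN1 expr0n mul0r sqr_ge0.
    have h1 : U^`().[t] <= C.
      apply: (@deriv_le_left R m U t1 c) => //; [lra| |by rewrite tN1].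
      move=> x /andP[x1 x2]; rewrite LU !pE.
      have := f0 x; rewrite x1 (le_trans x2 (le_trans t1T (ltW T1))) => /(_ isT); lra.
    have h0 : 0 <= U^`().[t] by apply: U0; rewrite tN1; lra.
    apply: (@le_trans _ _ (U^`().[t] ^+ 2)).
      by rewrite ler_piMl ?sqr_ge0// exprn_ile1 ?sinw_ge0// sinw_le1.
    by rewrite lerXn2r// nnegrE.
  rewrite itv_int_cst; last by lra.
  have := sqr_ge0 C; nra.
- have J1 : itv_int (-1) 1 (fun t => sinw t ^+ m.+1 * f.[t]) = vol'^-1.
    have vn : vol' != 0 by rewrite gt_eqF.
    by apply: (mulfI vn); rewrite mulfV// -f1.
  (* The division by t1 pays for the factor t that makes the primitive of t / sinw t ^+ n
     elementary. *)
  pose K : R := vol'^-1 ^+ 2 / t1.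
  have wI : {within `[t1, T], continuous (fun t : R => t / sinw t ^+ n)}.
    apply: continuous_in_subspaceT => t; rewrite inE/= in_itv/= => /andP[h1 h2].
    apply: cvgM; first exact: cvg_id.
    apply: cvgV; last exact: continuous_sinwX.
    by rewrite expf_neq0// gt_eqF// sinw_gt0//; apply/andP; split; lra.
  have wK : {within `[t1, T], continuous (fun t : R => K * (t / sinw t ^+ n))}.
    by apply: within_continuousM => //; apply: within_continuousT; exact: cst_continuous.
  apply: (@le_trans _ _ (itv_int t1 T (fun t => K * (t / sinw t ^+ n)))).
    apply: le_itv_int => //.
    move=> t /andP[h1 h2]; have t12 : -1 < t < 1 by apply/andP; split; lra.
    have s0 : 0 < sinw t ^+ n by rewrite exprn_gt0// sinw_gt0.
    have fl0 : 0 <= flux m U t by rewrite /flux mulr_ge0 ?U0// ltW.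
    have fl1 : flux m U t <= vol'^-1.
      by rewrite -J1; apply: (flux_le_mass LU) => //; case/andP: t12 => ? ?; lra.
    have -> : G t = flux m U t ^+ 2 / sinw t ^+ n.
      by rewrite /G /flux; field; rewrite gt_eqF.
    rewrite mulrA ler_wpM2r ?invr_ge0 ?(ltW s0)//.
    apply: (@le_trans _ _ (vol'^-1 ^+ 2)).
      by rewrite lerXn2r// nnegrE ?invr_ge0// ltW.
    rewrite /K -mulrA ler_peMr ?sqr_ge0// mulrC ler_pdivlMr// mul1r//.
  rewrite itv_intZ//.
  have E : m.+1%:R * itv_int t1 T (fun t => t / sinw t ^+ n) =
     (sinw T ^+ m.+1)^-1 - (sinw t1 ^+ m.+1)^-1.
    rewrite -itv_intZ//; move: t1T; rewrite le_eqVlt => /predU1P[<-|t1T].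
      rewrite subrr /itv_int set_itv1 /Rintegral integral_set1//.
    apply: (@itv_int_derive R t1 T _ (fun t => (sinw t ^+ m.+1)^-1)) => //.
    - by apply: within_continuousM => //; apply: within_continuousT; exact: cst_continuous.
    - apply: continuous_in_subspaceT => t; rewrite inE/= in_itv/= => /andP[h1 h2].
      apply: cvgV; last exact: continuous_sinwX.
      by rewrite expf_neq0// gt_eqF// sinw_gt0//; apply/andP; split; lra.
    - by move=> t /andP[h1 h2]; apply: is_derive_inv_sinw; apply/andP; split; lra.
  have m0 : (0 : R) < m.+1%:R by rewrite ltr0n.
  have sT : 0 < sinw T ^+ m.+1 by rewrite exprn_gt0// sinw_gt0//; apply/andP; split; lra.
  have -> : itv_int t1 T (fun t => t / sinw t ^+ n) =
     ((sinw T ^+ m.+1)^-1 - (sinw t1 ^+ m.+1)^-1) / m.+1%:R.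
    by rewrite -E mulrC mulKf// gt_eqF.
  apply: (@le_trans _ _ (K * ((sinw T ^+ m.+1)^-1 / m.+1%:R))).
    have K0 : 0 <= K by rewrite divr_ge0 ?sqr_ge0// ltW.
    rewrite ler_wpM2l// ler_wpM2r ?invr_ge0 ?(ltW m0)//.
    by rewrite gerBl invr_ge0 sinwX_ge0.
  rewrite le_eqVlt; apply/orP; left; apply/eqP; rewrite /K.
  move: (m.+1%:R : R) m0 => N N0.
  by field; rewrite !gt_eqF.
- pose K : R := (M / (n%:R * T)) ^+ 2 / T.
  have wK : {within `[T, 1], continuous (fun t : R => K * (t * sinw t ^+ n))}.
    by apply: within_continuousM; [apply: within_continuousT; exact: cst_continuous|exact: within_t_sinw].
  apply: (@le_trans _ _ (itv_int T 1 (fun t => K * (t * sinw t ^+ n)))).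
    apply: le_itv_int => //.
    move=> t /andP[h1]; rewrite le_eqVlt => /predU1P[->|h2].
      by rewrite /G sinw1 expr0n mul0r !mulr0.
    have h0 : 0 <= U^`().[t] by apply: U0; apply/andP; split; lra.
    have h3 : U^`().[t] <= M / (n%:R * T).
      apply: (@deriv_le_right R m U T M) => //; last by rewrite h1.
      move=> x /andP[x1 x2]; rewrite LU !pE.
      have := fM x; rewrite x2 andbT => /(_ _); have -> : -1 <= x by lra.
      by move=> /(_ isT); lra.
    rewrite /G mulrA mulrC ler_wpM2r ?sinwX_ge0//.
    apply: (@le_trans _ _ ((M / (n%:R * T)) ^+ 2)).
      by rewrite lerXn2r// nnegrE// (le_trans h0).
    by rewrite /K -mulrA ler_peMr ?sqr_ge0// mulrC ler_pdivlMr// mul1r.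
  rewrite itv_intZ; last exact: within_t_sinw.
  rewrite itv_int_t_sinw//; last by lra.
  rewrite le_eqVlt; apply/orP; left; apply/eqP; rewrite /K.
  have k0 : m.+3.+2%:R != 0 :> R by rewrite pnatr_eq0.
  have n0 : n%:R != 0 :> R by rewrite pnatr_eq0.
  move: (m.+3.+2%:R : R) k0 (n%:R : R) n0 => N k0 N' n0.
  by field; rewrite k0 n0 gt_eqF.
Qed.

End smoothing_constants.

(** * Approximate indicators of caps *)

Section step_polynomials.
Context {R : realType}.
Implicit Types (s t x : R) (f g : {poly R}).

Lemma bernoulli_le x k : 0 <= x <= 1 -> 1 - k%:R * x <= (1 - x) ^+ k.
Proof.
move=> /andP[x0 x1]; elim: k => [|k ih]; first by rewrite mul0r subr0 expr0.
rewrite exprS; apply: (@le_trans _ _ ((1 - x) * (1 - k%:R * x))).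
  rewrite -natr1 -subr_ge0 (_ : _ - _ = k%:R * x ^+ 2); last by ring.
  by rewrite mulr_ge0// sqr_ge0.
by rewrite ler_wpM2l// subr_ge0.
Qed.

Lemma bernoulli_ge x k : 0 <= x <= 1 -> (1 - x) ^+ k * (1 + k%:R * x) <= 1.
Proof.
move=> /andP[x0 x1]; elim: k => [|k ih]; first by rewrite mul0r addr0 expr0 mulr1.
apply: le_trans ih; rewrite exprSr -mulrA ler_wpM2l ?exprn_ge0 ?subr_ge0//.
rewrite -natr1 -subr_ge0 (_ : _ - _ = (k%:R + 1) * x ^+ 2); last by ring.
by rewrite mulr_ge0 ?addr_ge0// sqr_ge0.
Qed.

Lemma exists_expr_le x eps : 0 <= x < 1 -> 0 < eps -> exists k, x ^+ k <= eps.
Proof.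
move=> /andP[x0 x1] e0.
have /cvgrPdist_le /(_ eps e0) : x ^+ k @[k --> \oo] --> (0 : R).
  by apply: cvg_expr; rewrite ger0_norm.
move=> [k _ h]; exists k; have := h k (leqnn k).
by rewrite sub0r normrN ger0_norm// exprn_ge0.
Qed.

(** Uniform approximation alone would not do: the sign arguments on [Lop] need exact monotonicity
    and exact nonnegativity. The polynomial is the one used in elementary proofs of the
    Stone-Weierstrass theorem, in the variable (1 - t) / 2. *)
Lemma step_poly (a b eta : R) : -1 < a -> a < b -> b < 1 -> 0 < eta ->
  exists f, [/\ forall t, -1 <= t <= 1 -> 0 <= f.[t] <= 1,
    forall s t, -1 <= s -> s <= t -> t <= 1 -> f.[s] <= f.[t],
    forall t, -1 <= t <= a -> f.[t] <= eta &
    forall t, b <= t <= 1 -> 1 - eta <= f.[t]].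
Proof.
move=> a1 ab b1 eta0.
pose sa := (1 - a) / 2; pose sb := (1 - b) / 2; pose c := (sa + sb) / 2.
have sb0 : 0 < sb by rewrite /sb; lra.
have sbc : sb < c by rewrite /c /sb /sa; lra.
have csa : c < sa by rewrite /c /sb /sa; lra.
have sa1 : sa < 1 by rewrite /sa; lra.
have c0 : 0 < c by lra.
have x01 : 0 <= Num.max (sb / c) (c / sa) < 1.
  rewrite le_max divr_ge0 ?(ltW c0) ?(ltW sb0)//= gt_max.
  by apply/andP; split; rewrite ltr_pdivrMr ?mul1r ?sbc ?csa// (lt_trans c0).
have e2 : 0 < eta / 2 by lra.
have [k] := exists_expr_le x01 e2; set x := Num.max _ _ => hk.
have hb : (sb / c) ^+ k <= eta / 2.
  apply: le_trans hk; rewrite lerXn2r ?nnegrE//; last by rewrite le_max lexx.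
    by rewrite divr_ge0 ?ltW.
  by case/andP: x01.
have ha : (c / sa) ^+ k <= eta.
  apply: (@le_trans _ _ (eta / 2)); last by lra.
  apply: le_trans hk; rewrite lerXn2r ?nnegrE//; last by rewrite le_max lexx orbT.
    by rewrite divr_ge0; lra.
  by case/andP: x01.
pose K := (Num.truncn (c^-1 ^+ k)).+1.
have ck0 : 0 < c^-1 ^+ k by rewrite exprn_gt0// invr_gt0.
have ck1 : 1 <= c^-1 ^+ k by rewrite exprn_ege1// invf_ge1//; lra.
have K1 : c^-1 ^+ k < K%:R by exact: truncnS_gt.
have K2 : K%:R <= 2 * c^-1 ^+ k.
  have := truncn_itv (ltW ck0) => /andP[h _].
  rewrite /K -natr1; lra.
(* The k-th powers separate a from b and the K-th power, with [K ~ c^-k],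
   amplifies the separation. *)
pose f : {poly R} := (1 - (2^-1 *: (1 - 'X)) ^+ k) ^+ K.
have fE t : f.[t] = (1 - ((1 - t) / 2) ^+ k) ^+ K.
  by rewrite /f !pE [2^-1 * _]mulrC.
have s01 t : -1 <= t <= 1 -> 0 <= ((1 - t) / 2) ^+ k <= 1.
  move=> /andP[t1 t2]; have h0 : 0 <= (1 - t) / 2 by lra.
  by rewrite exprn_ge0//= exprn_ile1//; lra.
exists f; split.
- move=> t /s01 /andP[h0 h1]; rewrite fE exprn_ge0 ?subr_ge0//=.
  by rewrite exprn_ile1 ?subr_ge0// gerBl.
- move=> s t s1 st t1; rewrite !fE.
  have /andP[_ h1] : 0 <= ((1 - s) / 2) ^+ k <= 1 by apply: s01; rewrite s1 (le_trans st).
  have /andP[_ h2] : 0 <= ((1 - t) / 2) ^+ k <= 1 by apply: s01; rewrite t1 (le_trans s1).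
  rewrite lerXn2r ?nnegrE ?subr_ge0//.
  by rewrite lerB// lerXn2r ?nnegrE; lra.
- move=> t /andP[t1 ta]; rewrite fE.
  have h01 : 0 <= ((1 - t) / 2) ^+ k <= 1 by apply: s01; rewrite t1; lra.
  have /andP[h0 h1] := h01.
  have B := bernoulli_ge K h01.
  have sak : sa ^+ k <= ((1 - t) / 2) ^+ k by rewrite lerXn2r ?nnegrE /sa; lra.
  have big : eta^-1 <= 1 + K%:R * ((1 - t) / 2) ^+ k.
    apply: (@le_trans _ _ (c^-1 ^+ k * sa ^+ k)).
      rewrite -exprMn -[leRHS]invrK lef_pV2 ?posrE ?invr_gt0 ?exprn_gt0 ?mulr_gt0 ?invr_gt0//; try lra.
      by rewrite -exprVn invfM invrK.
    rewrite ler_wpDl//; apply: ler_pM => //; rewrite ?ltW//.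
    by rewrite exprn_gt0//; lra.
  rewrite -[leRHS]invrK; have ei : 0 < eta^-1 by rewrite invr_gt0.
  have big0 : 0 < 1 + K%:R * ((1 - t) / 2) ^+ k by exact: lt_le_trans big.
  apply: (@le_trans _ _ (1 + K%:R * ((1 - t) / 2) ^+ k)^-1).
    by rewrite -[leRHS]mul1r ler_pdivlMr.
  by rewrite lef_pV2.
- move=> t /andP[bt t1]; rewrite fE.
  have h01 : 0 <= ((1 - t) / 2) ^+ k <= 1 by apply: s01; rewrite t1 andbT; lra.
  apply: le_trans (bernoulli_le K h01).
  rewrite lerD2l lerN2.
  apply: (@le_trans _ _ (2 * c^-1 ^+ k * sb ^+ k)).
    apply: ler_pM => //; first by case/andP: h01.
    by rewrite lerXn2r ?nnegrE /sb; lra.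
  rewrite -mulrA -exprMn mulrC (mulrC c^-1).
  lra.
Qed.

End step_polynomials.

(** * Concentrating a profile at the pole *)

Section concentration.
Context {R : realType}.
Variable m : nat.
Local Notation n := m.+3.
Local Notation zint := (@zint R m).
Local Notation vol' := (@sphere_volume R m.+2).
Implicit Types (s t x : R) (f g : {poly R}).

(** The factor ((1 + t)/2)^k moves the mass towards t = 1. Being increasing, it also yields the
    single sign change: after normalisation, the new profile minus [f] is [f] times an increasing
    function minus 1. *)
Definition tilt k f : {poly R} := f * (2^-1 *: (1 + 'X)) ^+ k.

Definition conc k f : {poly R} := (zint (tilt k f))^-1 *: tilt k f.

Lemma horner_tilt k f t : (tilt k f).[t] = f.[t] * ((1 + t) / 2) ^+ k.
Proof. by rewrite /tilt !pE [2^-1 * _]mulrC. Qed.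

Lemma tilt_ge0 k f t : (forall t, -1 <= t <= 1 -> 0 <= f.[t]) ->
  -1 <= t <= 1 -> 0 <= (tilt k f).[t].
Proof.
move=> f0 t1; rewrite horner_tilt mulr_ge0 ?f0// exprn_ge0//.
by case/andP: t1 => ? ?; lra.
Qed.

(** On [b, 1] the weight is bounded below by t times itself, which has an elementary primitive. *)
Lemma zint_lower f b c : 0 <= b -> b < 1 -> 0 <= c ->
  (forall t, -1 <= t <= 1 -> 0 <= f.[t]) ->
  (forall t, b <= t <= 1 -> c <= f.[t]) ->
  vol' * (c * (sinw b ^+ n / n%:R)) <= zint f.
Proof.
move=> b0 b1 c0 f0 fc; rewrite /zint ler_wpM2l ?(ltW (sphere_volume_gt0 _))//.
have bb : -1 <= b <= 1 by apply/andP; split; lra.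
rewrite (@itv_int_split _ (-1) 1 b)//; last exact: within_wt.
apply: ler_wpDl.
  apply: itv_int_ge0 => t /andP[t1 t2]; rewrite mulr_ge0 ?sinwX_ge0// f0// t1; lra.
rewrite -itv_int_t_sinw//; last by lra.
rewrite -itv_intZ; last exact: within_t_sinw.
apply: le_itv_int; [|exact: within_wt|].
  by apply: within_continuousM; [apply: within_continuousT; exact: cst_continuous|exact: within_t_sinw].
move=> t /andP[t1 t2]; rewrite mulrA mulrC ler_wpM2l ?sinwX_ge0//.
apply: (@le_trans _ _ c); last by rewrite fc// t1.
by rewrite ler_piMr.
Qed.

Variables (f : {poly R}) (b c M : R).
Hypotheses (b0 : 0 <= b) (b1 : b < 1) (c0 : 0 < c).
Hypothesis f0 : forall t, -1 <= t <= 1 -> 0 <= f.[t].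
Hypothesis fc : forall t, b <= t <= 1 -> c <= f.[t].
Hypothesis fM : forall t, -1 <= t <= 1 -> f.[t] <= M.

Lemma zint_tilt_ge k b' : b <= b' -> b' < 1 ->
  vol' * (c * ((1 + b') / 2) ^+ k * (sinw b' ^+ n / n%:R)) <= zint (tilt k f).
Proof.
move=> bb' b'1; have b'0 := le_trans b0 bb'; have h : 0 <= (1 + b') / 2 by lra.
apply: zint_lower => //.
- by rewrite mulr_ge0 ?exprn_ge0// ltW.
- by move=> t t1; exact: tilt_ge0.
- move=> t /andP[t1 t2]; rewrite horner_tilt; apply: ler_pM.
  + exact: ltW.
  + by rewrite exprn_ge0//; lra.
  + by rewrite fc// t2 andbT (le_trans bb').
  + by rewrite lerXn2r ?nnegrE; lra.
Qed.

Lemma zint_tilt_gt0 k : 0 < zint (tilt k f).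
Proof.
apply: lt_le_trans (zint_tilt_ge k (lexx b) b1).
rewrite mulr_gt0 ?sphere_volume_gt0// mulr_gt0//.
  by rewrite mulr_gt0// exprn_gt0//; move: (b0); lra.
by rewrite divr_gt0// exprn_gt0// sinw_gt0// b1 andbT; move: (b0); lra.
Qed.

Lemma zint_conc k : zint (conc k f) = 1.
Proof. by rewrite /conc zintZ mulVf// gt_eqF// zint_tilt_gt0. Qed.

Lemma horner_conc k t : (conc k f).[t] = (zint (tilt k f))^-1 * (f.[t] * ((1 + t) / 2) ^+ k).
Proof. by rewrite /conc hornerZ horner_tilt. Qed.

Lemma conc_ge0 k t : -1 <= t <= 1 -> 0 <= (conc k f).[t].
Proof.
by move=> t1; rewrite /conc hornerZ mulr_ge0 ?tilt_ge0// invr_ge0 ltW// zint_tilt_gt0.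
Qed.

Lemma conc_cross k s t : -1 <= s -> s <= t -> t <= 1 ->
  0 < (conc k f).[s] - f.[s] -> 0 <= (conc k f).[t] - f.[t].
Proof.
move=> s1 st t1; rewrite !horner_conc.
have E x : (zint (tilt k f))^-1 * (f.[x] * ((1 + x) / 2) ^+ k) - f.[x] =
    f.[x] * ((zint (tilt k f))^-1 * ((1 + x) / 2) ^+ k - 1) by ring.
rewrite !E => h.
have fs : 0 <= f.[s] by apply: f0; rewrite s1 (le_trans st).
have ft : 0 <= f.[t] by apply: f0; rewrite t1 (le_trans s1).
rewrite mulr_ge0//.
have : 0 < (zint (tilt k f))^-1 * ((1 + s) / 2) ^+ k - 1.
  rewrite ltNge; apply/negP => h'; move: h; rewrite ltNge => /negP; apply.
  by rewrite mulr_ge0_le0.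
move=> /ltW /le_trans; apply.
rewrite lerB// ler_wpM2l ?invr_ge0 ?(ltW (zint_tilt_gt0 k))//.
by rewrite lerXn2r ?nnegrE; lra.
Qed.

(** Away from the pole the tilted profile is at most M ((2 - delta)/2)^k, whereas its mass is at
    least a constant times ((1 + b')/2)^k. Taking [b'] above 1 - delta makes the quotient decay
    geometrically. *)
Lemma conc_small delta eps : 0 < delta -> 0 < eps ->
  exists k, forall t, -1 <= t <= 1 - delta -> (conc k f).[t] <= eps.
Proof.
move=> d0 e0.
pose b' := Num.max b (1 - delta / 2).
have bb' : b <= b' by rewrite le_max lexx.
have b'1 : b' < 1 by rewrite gt_max b1; lra.
have b'd : 1 - delta / 2 <= b' by rewrite le_max lexx orbT.
clearbody b'; have b'0 := le_trans b0 bb'.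
pose K := vol' * (c * (sinw b' ^+ n / n%:R)).
have K0 : 0 < K.
  rewrite mulr_gt0 ?sphere_volume_gt0// mulr_gt0// divr_gt0// exprn_gt0// sinw_gt0//.
  by apply/andP; split; lra.
(* The maximum with 0 covers delta > 2, where no t is concerned. *)
pose rho := Num.max 0 ((2 - delta) / (1 + b')).
have rho01 : 0 <= rho < 1.
  by rewrite le_max lexx /= gt_max ltr01 ltr_pdivrMr ?mul1r; lra.
have M0 : 0 <= M by apply: le_trans (fM (_ : -1 <= 0 <= 1)); [apply: f0|]; apply/andP; split; lra.
have eK : 0 < eps * K / (M + 1) by apply: divr_gt0; [exact: mulr_gt0|exact: ltr_wpDl].
have [k hk] := exists_expr_le rho01 eK; exists k => t /andP[t1 t2].
have t12 : -1 <= t <= 1 by rewrite t1; lra.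
have B0 : 0 < (1 + b') / 2 by lra.
have Bk : 0 < ((1 + b') / 2) ^+ k by rewrite exprn_gt0.
have Zk : K * ((1 + b') / 2) ^+ k <= zint (tilt k f).
  apply: le_trans (zint_tilt_ge k bb' b'1); rewrite /K.
  by rewrite le_eqVlt; apply/orP; left; apply/eqP; ring.
have Z0 : 0 < K * ((1 + b') / 2) ^+ k by rewrite mulr_gt0.
rewrite horner_conc mulrC ler_pdivrMr ?zint_tilt_gt0//.
apply: (@le_trans _ _ (eps * (K * ((1 + b') / 2) ^+ k))); last by rewrite ler_wpM2l// ltW.
apply: (@le_trans _ _ (M * (rho * ((1 + b') / 2)) ^+ k)).
  apply: ler_pM; [exact: f0|by rewrite exprn_ge0//; lra|exact: fM|].
  rewrite lerXn2r ?nnegrE; [|lra|by rewrite mulr_ge0; lra|].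
    done.
  apply: (@le_trans _ _ ((2 - delta) / (1 + b') * ((1 + b') / 2))).
    rewrite (_ : _ * _ = (2 - delta) / 2); last by field; rewrite gt_eqF//; lra.
    lra.
  by rewrite ler_wpM2r ?(ltW B0)// le_max lexx orbT.
rewrite exprMn mulrA [leRHS]mulrA ler_wpM2r ?(ltW Bk)//.
apply: (@le_trans _ _ (M * (eps * K / (M + 1)))); first by rewrite ler_wpM2l.
rewrite mulrA ler_pdivrMr; last by lra.
rewrite mulrC; apply: ler_wpM2l; last by rewrite lerDl.
by apply: mulr_ge0; exact: ltW.
Qed.

End concentration.

(** * The lower bound for the Green function *)

Section sphere_points.
Context {R : realType}.
Variable n : nat.
Local Notation V := 'rV[R]_n.+1.
Implicit Types (x y q : V).

Lemma dotvBB x y : sphere n x -> sphere n y -> dotv (x - y) (x - y) = 2 - 2 * dotv x y.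
Proof.
rewrite /sphere/= => x1 y1; rewrite -scaleN1r !(dotvDl, dotvDr, dotvZl, dotvZr) x1 y1 (dotvC y).
by ring.
Qed.

Lemma dotv_le1 x y : sphere n x -> sphere n y -> dotv x y <= 1.
Proof. by move=> x1 y1; have := dotv_ge0 (x - y); rewrite dotvBB//; lra. Qed.

Lemma sphereN x : sphere n x -> sphere n (- x).
Proof. by rewrite /sphere/= -scaleN1r dotvZl dotvZr => ->; rewrite mulr1 mulrNN mulr1. Qed.

Lemma dotv_itv x y : sphere n x -> sphere n y -> -1 <= dotv x y <= 1.
Proof.
move=> x1 y1; rewrite dotv_le1// andbT.
have := dotv_le1 (sphereN x1) y1; rewrite -scaleN1r dotvZl mulN1r; lra.
Qed.

Lemma dotv_lt1 x y : sphere n x -> sphere n y -> x <> y -> dotv x y < 1.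
Proof.
move=> x1 y1 xy; rewrite lt_neqAle dotv_le1// andbT; apply/eqP => e1; apply: xy.
have /eqP : dotv (x - y) (x - y) = 0 by rewrite dotvBB// e1; ring.
rewrite /dotv psumr_eq0; last by move=> i _; rewrite -expr2 sqr_ge0.
move=> /allP h; apply/rowP => i; have := h i (mem_index_enum i).
by rewrite !mxE mulf_eq0 orbb subr_eq0 => /eqP.
Qed.

(** Since |y - q|^2 = 2 - 2 y . q and the sup norm is at most the Euclidean one, every neighbourhood
    of [y] contains a cap around [y]. *)
Lemma near_sphere y (P : set V) : sphere n y -> (\forall q \near y, P q) ->
  exists2 d : R, 0 < d & forall q, sphere n q -> 1 - d < dotv y q -> P q.
Proof.
move=> y1 /nbhs_ballP[e /= e0 h]; exists (e ^+ 2 / 2).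
  by rewrite divr_gt0// exprn_gt0.
move=> q q1 yq; apply: h; rewrite -ball_normE/=.
have hq : dotv (y - q) (y - q) < e ^+ 2 by rewrite dotvBB//; lra.
have hi i : `|(y - q) 0 i| < e.
  rewrite -(ltr_pXn2r (ltn0Sn 1)) ?nnegrE ?(ltW e0)// real_normK ?num_real//.
  apply: le_lt_trans hq; rewrite /dotv (bigD1 i)//= -expr2 lerDl.
  by apply: sumr_ge0 => j _; rewrite -expr2 sqr_ge0.
rewrite /Num.norm/= mx_normrE; apply: bigmax_lt => // -[i j] _ /=.
by rewrite ord1; exact: hi.
Qed.

End sphere_points.

(** * Averages against concentrated kernels *)

Section approximate_identity.
Context {R : realType}.
Variable m : nat.
Local Notation n := m.+3.
Local Notation V := 'rV[R]_n.+1.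
Local Notation zint := (@zint R m).
Local Notation vol := (@sphere_volume R m.+3).
Local Notation SI := (@sphere_integral R n).
Implicit Types (f g u U : {poly R}) (x y p q : V) (F : V -> R).

Lemma Lop_solve f : exists U, Lop n U = f - (zint f / vol)%:P /\ zint U = 0.
Proof.
have [w [c E]] := @Lop_surj R n isT f.
have v0 : vol != 0 by rewrite gt_eqF// sphere_volume_gt0.
have -> : zint f = c * vol by rewrite E zintD zintC zint_Lop addr0.
exists (w - (zint w / vol)%:P); split.
  by rewrite LopB LopC subr0 mulfK// E addrC addKr.
by rewrite zintB zintC divfK// subrr.
Qed.

Lemma sphere_integrableMzonal F y g : sphere_integrable F ->
  sphere_integrable (fun q => F q * g.[dotv y q]).
Proof.
move=> hF; apply: (eq_sphere_integrable _ (sphere_integrableM (pzonal n.+1 g (renv y)) hF)).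
by move=> q _; rewrite psph_zonal.
Qed.

Lemma sphere_integrable_zonal2 f g x y :
  sphere_integrable (fun q : V => f.[dotv x q] * g.[dotv y q]).
Proof. exact: (sphere_integrableMzonal _ _ (sphere_integrable_zonal x f)). Qed.

Lemma sphere_integral_zonal1 f x : sphere n x -> SI (fun q => f.[dotv x q]) = zint f.
Proof. exact: sphere_integral_zonal. Qed.

Lemma sphere_integral_sum (I : Type) (r : seq I) (F : I -> V -> R) :
  (forall i, sphere_integrable (F i)) ->
  sphere_integrable (fun q => \sum_(i <- r) F i q) /\
  SI (fun q => \sum_(i <- r) F i q) = \sum_(i <- r) SI (F i).
Proof.
move=> hF; elim: r => [|i r [ih1 ih2]].
  have h0 : sphere_integrable (fun q : V => \sum_(i <- [::]) F i q).
    apply: (eq_sphere_integrable _ (@sphere_integrable_psph R n (PCst 0))).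
    by move=> q _; rewrite big_nil.
  split=> //; rewrite big_nil.
  rewrite (@eq_sphere_integral _ _ _ (fun q => 0 * psph (PCst 0) q)).
    by rewrite sphere_integralZ ?mul0r//; exact: sphere_integrable_psph.
  by move=> q _; rewrite big_nil mul0r.
have E q : sphere n q -> F i q + \sum_(j <- r) F j q = \sum_(j <- i :: r) F j q.
  by move=> _; rewrite big_cons.
split.
  by apply: (eq_sphere_integrable E); exact: sphere_integrableD.
by rewrite -(eq_sphere_integral E) sphere_integralD// ih2 big_cons.
Qed.

(** Away from [y] the kernel is uniformly small, so there integrability of [F] is enough and no
    bound on [F] is required. This matters for the Green function, which is only known to be
    continuous away from its pole. *)
Lemma sphere_approx f (b c M : R) F y : 0 <= b -> b < 1 -> 0 < c ->
  (forall t, -1 <= t <= 1 -> 0 <= f.[t]) -> (forall t, b <= t <= 1 -> c <= f.[t]) ->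
  (forall t, -1 <= t <= 1 -> f.[t] <= M) ->
  sphere n y -> sphere_integrable F ->
  (forall e : R, 0 < e -> exists2 d : R, 0 < d &
     forall q, sphere n q -> 1 - d < dotv y q -> `|F q - F y| <= e) ->
  forall e : R, 0 < e -> exists k,
    `|SI (fun q => F q * (conc m k f).[dotv y q]) - F y| <= e.
Proof.
move=> b0 b1 c0 f0 fc fM y1 hF cF e e0.
have e20 : 0 < e / 2 by lra.
have [d d0 hd] := cF _ e20.
pose D : V -> R := fun q => F q - F y.
have hC : sphere_integrable (fun _ : V => F y) by exact: (@sphere_integrable_psph R n (PCst (F y))).
have hD : sphere_integrable D by exact: sphere_integrableB.
have hN := sphere_integrable_norm hD.
pose W := SI (fun q => `|D q|).
have W0 : 0 <= W.
  rewrite -[leLHS](_ : SI (fun q => 0 * psph (PCst 0) q) = 0).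
    apply: le_sphere_integral => //; last by move=> q _; rewrite mul0r.
    by apply: sphere_integrableZ; exact: sphere_integrable_psph.
  by rewrite sphere_integralZ ?mul0r//; exact: sphere_integrable_psph.
have e'0 : 0 < e / 2 / (W + 1) by rewrite divr_gt0// ltr_wpDl.
set e' := e / 2 / (W + 1) in e'0.
have [k hk] := conc_small m b0 b1 c0 f0 fc fM d0 e'0; exists k.
set g := conc m k f in hk *.
have g0 t : -1 <= t <= 1 -> 0 <= g.[t] by exact: (conc_ge0 m b0 b1 c0 f0 fc).
have g1 : zint g = 1 by exact: (zint_conc m b0 b1 c0 f0 fc).
have hFg := sphere_integrableMzonal y g hF.
have hCg := sphere_integrableMzonal y g hC.
have hDg := sphere_integrableMzonal y g hD.
have -> : SI (fun q => F q * g.[dotv y q]) - F y = SI (fun q => D q * g.[dotv y q]).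
  rewrite -[in LHS](mulr1 (F y)) -g1 -(sphere_integral_zonal1 g y1).
  rewrite -sphere_integralZ; last exact: sphere_integrable_zonal.
  rewrite -sphere_integralB//; apply: eq_sphere_integral => q _.
  by rewrite /D mulrBl.
pose B : V -> R := fun q => e / 2 * g.[dotv y q] + e' * `|D q|.
have hg : sphere_integrable (fun q : V => e / 2 * g.[dotv y q]).
  by apply: sphere_integrableZ; exact: sphere_integrable_zonal.
have hB : sphere_integrable B.
  by apply: sphere_integrableD => //; exact: sphere_integrableZ.
have SB : SI B <= e.
  rewrite sphere_integralD//; last exact: sphere_integrableZ.
  rewrite !sphere_integralZ//; last exact: sphere_integrable_zonal.
  rewrite (sphere_integral_zonal1 g y1) g1 -/W mulr1.
  have : e' * W <= e / 2.
    by rewrite /e' mulrAC ler_pdivrMr ?ltr_wpDl// ler_wpM2l ?(ltW e20)// lerDl.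
  by move=> h; lra.
have DB q : sphere n q -> `|D q * g.[dotv y q]| <= B q.
  move=> q1; have tq := dotv_itv y1 q1; have gq := g0 _ tq.
  rewrite normrM (ger0_norm gq) /B.
  have [h|h] := ltP (1 - d) (dotv y q).
    apply: ler_wpDr; first by apply: mulr_ge0 => //; exact: ltW.
    by apply: ler_wpM2r => //; exact: hd.
  apply: ler_wpDl; first by apply: mulr_ge0 => //; exact: ltW.
  by rewrite mulrC; apply: ler_wpM2r => //; apply: hk; case/andP: tq => ->.
rewrite ler_norml; apply/andP; split; last first.
  apply: le_trans SB; apply: le_sphere_integral => // q /DB; exact: le_trans (ler_norm _).
rewrite lerNl; apply: le_trans SB; rewrite -mulN1r -sphere_integralZ//.
apply: le_sphere_integral => //; first exact: sphere_integrableZ.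
by move=> q /DB; apply: le_trans; rewrite mulN1r -normrN ler_norm.
Qed.

Lemma zonal_modulus U x y : sphere n y -> forall e : R, 0 < e -> exists2 d : R, 0 < d &
  forall q, sphere n q -> 1 - d < dotv y q -> `|U.[dotv x q] - U.[dotv x y]| <= e.
Proof.
move=> y1 e e0; have /= cU := @smooth_zonal R n x U 0.
have /cvgrPdist_le /(_ e e0) h := cU y.
have [d d0 hd] := near_sphere y1 h; exists d => // q q1 /(hd _ q1).
by rewrite distrC.
Qed.

(** Both sides integrate the scalar product of the gradients of U(x . q) and W(y . q). *)
Lemma sphere_integral_swap f g U W x y : sphere n x -> sphere n y ->
  Lop n U = f - (zint f / vol)%:P -> zint U = 0 ->
  Lop n W = g - (zint g / vol)%:P -> zint W = 0 ->
  SI (fun q => f.[dotv x q] * W.[dotv y q]) = SI (fun q => U.[dotv x q] * g.[dotv y q]).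
Proof.
move=> x1 y1 LU U0 LW W0.
have K (f' U' W' : {poly R}) x' y' : sphere n x' -> sphere n y' ->
   Lop n U' = f' - (zint f' / vol)%:P -> zint W' = 0 ->
   SI (fun q => f'.[dotv x' q] * W'.[dotv y' q]) =
   SI (fun q => W'.[dotv y' q] * (Lop n U').[dotv x' q]).
  move=> x1' y1' LU' W0'.
  transitivity (SI (fun q => W'.[dotv y' q] * (Lop n U').[dotv x' q] +
      zint f' / vol * W'.[dotv y' q])).
    by apply: eq_sphere_integral => q _; rewrite LU' !pE; ring.
  rewrite sphere_integralD; first last.
  - by apply: sphere_integrableZ; exact: sphere_integrable_zonal.
  - exact: sphere_integrable_zonal2.
  rewrite sphere_integralZ; last exact: sphere_integrable_zonal.
  by rewrite (sphere_integral_zonal1 W' y1') W0' mulr0 addr0.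
rewrite (K _ _ _ _ _ x1 y1 LU W0) sphere_integral_Lop2//.
transitivity (SI (fun q => g.[dotv y q] * U.[dotv x q])); last first.
  by apply: eq_sphere_integral => q _; rewrite mulrC.
rewrite (K _ _ _ _ _ y1 x1 LW U0) sphere_integral_Lop2//.
by apply: eq_sphere_integral => q _; rewrite (dotvC y x); ring.
Qed.

End approximate_identity.

(** * Green energy of a configuration for a fixed profile *)

Section green_bound.
Context {R : realType}.
Variable m : nat.
Local Notation n := m.+3.
Local Notation V := 'rV[R]_n.+1.
Local Notation zint := (@zint R m).
Local Notation vol := (@sphere_volume R m.+3).
Local Notation SI := (@sphere_integral R n).
Implicit Types (f g u U : {poly R}) (x y p q : V) (F : V -> R).
Variable G : V -> V -> R.
Hypothesis HG : is_green_function G.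

(** The equation of [G x] is tested on q |-> U(p . q). The constant terms drop out because [U] and
    [G x] both have mean zero. *)
Lemma green_zonal f U x p : sphere n x -> sphere n p ->
  Lop n U = f - (zint f / vol)%:P -> zint U = 0 ->
  SI (fun q => G x q * f.[dotv p q]) = U.[dotv p x].
Proof.
move=> x1 p1 LU U0.
have hG := green_integrable HG x1.
have := green_laplacian HG x1 (@smooth_zonal R n p U).
rewrite (sphere_integral_zonal U p1) U0 mulr0 subr0 {2}/zonal => <-.
transitivity (SI (fun q => G x q * f.[dotv p q] - zint f / vol * G x q)).
  rewrite sphere_integralB; first last.
  - exact: sphere_integrableZ.
  - exact: sphere_integrableMzonal.
  by rewrite sphere_integralZ// (green_mean0 HG)// mulr0 subr0.
apply: eq_sphere_integral => q q1; rewrite sphere_laplacian_zonal// LU !pE.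
by ring.
Qed.

Lemma green_modulus x y : sphere n x -> sphere n y -> x <> y ->
  forall e : R, 0 < e -> exists2 d : R, 0 < d &
  forall q, sphere n q -> 1 - d < dotv y q -> `|G x q - G x y| <= e.
Proof.
move=> x1 y1 xy e e0.
pose A := [set z : V * V | [/\ sphere n z.1, sphere n z.2 & z.1 <> z.2]].
have Axy : A (x, y) by [].
have cG := green_continuous HG.
have : \forall z \near within A (nbhs (x, y)), `|G x y - G z.1 z.2| <= e.
  rewrite (nbhs_subspace_in Axy).
  by have /cvgrPdist_le /(_ e e0) := cG (x, y).
rewrite near_withinE => h.
have h2 : \forall q \near y, A (x, q) -> `|G x y - G x q| <= e.
  case/nbhs_ballP: h => r /= r0 h; apply/nbhs_ballP; exists r => // q yq.
  by apply: (h (x, q)); split => //=; exact: ballxx.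
have [d d0 hd] := near_sphere y1 h2.
have yx1 : dotv y x < 1 by apply: dotv_lt1 => // yx; apply: xy.
(* The second bound keeps x outside the cap around y. *)
exists (Num.min d (1 - dotv y x)); first by rewrite lt_min d0 subr_gt0.
move=> q q1 hq; rewrite distrC; apply: hd => //.
  by apply: le_lt_trans hq; rewrite lerD2l lerN2 ge_min lexx.
split => //= xq; move: hq; rewrite -xq ltNge => /negP; apply.
by rewrite lerBrDl -lerBrDr ge_min lexx orbT.
Qed.

Variables (f U : {poly R}) (b c M del : R).
Hypotheses (b0 : 0 <= b) (b1 : b < 1) (c0 : 0 < c).
Hypothesis f0 : forall t, -1 <= t <= 1 -> 0 <= f.[t].
Hypothesis fc : forall t, b <= t <= 1 -> c <= f.[t].
Hypothesis fM : forall t, -1 <= t <= 1 -> f.[t] <= M.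
Hypothesis f1 : zint f = 1.
Hypotheses (LU : Lop n U = f - (zint f / vol)%:P) (U0 : zint U = 0).
Hypothesis hdel : forall k D, Lop n D = conc m k f - f -> zint D = 0 ->
  forall t, -1 <= t <= 1 -> - del <= D.[t].

(** Each of the two smearings costs one [del]. First, G(x, y) is the limit of W(x . y), where W
    solves the equation for the concentrated profile and W >= U - del. Second, averaging U <= W +
    del against [f] and moving the concentrated profile onto [U] by symmetry bounds the integral by
    U(x . y) + del in the limit. *)
Lemma green_ge x y : sphere n x -> sphere n y -> x <> y ->
  SI (fun q => f.[dotv x q] * U.[dotv y q]) - 2 * del <= G x y.
Proof.
move=> x1 y1 xy.
have conc1 k : zint (conc m k f) = 1 by exact: (zint_conc m b0 b1 c0 f0 fc).
have drop k W : Lop n W = conc m k f - (zint (conc m k f) / vol)%:P -> zint W = 0 ->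
    forall t, -1 <= t <= 1 -> U.[t] - del <= W.[t].
  move=> LW W0 t t1; have E : Lop n (W - U) = conc m k f - f.
    by rewrite LopB LW LU conc1 f1 opprB addrA subrK.
  have := @hdel k (W - U) E; rewrite zintB W0 U0 subr0 => /(_ erefl t t1).
  rewrite hornerB; lra.
have s1 e : 0 < e -> U.[dotv x y] - del - e <= G x y.
  move=> e0.
  have [k hk] := sphere_approx b0 b1 c0 f0 fc fM y1 (green_integrable HG x1)
    (green_modulus x1 y1 xy) e0.
  have [W [LW W0]] := Lop_solve m (conc m k f).
  have := hk; rewrite (green_zonal x1 y1 LW W0) ler_norml => /andP[_ h].
  have := drop k W LW W0 _ (dotv_itv y1 x1); rewrite (dotvC x y); lra.
have s2 e : 0 < e -> SI (fun q => f.[dotv x q] * U.[dotv y q]) <= U.[dotv x y] + del + e.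
  move=> e0.
  have [k hk] := sphere_approx b0 b1 c0 f0 fc fM y1 (sphere_integrable_zonal x U)
    (zonal_modulus U x y1) e0.
  have [W [LW W0]] := Lop_solve m (conc m k f).
  apply: (@le_trans _ _ (SI (fun q => f.[dotv x q] * W.[dotv y q] + del * f.[dotv x q]))).
    apply: le_sphere_integral.
    - exact: sphere_integrable_zonal2.
    - apply: sphere_integrableD; first exact: sphere_integrable_zonal2.
      by apply: sphere_integrableZ; exact: sphere_integrable_zonal.
    - move=> q q1; have := drop k W LW W0 _ (dotv_itv y1 q1).
      have := f0 (dotv_itv x1 q1) => h1 h2.
      by rewrite (mulrC del) -mulrDr ler_wpM2l//; lra.
  rewrite sphere_integralD; first last.
  - by apply: sphere_integrableZ; exact: sphere_integrable_zonal.
  - exact: sphere_integrable_zonal2.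
  rewrite sphere_integralZ; last exact: sphere_integrable_zonal.
  rewrite (sphere_integral_zonal1 f x1) f1 (sphere_integral_swap x1 y1 LU U0 LW W0).
  by move: hk; rewrite /zonal ler_norml => /andP[_]; lra.
rewrite leNgt; apply/negP => h.
pose e := (SI (fun q => f.[dotv x q] * U.[dotv y q]) - 2 * del - G x y) / 4.
have e0 : 0 < e by rewrite /e; lra.
have := s1 e e0; have := s2 e e0; rewrite /e; lra.
Qed.

Lemma sphere_integral_energyE x y : sphere n x -> sphere n y ->
  SI (fun q => f.[dotv x q] * U.[dotv y q]) =
  SI (fun q => U^`().[dotv x q] * U^`().[dotv y q] *
      (dotv x y - dotv x q * dotv y q)).
Proof.
move=> x1 y1; rewrite -sphere_integral_Lop2//.
transitivity (SI (fun q => U.[dotv y q] * (Lop n U).[dotv x q] +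
    zint f / vol * U.[dotv y q])).
  by apply: eq_sphere_integral => q _; rewrite LU !pE; ring.
rewrite sphere_integralD; first last.
- by apply: sphere_integrableZ; exact: sphere_integrable_zonal.
- exact: sphere_integrable_zonal2.
rewrite sphere_integralZ; last exact: sphere_integrable_zonal.
by rewrite (sphere_integral_zonal1 U y1) U0 mulr0 addr0.
Qed.

Lemma sphere_integral_energy_diag x : sphere n x ->
  SI (fun q => f.[dotv x q] * U.[dotv x q]) = zint ((1 - 'X^2) * U^`() * U^`()).
Proof.
move=> x1; rewrite sphere_integral_energyE// -(sphere_integral_zonal1 _ x1).
apply: eq_sphere_integral => q _; rewrite !pE.
by move: x1; rewrite /sphere/= => ->; ring.
Qed.

Lemma dotv_suml (I : Type) (r : seq I) k (v : I -> 'rV[R]_k) w :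
  dotv (\sum_(i <- r) v i) w = \sum_(i <- r) dotv (v i) w.
Proof.
elim: r => [|i r ih]; first by rewrite !big_nil /dotv big1// => i _; rewrite mxE mul0r.
by rewrite !big_cons dotvDl ih.
Qed.

Lemma sum_energy_ge0 N (p : 'I_N -> V) : (forall i, sphere n (p i)) ->
  0 <= \sum_(i < N) \sum_(j < N) SI (fun q => f.[dotv (p i) q] * U.[dotv (p j) q]).
Proof.
move=> p1.
pose K i j q := f.[dotv (p i) q] * U.[dotv (p j) q].
pose K' i j q := U^`().[dotv (p i) q] * U^`().[dotv (p j) q] *
      (dotv (p i) (p j) - dotv (p i) q * dotv (p j) q).
have hK' i j : sphere_integrable (K' i j).
  pose k (a b : {poly R}) : V -> R := fun q => a.[dotv (p i) q] * b.[dotv (p j) q].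
  apply: (@eq_sphere_integrable _ _ (fun q => dotv (p i) (p j) * k U^`() U^`() q -
     k (U^`() * 'X) (U^`() * 'X) q)).
    by move=> q _; rewrite /k /K' !pE; ring.
  apply: sphere_integrableB; last exact: sphere_integrable_zonal2.
  by apply: sphere_integrableZ; exact: sphere_integrable_zonal2.
have h1 i := sphere_integral_sum (index_enum 'I_N) (hK' i).
have [h2 E2] := sphere_integral_sum (index_enum 'I_N) (fun i => (h1 i).1).
rewrite (eq_bigr (fun i => SI (fun q => \sum_j K' i j q))); last first.
  move=> i _; rewrite (h1 i).2; apply: eq_bigr => j _; exact: sphere_integral_energyE.
rewrite -E2 -[leLHS](_ : SI (fun q => 0 * psph (PCst 0) q) = 0); last first.
  by rewrite sphere_integralZ ?mul0r//; exact: sphere_integrable_psph.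
apply: le_sphere_integral => //.
  by apply: sphere_integrableZ; exact: sphere_integrable_psph.
move=> q q1; rewrite mul0r.
(* The gradient at q of the potential U(p i . q): the double sum is the squared norm of the total
   field. *)
pose w i := U^`().[dotv (p i) q] *: (p i - dotv (p i) q *: q).
suff -> : \sum_i \sum_j K' i j q = dotv (\sum_i w i) (\sum_i w i) by exact: dotv_ge0.
rewrite dotv_suml; apply: eq_bigr => i _; rewrite dotvC dotv_suml.
apply: eq_bigr => j _; rewrite /w -!scaleNr !(dotvDl, dotvDr, dotvZl, dotvZr).
rewrite (dotvC (p j) (p i)) (dotvC q (p i)) q1 /K'; ring.
Qed.

Lemma green_energy_ge A N (p : 'I_N -> V) : 0 <= del ->
  zint ((1 - 'X^2) * U^`() * U^`()) <= A ->
  injective p -> (forall i, sphere n (p i)) ->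
  - (N%:R * A) - 2 * N%:R ^+ 2 * del <= green_energy G p.
Proof.
move=> d0 hA injp p1.
pose H i j := SI (fun q => f.[dotv (p i) q] * U.[dotv (p j) q]).
have S0 := sum_energy_ge0 p1; rewrite -/H in S0.
have E : \sum_(i < N) \sum_(j < N) H i j =
    \sum_(i < N) \sum_(j < N | i != j) H i j + \sum_(i < N) H i i.
  rewrite -big_split; apply: eq_bigr => i _ /=.
  rewrite (bigD1 i)//= addrC; congr (_ + _); by apply: eq_bigl => j; rewrite eq_sym.
have D : \sum_(i < N) H i i <= N%:R * A.
  rewrite (_ : N%:R * A = \sum_(i < N) A); last by rewrite sumr_const card_ord mulr_natl.
  by apply: ler_sum => i _; rewrite /H sphere_integral_energy_diag.
have L : \sum_(i < N) \sum_(j < N | i != j) H i j - 2 * N%:R ^+ 2 * del <= green_energy G p.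
  rewrite lerBlDr (_ : 2 * N%:R ^+ 2 * del = \sum_(i < N) \sum_(j < N) 2 * del); last first.
    by rewrite !sumr_const card_ord -[in RHS]mulr_natl -[_ *+ N in RHS]mulr_natl; ring.
  rewrite /green_energy -big_split; apply: ler_sum => i _ /=.
  apply: (@le_trans _ _ (\sum_(j < N | i != j) (G (p i) (p j) + 2 * del))).
    apply: ler_sum => j ij; rewrite -lerBlDr; apply: green_ge => //.
    by move=> /injp e; rewrite e eqxx in ij.
  rewrite big_split/= lerD2l [leRHS](bigID (fun j => i != j))/= lerDl.
  by apply: sumr_ge0 => j _; rewrite mulr_ge0.
lra.
Qed.

End green_bound.

(** * Sharp caps *)

Section preasymptotic.
Context {R : realType}.
Variable m : nat.
Local Notation n := m.+3.
Local Notation V := 'rV[R]_n.+1.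
Local Notation zint := (@zint R m).
Local Notation vol := (@sphere_volume R m.+3).
Local Notation vol' := (@sphere_volume R m.+2).

Definition energy_bound (t1 T M : R) : R :=
  vol' * (2 * (vol^-1 * left_const m t1) ^+ 2 +
     (vol' ^+ 2 * (m.+1%:R * t1 * sinw T ^+ m.+1))^-1 +
     (M / (n%:R * T)) ^+ 2 * (sinw T ^+ m.+3.+2 / (m.+3.+2%:R * T))).

Definition drop_bound (a b M : R) : R :=
  (vol' * (4 * b + M * sinw a ^+ m.+3.+2 / (m.+3.+2%:R * (a * (1 + a)))) / n%:R +
   4 * (b * left_const m a) * vol) / (a * vol).

(** Inverse of the volume V_(n-1) s^n / n of a flat ball of radius s = sinw T. The cap t >= T is at
    least as large, so this bounds the height of its normalised indicator. *)
Definition cap_height (T : R) : R := n%:R / (vol' * sinw T ^+ n).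

Lemma drop_bound_ge0 a b M : 0 < a -> a < 1 -> 0 <= b -> 0 <= M -> 0 <= drop_bound a b M.
Proof.
move=> a0 a1 b0 M0; have v := sphere_volume_gt0 m.+3 : 0 < vol.
have v' := sphere_volume_gt0 m.+2 : 0 < vol'.
apply: divr_ge0; last by apply: mulr_ge0; exact: ltW.
apply: addr_ge0; last first.
  apply: mulr_ge0; last exact: ltW.
  by rewrite mulr_ge0// mulr_ge0// left_const_ge0// ltW.
apply: divr_ge0 => //; apply: mulr_ge0; first exact: ltW.
apply: addr_ge0; first exact: mulr_ge0.
apply: divr_ge0; first by rewrite mulr_ge0// sinwX_ge0.
by rewrite !mulr_ge0// ?addr_ge0// ltW.
Qed.

(** The profile is a step polynomial rising on [T - eta, T], divided by its mass. That mass is at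
    least (1 - eta) / [cap_height T], hence the bound on the height, and left of T - eta the profile
    is at most [eta] times this bound. *)
Lemma green_energy_step G (t1 T eta : R) N (p : 'I_N -> V) :
  is_green_function G -> injective p -> (forall i, sphere n (p i)) ->
  0 < t1 -> t1 <= T -> T < 1 -> 0 < eta -> eta < T ->
  - (N%:R * energy_bound t1 T (cap_height T / (1 - eta))) -
    2 * N%:R ^+ 2 * drop_bound (T - eta) (eta * (cap_height T / (1 - eta)))
      (cap_height T / (1 - eta)) <= green_energy G p.
Proof.
move=> HG injp p1 t10 t1T T1 e0 eT.
have v := sphere_volume_gt0 m.+3 : 0 < vol.
have v' := sphere_volume_gt0 m.+2 : 0 < vol'.
have T0 : 0 < T := lt_le_trans t10 t1T.
have sT : 0 < sinw T by apply: sinw_gt0; rewrite T1; lra.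
have ch0 : 0 < cap_height T.
  by rewrite /cap_height divr_gt0// mulr_gt0// exprn_gt0.
set a := T - eta; have a0 : 0 < a by rewrite /a; lra.
have aT : a < T by rewrite /a; lra.
have e1 : eta < 1 by lra.
have [h [h01 hincr hl hr]] : exists f : {poly R}, [/\ forall t, -1 <= t <= 1 -> 0 <= f.[t] <= 1,
    forall s t, -1 <= s -> s <= t -> t <= 1 -> f.[s] <= f.[t],
    forall t, -1 <= t <= a -> f.[t] <= eta &
    forall t, T <= t <= 1 -> 1 - eta <= f.[t]].
  by apply: step_poly => //; lra.
have h0 t : -1 <= t <= 1 -> 0 <= h.[t] by move=> /h01 /andP[].
have h1 t : -1 <= t <= 1 -> h.[t] <= 1 by move=> /h01 /andP[].
set M := cap_height T / (1 - eta).
have M0 : 0 < M by rewrite /M divr_gt0// subr_gt0.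
pose z := zint h.
have zM : M^-1 <= z.
  have e1' : 0 <= 1 - eta by lra.
  apply: le_trans (zint_lower m (ltW T0) T1 e1' h0 hr).
  by rewrite /M /cap_height !invf_div -!mulrA mulrCA.
have z0 : 0 < z by apply: lt_le_trans zM; rewrite invr_gt0.
have zi : z^-1 <= M by rewrite -[leRHS]invrK lef_pV2// posrE invr_gt0.
pose f := z^-1 *: h.
have f0 t : -1 <= t <= 1 -> 0 <= f.[t].
  by move=> /h0 ?; rewrite hornerZ mulr_ge0// invr_ge0 ltW.
have fM t : -1 <= t <= 1 -> f.[t] <= M.
  move=> tt; apply: le_trans zi; rewrite hornerZ -[leRHS]mulr1.
  by apply: ler_wpM2l; [rewrite invr_ge0 ltW|exact: h1].
have f1 : zint f = 1 by rewrite zintZ mulVf// gt_eqF.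
have fincr s t : -1 <= s -> s <= t -> t <= 1 -> f.[s] <= f.[t].
  by move=> s1 st t1'; rewrite !hornerZ ler_wpM2l ?hincr// invr_ge0 ltW.
have fl t : -1 <= t <= a -> f.[t] <= eta * M.
  move=> ta; have /andP[ta1 ta2] := ta; rewrite hornerZ mulrC; apply: ler_pM => //.
  - by apply: h0; rewrite ta1; lra.
  - by rewrite invr_ge0 ltW.
  - exact: hl.
have c0 : 0 < z^-1 * (1 - eta) by rewrite mulr_gt0 ?invr_gt0// subr_gt0.
have fr t : T <= t <= 1 -> z^-1 * (1 - eta) <= f.[t].
  by move=> tt; rewrite hornerZ; apply: ler_wpM2l; [rewrite invr_ge0 ltW|exact: hr].
have [U [LU U0]] := Lop_solve m f.
have b0 : 0 <= eta * M by rewrite mulr_ge0// ltW.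
have a1 : a < 1 by lra.
apply: (green_energy_ge HG (ltW T0) T1 c0 f0 fr fM f1 LU U0) => //.
- move=> k D LD D0 t tt.
  have conc1 : zint (conc m k f) = 1 by exact: (zint_conc m (ltW T0) T1 c0 f0 fr).
  have [Dm Db] : (forall t, -1 <= t <= 1 -> D.[-1] <= D.[t]) /\
     - D.[-1] * (a * vol) <= zint (f * (1 - 'X)) / n%:R + 4 * (eta * M * left_const m a) * vol.
    apply: zint_drop LD D0 _ _ _ _ _ => //; first by rewrite f1 conc1.
    - by move=> ? ?; exact: (conc_ge0 m (ltW T0) T1 c0 f0 fr).
    - exact: (conc_cross (ltW T0) T1 c0 f0 fr).
  apply: le_trans (Dm _ tt).
  rewrite lerNl /drop_bound ler_pdivlMr ?mulr_gt0//.
  apply: le_trans Db _; rewrite lerD2r ler_wpM2r ?invr_ge0//.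
  apply: zint_moment => //; first exact: ltW.
  by move=> s /andP[s1 s2]; apply: fM; rewrite s2 andbT; lra.
- by apply: drop_bound_ge0 => //; exact: ltW.
- have c1 : 0 <= vol^-1 by rewrite invr_ge0 ltW.
  apply: (zint_energy t10 t1T T1 (ltW M0) c1 _ f1 f0 fincr fM).
  by rewrite LU f1 div1r.
Qed.

Definition energy_lim (t1 T : R) : R :=
  energy_bound t1 T (cap_height T).

Definition drop_lim (T : R) : R := drop_bound T 0 (cap_height T).

Lemma cvg_energy_bound (F : set_system R) (FF : Filter F) t1 T (M : R -> R) (M0 : R) :
  M x @[x --> F] --> M0 ->
  energy_bound t1 T (M x) @[x --> F] --> energy_bound t1 T M0.
Proof.
move=> cM; apply: cvgMr; apply: cvgD; first exact: cvg_cst.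
by apply: cvgMl; under eq_cvg do rewrite expr2; rewrite expr2; apply: cvgM; exact: cvgMl.
Qed.

Lemma cvg_drop_bound (F : set_system R) (FF : Filter F) (a b M : R -> R) (a0 b0 M0 : R) :
  0 < a0 -> a0 < 1 -> a x @[x --> F] --> a0 -> b x @[x --> F] --> b0 -> M x @[x --> F] --> M0 ->
  drop_bound (a x) (b x) (M x) @[x --> F] --> drop_bound a0 b0 M0.
Proof.
move=> a00 a01 ca cb cM; have v := sphere_volume_gt0 m.+3 : 0 < vol.
have c1 : 1 + a x @[x --> F] --> 1 + a0 by apply: cvgD => //; exact: cvg_cst.
have cpow (g : R -> R) (g0 : R) k : g x @[x --> F] --> g0 -> g x ^+ k @[x --> F] --> g0 ^+ k.
  by move=> cg; exact: (cvg_comp _ _ cg (@exprn_continuous _ k g0)).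
have cs k : sinw (a x) ^+ k @[x --> F] --> sinw a0 ^+ k.
  exact: (cvg_comp _ _ ca (@continuous_sinwX _ k a0)).
apply: cvgM.
- apply: cvgD.
  + apply: cvgMl; apply: cvgMr; apply: cvgD; first exact: cvgMr.
    apply: cvgM; first exact: cvgM.
    apply: cvgV; first by rewrite gt_eqF// !mulr_gt0// addr_gt0.
    by apply: cvgMr; exact: cvgM.
  + apply: cvgMl; apply: cvgMr; apply: cvgM => //.
    apply: cvgMr; apply: cvgV.
      by rewrite gt_eqF// mulr_gt0// exprn_gt0// subr_gt0.
    by apply: cvgMr; apply: cpow; apply: cvgB => //; exact: cvg_cst.
- apply: cvgV; first by rewrite gt_eqF// mulr_gt0.
  exact: cvgMl.
Qed.

(** The energy does not depend on [eta] and the bound is continuous in it, so the passage to a sharp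
    cap is a limit of numbers; no equation with a discontinuous right-hand side is solved. *)
Lemma green_energy_cap G (t1 T : R) N (p : 'I_N -> V) :
  is_green_function G -> injective p -> (forall i, sphere n (p i)) ->
  0 < t1 -> t1 <= T -> T < 1 ->
  - (N%:R * energy_lim t1 T) - 2 * N%:R ^+ 2 * drop_lim T <= green_energy G p.
Proof.
move=> HG injp p1 t10 t1T T1; have T0 : 0 < T := lt_le_trans t10 t1T.
pose M (x : R) := cap_height T / (1 - x).
pose phi (x : R) := - (N%:R * energy_bound t1 T (M x)) -
    2 * N%:R ^+ 2 * drop_bound (T - x) (x * M x) (M x).
have M0 : M 0 = cap_height T by rewrite /M subr0 divr1.
have cM : M x @[x --> (0 : R)] --> cap_height T.
  rewrite -M0 /M; apply: cvgMr; apply: cvgV; first by rewrite subr0 oner_neq0.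
  by apply: cvgB; [exact: cvg_cst|exact: cvg_id].
have : phi x @[x --> (0 : R)] -->
    - (N%:R * energy_lim t1 T) - 2 * N%:R ^+ 2 * drop_lim T.
  apply: cvgB; first by apply: cvgN; apply: cvgMr; exact: cvg_energy_bound.
  apply: cvgMr; apply: cvg_drop_bound => //.
  - rewrite -[X in _ --> X]subr0; apply: cvgB; [exact: cvg_cst|exact: cvg_id].
  - rewrite -[X in _ --> X](mul0r (cap_height T)); apply: cvgM => //; exact: cvg_id.
move=> /cvgr_dist_le h; rewrite leNgt; apply/negP => lt.
set L := _ - _ in h lt.
have e0 : 0 < (L - green_energy G p) / 2 by lra.
have {h} := h _ e0; rewrite near_simpl => /nbhs_ballP[r /= r0 h].
pose x := Num.min (r / 2) (T / 2).
have x0 : 0 < x by rewrite lt_min; apply/andP; split; lra.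
have xr : x <= r / 2 by rewrite ge_min lexx.
have xT : x <= T / 2 by rewrite ge_min lexx orbT.
clearbody x.
have : `|L - phi x| <= (L - green_energy G p) / 2.
  by apply: h; rewrite /ball/= sub0r normrN gtr0_norm//; lra.
have xT' : x < T by lra.
have := green_energy_step HG injp p1 t10 t1T T1 x0 xT'; rewrite -/(M x) -/(phi x).
by rewrite ler_norml => h1 /andP[_ h2]; lra.
Qed.

End preasymptotic.

(** * Asymptotics *)

Section asymptotics.
Context {R : realType}.
Variable m : nat.
Local Notation n := m.+3.
Local Notation V := 'rV[R]_n.+1.
Local Notation vol := (@sphere_volume R m.+3).
Local Notation vol' := (@sphere_volume R m.+2).
Implicit Types (y T : R).

Lemma sinw_sinw (s : R) : 0 <= s -> s <= 1 -> sinw (sinw s) = s.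
Proof.
move=> s0 s1; rewrite {1}/sinw sinw_sqr; last by apply/andP; split; lra.
by rewrite opprB addrC subrK sqrtr_sqr ger0_norm.
Qed.

Lemma sinw_ge1B (s : R) : 0 <= s -> s <= 1 -> 1 - s <= sinw s.
Proof.
move=> s0 s1; rewrite -[leLHS]ger0_norm; last by lra.
by rewrite -sqrtr_sqr ler_wsqrtr//; nra.
Qed.

Lemma energy_limE (t1 T : R) : 0 < t1 -> 0 < T -> T < 1 ->
  energy_lim m t1 T = 2 * vol' * (vol^-1 * left_const m t1) ^+ 2 +
    (vol' * sinw T ^+ m.+1)^-1 * ((m.+1%:R * t1)^-1 + (m.+3.+2%:R * T ^+ 3)^-1).
Proof.
move=> t10 T0 T1; have v' : vol' != 0 by rewrite gt_eqF// sphere_volume_gt0.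
have s0 : sinw T != 0 by rewrite gt_eqF// sinw_gt0// T1 andbT; lra.
have [n0 n1 n2] : [/\ n%:R != 0 :> R, m.+1%:R != 0 :> R & m.+3.+2%:R != 0 :> R].
  by split; rewrite pnatr_eq0.
rewrite /energy_lim /energy_bound /cap_height.
have E5 : sinw T ^+ m.+3.+2 = sinw T ^+ m.+1 * sinw T ^+ 4 by rewrite -exprD addn4.
have E3 : sinw T ^+ n = sinw T ^+ m.+1 * sinw T ^+ 2 by rewrite -exprD addn2.
rewrite E5 E3; clear E5 E3.
have v : vol != 0 by rewrite gt_eqF// sphere_volume_gt0.
move: (n%:R : R) n0 (m.+1%:R : R) n1 (m.+3.+2%:R : R) n2 (left_const m t1) (vol : R) v.
move: (vol' : R) v' (sinw T) s0 => v0 v0N s sN N NN N1 N1N N2 N2N L v vN.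
have t1N : t1 != 0 by rewrite gt_eqF.
have TN : T != 0 by rewrite gt_eqF.
by field; rewrite ?TN ?t1N ?N2N ?N1N ?NN ?sN ?v0N ?vN expf_neq0.
Qed.

Lemma drop_limE T : 0 < T -> T < 1 ->
  drop_lim m T = sinw T ^+ 2 / (m.+3.+2%:R * T ^+ 2 * (1 + T) * vol).
Proof.
move=> T0 T1; have v' : vol' != 0 by rewrite gt_eqF// sphere_volume_gt0.
have v : vol != 0 by rewrite gt_eqF// sphere_volume_gt0.
have s0 : sinw T != 0 by rewrite gt_eqF// sinw_gt0// T1 andbT; lra.
have [n0 n2] : n%:R != 0 :> R /\ m.+3.+2%:R != 0 :> R by split; rewrite pnatr_eq0.
have E5 : sinw T ^+ m.+3.+2 = sinw T ^+ n * sinw T ^+ 2 by rewrite -exprD addn2.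
rewrite /drop_lim /drop_bound /cap_height E5; clear E5.
move: (n%:R : R) n0 (m.+3.+2%:R : R) n2 (left_const m T) (vol : R) v.
move: (vol' : R) v' (sinw T) s0 => v0 v0N s sN N NN N2 N2N L v vN.
have TN : T != 0 by rewrite gt_eqF.
have T1N : 1 + T != 0 by rewrite gt_eqF// addr_gt0.
by field; rewrite ?TN ?T1N ?N2N ?NN ?sN ?v0N ?vN expf_neq0.
Qed.

(* The radius [scale * N `^ (- n^-1)] minimises the sum of the two error terms;
   it is [cap_sin (rate N)] below. *)
Definition scale : R := (n%:R * vol / vol') `^ n%:R^-1.

(** All powers of N are expressed through y = [rate N], that is N^(-1/(4 n^2)): y^(2n) is
    N^(-1/(2n)) and its square is N^(-1/n). Limits in N thereby become continuity at y = 0. *)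
Definition cap_sin y : R := scale * (y ^+ (2 * n)) ^+ 2.

(** The total loss divided by N^(2 - 2/n). In the first term [left_const] contributes y^(-2n), but a
    positive power of y^(2n) survives, so this term vanishes at 0. *)
Definition ratio y : R := let T := sinw (cap_sin y) in
  2 * vol' * (vol^-1 * (2 ^+ n / n%:R)) ^+ 2 * (y ^+ (2 * n)) ^+ m.*2.+1 +
  (vol' * scale ^+ m.+1)^-1 * ((m.+1%:R * (1 - y))^-1 + (m.+3.+2%:R * T ^+ 3)^-1) +
  2 * (scale ^+ 2 / (m.+3.+2%:R * T ^+ 2 * (1 + T) * vol)).

Lemma scale_gt0 : 0 < scale.
Proof. by rewrite powR_gt0// divr_gt0 ?mulr_gt0 ?sphere_volume_gt0. Qed.

Lemma cap_ratio y : 0 < y -> y < 1 -> cap_sin y < 1 ->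
  let T := sinw (cap_sin y) in let w := y ^+ (2 * n) in
  (w ^+ (2 * n))^-1 * energy_lim m (1 - y) T + 2 * (w ^+ (2 * n))^-1 ^+ 2 * drop_lim m T =
  (w ^+ (4 * m.+2))^-1 * ratio y.
Proof.
move=> y0 y1 s1; cbv zeta.
have w0 : 0 < y ^+ (2 * n) by rewrite exprn_gt0.
have sg0 := scale_gt0.
have s0 : 0 < cap_sin y by rewrite mulr_gt0// exprn_gt0.
have s11 : -1 < cap_sin y < 1 by rewrite s1 andbT; lra.
have T0 : 0 < sinw (cap_sin y) by rewrite sinw_gt0.
have T1 : sinw (cap_sin y) < 1.
  by rewrite -[ltRHS]sqrtr1 ltr_sqrt// ltrBlDr ltrDl exprn_gt0.
rewrite energy_limE ?subr_gt0// drop_limE// sinw_sinw ?ltW// /ratio.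
have v' : vol' != 0 by rewrite gt_eqF// sphere_volume_gt0.
have v : vol != 0 by rewrite gt_eqF// sphere_volume_gt0.
have [n0 n1 n2] : [/\ n%:R != 0 :> R, m.+1%:R != 0 :> R & m.+3.+2%:R != 0 :> R].
  by split; rewrite pnatr_eq0.
rewrite /left_const (_ : 1 - (1 - y) = y); last by ring.
have yn : y ^+ (2 * n) = (y ^+ n) ^+ 2 by rewrite mulnC exprM.
rewrite /cap_sin (exprMn (m.+1)); set T := sinw _ in T0 *.
set Y := y ^+ n in yn *; have Y0 : 0 < Y by rewrite exprn_gt0.
set w := y ^+ (2 * n) in yn w0 *.
set W := w ^+ m.+1; have W0 : 0 < W by rewrite exprn_gt0.
have E1 : w ^+ (2 * n) = W ^+ 2 * w ^+ 4.
  by rewrite /W -exprM -exprD; congr (_ ^+ _); rewrite mulnC !mulSn; ring.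
have E2 : w ^+ (4 * m.+2) = W ^+ 4 * w ^+ 4.
  by rewrite /W -exprM -exprD; congr (_ ^+ _); ring.
have E3 : w ^+ m.*2.+1 = W ^+ 2 / w.
  by rewrite /W -exprM muln2 doubleS [in RHS]exprS mulrAC divff ?mul1r// gt_eqF.
have E4 : (w ^+ 2) ^+ m.+1 = W ^+ 2 by rewrite /W -(exprM w 2) -(exprM w m.+1) mulnC.
rewrite E1 E2 E3 E4 yn.
have TN : T != 0 by rewrite gt_eqF.
have T1N : 1 + T != 0 by rewrite gt_eqF// addr_gt0.
have YN : Y != 0 by rewrite gt_eqF.
have WN : W != 0 by rewrite gt_eqF.
have aN : scale != 0 by rewrite gt_eqF.
have y1N : 1 - y != 0 by rewrite gt_eqF// subr_gt0.
clear E1 E2 E3 E4 W0 yn w0 Y0 T1 T0 s11 s0 sg0 s1 y1 y0.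
clearbody W T Y.
move: (scale) aN (2 ^+ n : R) => a aN p2.
move: (n%:R : R) n0 (m.+1%:R : R) n1 (m.+3.+2%:R : R) n2 (vol : R) v (vol' : R) v'.
move=> N NN N1 N1N N2 N2N v vN u uN.
by field; rewrite ?TN ?T1N ?YN ?WN ?y1N ?NN ?N1N ?N2N ?vN ?uN expf_neq0.
Qed.

Lemma cvg_ratio : ratio y @[y --> (0 : R)] --> ratio 0.
Proof.
have cp k : (fun y : R => y ^+ k) @ (0 : R) --> (0 : R) ^+ k by exact: exprn_continuous.
have cpow (g : R -> R) (g0 : R) k : g y @[y --> (0 : R)] --> g0 ->
    g y ^+ k @[y --> (0 : R)] --> g0 ^+ k.
  by move=> cg; exact: (cvg_comp _ _ cg (@exprn_continuous _ k g0)).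
have c1 : cap_sin y @[y --> (0 : R)] --> cap_sin 0.
  by apply: cvgMr; apply: (cpow (fun y => y ^+ (2 * n)) _ 2); exact: cp.
have cT : sinw (cap_sin y) @[y --> (0 : R)] --> sinw (cap_sin 0).
  exact: (cvg_comp _ _ c1 (@continuous_sinw _ (cap_sin 0))).
have T0 : sinw (cap_sin 0) = 1.
  by rewrite /cap_sin mulnC exprM expr0n /= !expr0n /= mulr0 /sinw expr0n /= subr0 sqrtr1.
have n2 : m.+3.+2%:R != 0 :> R by rewrite pnatr_eq0.
have v : vol != 0 by rewrite gt_eqF// sphere_volume_gt0.
apply: cvgD; first apply: cvgD.
- by apply: cvgMr; apply: (cpow (fun y => y ^+ (2 * n))); exact: cp.
- apply: cvgMr; apply: cvgD.
  + apply: cvgV; first by rewrite subr0 mulr1 pnatr_eq0.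
    by apply: cvgMr; apply: cvgB; [exact: cvg_cst|exact: cvg_id].
  + apply: cvgV; first by rewrite T0 expr1n mulr1.
    by apply: cvgMr; exact: cpow.
- apply: cvgMr; apply: cvgMr; apply: cvgV.
    by rewrite T0 expr1n mulr1 !mulf_neq0// pnatr_eq0.
  apply: cvgMl; apply: cvgM; first by apply: cvgMr; exact: cpow.
  by apply: cvgD => //; exact: cvg_cst.
Qed.

(** At 0 there remain scale^(2 - n) / V_(n-1) times 1/(n - 2) + 1/(n + 2), and scale^2 / ((n + 2)
    V_n). By scale^n = n V_n / V_(n-1) they add up to n scale^2 / ((n^2 - 4) V_n). *)
Lemma ratio0 : ratio 0 = n%:R `^ (1 + 2 / n%:R) /
  ((n%:R ^+ 2 - 4) * vol `^ (1 - 2 / n%:R) * vol' `^ (2 / n%:R)).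
Proof.
have v0 := sphere_volume_gt0 m.+3 : 0 < vol.
have v0' := sphere_volume_gt0 m.+2 : 0 < vol'.
have T0 : sinw (cap_sin 0) = 1.
  by rewrite /cap_sin mulnC exprM expr0n /= !expr0n /= mulr0 /sinw expr0n /= subr0 sqrtr1.
have nn0 : 0 < n%:R :> R by rewrite ltr0n.
have an : scale ^+ n = n%:R * vol / vol'.
  rewrite -powR_mulrn ?ltW ?scale_gt0// /scale -powRrM mulVf ?gt_eqF// powRr1//.
  by rewrite divr_ge0 ?mulr_ge0// ltW.
have a2 : scale ^+ 2 * vol' `^ (2 / n%:R) = n%:R `^ (2 / n%:R) * vol `^ (2 / n%:R).
  rewrite -powR_mulrn ?ltW ?scale_gt0// /scale -powRrM (mulrC _^-1).
  have h : 0 <= n%:R * vol / vol' by rewrite divr_ge0 ?mulr_ge0// ltW.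
  by rewrite -(powRM _ h (ltW v0')) divfK ?gt_eqF// powRM// ltW.
have sg0 := scale_gt0.
have a2' : scale ^+ m.+1 = n%:R * vol / vol' / scale ^+ 2.
  by rewrite -an -[in RHS]addn2 exprD mulfK// gt_eqF// exprn_gt0.
have E1 : n%:R `^ (1 + 2 / n%:R) = n%:R * n%:R `^ (2 / n%:R) :> R.
  by rewrite powRD ?powRr1// ?ltW// gt_eqF// implybT.
have E2 : vol `^ (1 - 2 / n%:R) = vol / vol `^ (2 / n%:R).
  by rewrite powRB ?powRr1// ?ltW// (gt_eqF v0) implybT.
rewrite /ratio T0 E1 E2 a2' !expr1n subr0 !mulr1.
rewrite [y in y ^+ m.*2.+1](_ : _ = 0); last by rewrite expr0n.
rewrite expr0n /= mulr0 add0r.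
have q1 := powR_gt0 (2 / n%:R) v0; have q2 := powR_gt0 (2 / n%:R) v0'.
move: a2 q1 q2; set A := n%:R `^ _; set B := vol `^ _; set B' := vol' `^ _ => a2 q1 q2.
have -> : A = scale ^+ 2 * B' / B by rewrite a2 mulfK// gt_eqF.
have [N1 N2 N4] : [/\ m.+1%:R = n%:R - 2 :> R, m.+3.+2%:R = n%:R + 2 :> R &
   n%:R ^+ 2 - 4 = m.+1%:R * m.+3.+2%:R :> R].
  by split; rewrite -!natr1; ring.
have N1N : n%:R - 2 != 0 :> R by rewrite -N1 pnatr_eq0.
have N2N : n%:R + 2 != 0 :> R by rewrite -N2 pnatr_eq0.
rewrite N4 N1 N2.
have [aN vN uN bN b'N] : [/\ scale != 0, vol != 0, vol' != 0, B != 0 & B' != 0].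
  by split; rewrite gt_eqF.
have nN : n%:R != 0 :> R by rewrite gt_eqF.
clearbody A B B'; clear a2 an a2' E1 E2 N1 N2 N4 T0 q1 q2 sg0.
move: (n%:R : R) nN N1N N2N scale aN (vol : R) vN (vol' : R) uN {nn0 v0 v0'}.
move=> N NN N1N N2N a aN v vN u uN.
by field; rewrite ?NN ?N1N ?N2N ?aN ?vN ?uN ?bN ?b'N.
Qed.

(* [1 - rate N] tends to 1 slowly enough for [left_const (1 - rate N)] to give a
   negligible contribution to [energy_lim]. *)
Definition rate (N : nat) : R := N%:R `^ (- (4 * n%:R ^+ 2)^-1).

Lemma rate_gt0 N : (0 < N)%N -> 0 < rate N.
Proof. by move=> N0; rewrite powR_gt0// ltr0n. Qed.

Lemma cvg_rate : rate N @[N --> \oo] --> (0 : R).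
Proof.
apply/cvgrPdist_le => e e0.
have c0 : 0 < 4 * n%:R ^+ 2 :> R by rewrite mulr_gt0// exprn_gt0// ltr0n.
near=> N; have N0 : 0 < N%:R :> R by rewrite ltr0n; near: N; exact: nbhs_infty_gt.
rewrite sub0r normrN ger0_norm ?powR_ge0// /rate powRN.
rewrite -[leRHS]invrK lef_pV2 ?posrE ?invr_gt0 ?powR_gt0//.
have h : (e^-1) `^ (4 * n%:R ^+ 2) <= N%:R by near: N; exact: nbhs_infty_ger.
have : ((e^-1) `^ (4 * n%:R ^+ 2)) `^ (4 * n%:R ^+ 2)^-1 <= N%:R `^ (4 * n%:R ^+ 2)^-1.
  by apply: ge0_ler_powR => //; rewrite ?nnegrE ?powR_ge0 ?invr_ge0 ?ltW.
by rewrite -powRrM mulfV ?gt_eqF// powRr1// invr_ge0 ltW.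
Unshelve. all: by end_near. Qed.

Lemma rate_pow N k : (0 < N)%N ->
  (rate N ^+ (2 * n)) ^+ k = N%:R `^ (- (k%:R / (2 * n%:R))).
Proof.
move=> N0; have r0 := ltW (rate_gt0 N0).
rewrite -exprM -powR_mulrn// /rate -powRrM; congr (_ `^ _).
have n0 : n%:R != 0 :> R by rewrite pnatr_eq0.
by rewrite !natrM; move: (n%:R : R) n0 => x x0; field; rewrite x0.
Qed.

Lemma rate_inv N : (0 < N)%N -> ((rate N ^+ (2 * n)) ^+ (2 * n))^-1 = N%:R.
Proof.
move=> N0; rewrite rate_pow// -powRN opprK natrM divff ?powRr1//.
Qed.

Lemma rate_inv2 N : (0 < N)%N ->
  ((rate N ^+ (2 * n)) ^+ (4 * m.+2))^-1 = N%:R `^ (2 - 2 / n%:R).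
Proof.
move=> N0; rewrite rate_pow// -powRN opprK natrM; congr (_ `^ _).
have n0 : n%:R != 0 :> R by rewrite pnatr_eq0.
rewrite (_ : m.+2%:R = n%:R - 1); last by rewrite -[in RHS]natr1 addrK.
by move: (n%:R : R) n0 => x x0; field; rewrite x0.
Qed.

Definition cap_loss N (t1 T : R) : R :=
  N%:R * energy_lim m t1 T + 2 * N%:R ^+ 2 * drop_lim m T.

Definition good_cap (t1 T : R) := [&& 0 < t1, t1 <= T & T < 1].

(** For small N the optimal cap may be inadmissible; the fallback at 1/2 makes the bound hold for
    every N without affecting the asymptotics. *)
Definition best_loss N : R :=
  let t1 := 1 - rate N in let T := sinw (cap_sin (rate N)) in
  if good_cap t1 T then cap_loss N t1 T else cap_loss N 2^-1 2^-1.

Lemma green_energy_best_loss G N (p : 'I_N -> V) :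
  is_green_function G -> injective p -> (forall i, sphere n (p i)) ->
  - best_loss N <= green_energy G p.
Proof.
move=> HG injp p1; rewrite /best_loss /cap_loss; case: ifPn => [/and3P[? ? ?]|_].
  by rewrite opprD; exact: green_energy_cap.
by rewrite opprD; apply: green_energy_cap => //; lra.
Qed.

Lemma near_best_loss : \forall N \near \oo,
  best_loss N = N%:R `^ (2 - 2 / n%:R) * ratio (rate N).
Proof.
(* Below 1/2 the value of [rate N] leaves t1 positive; below 1 / [scale] it bounds [cap_sin], which
   gives t1 <= T through 1 - s <= sinw s. *)
have d0 : 0 < Num.min 2^-1 scale^-1.
  by rewrite lt_min !invr_gt0 scale_gt0 ltr0n.
have /cvgrPdist_lt /(_ _ d0) h := cvg_rate.
near=> N.
have N0 : (0 < N)%N by near: N; exact: nbhs_infty_gt.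
have y0 := rate_gt0 N0.
have : `|0 - rate N| < Num.min 2^-1 scale^-1 by near: N; exact: h.
set y := rate N in y0 *.
rewrite sub0r normrN gtr0_norm// lt_min => /andP[y2 ys].
have sg0 := scale_gt0.
have ay : scale * y <= 1 by rewrite -ler_pdivlMl// mulr1 ltW.
have s0 : 0 < cap_sin y by rewrite mulr_gt0// !exprn_gt0.
have sy : cap_sin y <= y.
  (* As 4 n = 2 + (4 m + 10), one factor y absorbs [scale], one is kept, and the others are at most
     1. *)
  rewrite /cap_sin -exprM (_ : 2 * n * 2 = (2 + (4 * m + 10)))%N; last by ring.
  rewrite exprD expr2 mulrA mulrA -[leRHS]mulr1; apply: ler_pM.
  - by rewrite !mulr_ge0// ltW.
  - by rewrite exprn_ge0// ltW.
  - by rewrite -[leRHS]mul1r ler_wpM2r// ltW.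
  - by rewrite exprn_ile1// ?ltW//; lra.
have T1 : sinw (cap_sin y) < 1.
  by rewrite -[ltRHS]sqrtr1 ltr_sqrt// ltrBlDr ltrDl exprn_gt0.
have tT : 1 - y <= sinw (cap_sin y).
  by apply: le_trans (sinw_ge1B (ltW s0) _); lra.
rewrite /best_loss -/y /good_cap subr_gt0 tT T1 andbT.
rewrite (_ : y < 1); last by lra.
rewrite -rate_inv2// -/y -cap_ratio//; [|lra|lra].
by rewrite /cap_loss /y rate_inv.
Unshelve. all: by end_near. Qed.

End asymptotics.

Theorem theorem4p2 (R : realType) (n : nat) (hn : (3 <= n)%N) :
  exists r : nat -> R,
    r =o_\oo (fun N : nat => N%:R `^ (2 - 2 / n%:R)) /\
    forall G : 'rV[R]_n.+1 -> 'rV[R]_n.+1 -> R, is_green_function G ->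
    forall (N : nat) (p : 'I_N -> 'rV[R]_n.+1),
      injective p -> (forall i, sphere n (p i)) ->
      green_energy G p >=
        - (n%:R `^ (1 + 2 / n%:R) /
           ((n%:R ^+ 2 - 4) * sphere_volume n `^ (1 - 2 / n%:R) *
            sphere_volume n.-1 `^ (2 / n%:R))) *
          N%:R `^ (2 - 2 / n%:R)
        + r N.
Proof.
case: n hn => [|[|[|m]]]// _; rewrite -pred_Sn.
set C := _ / (_ * _).
(* The remainder is the exact difference between the main term and the loss, so the inequality holds
   for every N and only its order of growth is asymptotic. *)
exists (fun N => C * N%:R `^ (2 - 2 / m.+3%:R) - best_loss m N); split; last first.
  move=> G HG N p injp p1; rewrite mulNr addKr.
  exact: green_energy_best_loss.
have C0 : C = ratio m 0 by rewrite ratio0.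
apply/eqoP => e e0.
have /cvgrPdist_le /(_ e e0) h : ratio m (@rate R m N) @[N --> \oo] --> C.
  by rewrite C0; exact: (cvg_comp _ _ (@cvg_rate R m) (@cvg_ratio R m)).
have b := @near_best_loss R m.
apply: filterS2 b h => N -> h.
by rewrite mulrC -mulrBr normrM mulrC ler_wpM2r.
Qed.
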